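(* Let $P$ be a monic polynomial of degree $n\ge2$. Then $\Phi_P(t)$ and $|E_P(t)|$ are continuous functions of $t\in(-\infty,+\infty)$. Moreover, if $P$ is non-trivial (i.e. $P$ is not of the form $(z-a)^n$ with $a\in\mathbb{C}$), then: A) $\Phi_P(t)$ and $|E_P(t)|$ are strictly convex in each regular interval $(T_{j-1},T_j)$, $1\le j\le\nu$; B) the following asymptotic behavior holds: $$\lim_{t\to+\infty}\Phi_P(t)=\ln 2\pi .$$
   Context: For a polynomial $P$ and real $t$, $E_P(t)=\{z\in\mathbb{C}:\ln|P(z)|=t\}$ and $|E_P(t)|$ denotes its length. For $P$ monic of degree $n$ the indicator of $P$ is $\Phi_P(t):=\ln|E_P(t)|-\frac{t}{n}$. Let $T_1<\ldots<T_{\nu-1}$ be the set of all finite critical values of $\ln|P|$, i.e. the distinct numbers $\ln|P(\zeta)|$ with $P'(\zeta)=0$, $P(\zeta)\ne0$, and put $T_0=-\infty$, $T_\nu=+\infty$. The intervals $(T_{j-1},T_j)$, $1\le j\le\nu$, are called regular with respect to $P$. *)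

(* Defs.v *)
From HB Require Import structures.
From mathcomp Require Import all_boot all_order all_algebra.
From mathcomp Require Import complex.
From mathcomp Require Import finmap.
From mathcomp Require Import all_classical all_reals all_analysis.

Set Implicit Arguments.
Unset Strict Implicit.
Unset Printing Implicit Defensive.
Import Order.TTheory GRing.Theory Num.Theory.
Import numFieldNormedType.Exports.

Local Open Scope classical_set_scope.
Local Open Scope ring_scope.
Local Open Scope complex_scope.

Section Length.
Variable R : realType.
Implicit Types (A : set R[i]) (d : R).

(* Adjoining 0 makes the diameter of the empty set 0 instead of -oo. *)
Definition diam A : \bar R :=
  ereal_sup (0%E |` [set (ComplexField.Normc.normc (x - y))%:E
                    | x in A & y in A]).

Definition hausdorff1_pre d A : \bar R :=
  ereal_inf [set (\sum_(0 <= k <oo) diam (U k))%E | U in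
    [set U : nat -> set R[i] |
      A `<=` \bigcup_k U k /\ forall k, (diam (U k) <= d%:E)%E]].

(* One-dimensional Hausdorff (outer) measure on the plane. With the weight
   diam(U)^1 and no further constant it agrees with arc length on rectifiable
   simple arcs. The supremum over d > 0 is the limit as d tends to 0. *)
Definition hausdorff1 A : \bar R :=
  ereal_sup [set hausdorff1_pre d A | d in [set d | 0 < d]].

End Length.

Section Lemniscates.
Variable R : realType.
Implicit Types (P : {poly R[i]}) (t : R).

(* The extended logarithm is used because ln 0 = 0 in the library, so that the
   zeros of P would otherwise belong to the level t = 0; lne 0 = -oo. *)
Definition lemniscate P t : set R[i] :=
  [set z | lne (ComplexField.Normc.normc P.[z])%:E = t%:E].

Definition lemniscate_length P t : R := fine (hausdorff1 (lemniscate P t)).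

Definition indicator_fun P t : R :=
  ln (lemniscate_length P t) - t / (size P).-1%:R.

Definition critical_value_set P : set R :=
  [set ln (ComplexField.Normc.normc P.[z]) | z in
    [set z : R[i] | P^`().[z] = 0 /\ P.[z] != 0]].

Definition critical_values P : seq R :=
  sort <=%R (enum_fset (fset_set (critical_value_set P))).

(* fset_set returns the empty set on infinite sets; this does not happen
   for the critical values of a nonconstant polynomial. *)
Lemma finite_critical_value_set P :
  (1 < size P)%N -> finite_set (critical_value_set P).
Proof.
move=> sP; apply: finite_image.
have P'0 : P^`() != 0.
  have [n sPE] : exists n, size P = n.+2.
    by case: (size P) sP => [|[|n]] // _; exists n.
  apply/eqP => /(congr1 (fun q : {poly R[i]} => q`_n)).
  rewrite coef_deriv coef0 => /eqP; rewrite mulrn_eq0/= => /eqP lc0.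
  have : lead_coef P = 0 by rewrite /lead_coef sPE.
  by move=> /eqP; rewrite lead_coef_eq0 => /eqP P0; rewrite P0 size_poly0 in sPE.
have [r Pr] := closed_field_poly_normal P^`().
apply: (@sub_finite_set _ _ [set` r]); last exact: finite_seq.
move=> z [/eqP + _] /=; rewrite -rootE Pr rootZ ?lead_coef_eq0//.
by rewrite root_prod_XsubC.
Qed.

Lemma mem_critical_values P x : (1 < size P)%N ->
  x \in critical_values P <-> critical_value_set P x.
Proof.
move=> sP; rewrite /critical_values mem_sort.
have -> : (x \in enum_fset (fset_set (critical_value_set P))) =
  (x \in critical_value_set P).
  exact: in_fset_set (finite_critical_value_set sP) x.
by split=> [/set_mem|/mem_set].
Qed.

Lemma sorted_critical_values P : sorted <%R (critical_values P).
Proof. by rewrite sort_lt_sorted; exact: fset_uniq. Qed.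

(* T_0 = -oo, T_1 < ... < T_(nu - 1) the critical values, T_nu = +oo. *)
Definition crit_level P (j : nat) : \bar R :=
  nth +oo%E (-oo%E :: [seq x%:E | x <- critical_values P]) j.

Definition num_regular P : nat := (size (critical_values P)).+1.

Definition regular_interval P (j : nat) : set R :=
  [set t | (crit_level P j.-1 < t%:E)%E /\ (t%:E < crit_level P j)%E].

Definition strictly_convex_on (D : set R) (f : R -> R) : Prop :=
  forall x y l : R, D x -> D y -> x != y -> 0 < l < 1 ->
    f (l * x + (1 - l) * y) < l * f x + (1 - l) * f y.

End Lemniscates.

(* Main.v *)
Require Import Defs.
From HB Require Import structures.
From mathcomp Require Import all_boot all_order all_algebra.
From mathcomp Require Import complex separable.
From mathcomp Require Import all_classical all_reals all_analysis measurable_realfun.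
From mathcomp Require Import ring lra zify.
Import Order.TTheory GRing.Theory Num.Theory.
Import numFieldNormedType.Exports.
Local Open Scope classical_set_scope.
Local Open Scope ring_scope.
Local Open Scope complex_scope.

Set Implicit Arguments.
Unset Strict Implicit.
Unset Printing Implicit Defensive.

(** Parametrise the level curve [|P| = exp t] by the argument [u] of [P]. Since
    [|dz| = |P / P'| du], its length is the integral over the circle of the density
      [level_density P t u = \sum_(P z = exp (t + i u)) |P z / P' z|].
    For the Hausdorff measure this is proved from both sides by coverings
    ([hausdorff1_level_curve]): away from the critical arguments [P] is almost a
    similarity on small discs, so it maps a small piece of the curve of diameter [delta]
    to an arc of length about [|P'| * delta], and the neighbourhoods of the
    critical points contribute arbitrarily little, because an [n]-th root controls
    the distance to a fibre ([fiber_near]).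

    Continuity. The inequality [lojasiewicz] bounds [1 / |P'|] by a multiple of
    the power [1/n - 1] of the distance of [u] to the critical arguments. This
    bound is integrable and locally uniform in [t], even across critical levels,
    so dominated convergence applies to the integral.

    Strict convexity. Locally [z] is an analytic function [G] of [s = t + i u], where
    [exp s = P z], and each term of the density is [|G' s|]. For real [c] the function
    [|exp (- c s) G' s|] is subharmonic with Laplacian [|exp (- c s) G' s| * |G''/G' - c|^2].
    Comparing it with its mean over four points at distance [rho]
    ([density_second_difference]) and integrating over the circle, where the two
    shifts in [u] disappear by periodicity, shows that the second difference in [t]
    of [exp (- c t)] times the length is positive
    ([level_integral_second_difference]). This holds for every slope [c], which is
    strict convexity of the logarithm of the length ([strict_log_convexity]), and
    hence of the length. Equality would require [G''/G'] to be constant,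
    that is [(1 - c) P'^2 = P P''], and comparing leading terms at a root and at
    infinity shows that then [P] is a power of a linear polynomial
    ([power_of_log_deriv_eq]).

    Asymptotics. On a high level all distances to zeros and critical points are
    [exp (t / n) + O(1)], so each of the [n] terms of the density is
    [exp (t / n) / n * (1 + o(1))] ([level_density_bounds]). *)

Notation normc := ComplexField.Normc.normc.

(** * The modulus of complex numbers and estimates for polynomials *)

Section ComplexNorm.
Variable R : realType.
Local Notation C := R[i].
Implicit Types (x y z : C).

Lemma normc_ge0 x : 0 <= normc x.
Proof. by case: x => a b /=; exact: sqrtr_ge0. Qed.

Lemma normc_eq0 x : (normc x == 0) = (x == 0).
Proof.
apply/eqP/eqP => [|->]; first exact: ComplexField.Normc.eq0_normc.
exact: ComplexField.Normc.normc0.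
Qed.

Lemma normc_gt0 x : (0 < normc x) = (x != 0).
Proof. by rewrite lt_neqAle normc_ge0 andbT eq_sym normc_eq0. Qed.

Lemma normc0 : normc (0 : C) = 0.
Proof. exact: ComplexField.Normc.normc0. Qed.

Lemma normc1 : normc (1 : C) = 1.
Proof. exact: ComplexField.Normc.normc1. Qed.

Lemma normcM x y : normc (x * y) = normc x * normc y.
Proof. exact: ComplexField.Normc.normcM. Qed.

Lemma normcD x y : normc (x + y) <= normc x + normc y.
Proof. exact: (@le_normcD R). Qed.

Lemma normc_opp x : normc (- x) = normc x.
Proof. exact: (@normcN R). Qed.

Lemma normc_subC x y : normc (x - y) = normc (y - x).
Proof. by rewrite -normc_opp opprB. Qed.

Lemma normcB x y : normc (x - y) <= normc x + normc y.
Proof. by rewrite -[normc y]normc_opp normcD. Qed.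

Lemma normc_dist z x y : normc (x - y) <= normc (x - z) + normc (z - y).
Proof. by rewrite -[x - y](subrKA z) normcD. Qed.

Lemma normcX x k : normc (x ^+ k) = normc x ^+ k.
Proof. by elim: k => [|k IH]; rewrite ?normc1// !exprS normcM IH. Qed.

Lemma normcV x : normc x^-1 = (normc x)^-1.
Proof. exact: ComplexField.Normc.normcV. Qed.

Lemma normc_real (a : R) : normc a%:C = `|a|.
Proof. by rewrite /= expr0n/= addr0 sqrtr_sqr. Qed.

Lemma normc_i : normc ('i : C) = 1.
Proof. by rewrite /= expr0n/= add0r expr1n sqrtr1. Qed.

Lemma normc_nat k : normc (k%:R : C) = k%:R.
Proof. by rewrite -(rmorph_nat (real_complex R)) normc_real normr_nat. Qed.

Lemma normcMn x k : normc (x *+ k) = normc x *+ k.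
Proof. by rewrite -mulr_natr normcM normc_nat mulr_natr. Qed.

Lemma lerB_normc x y : normc x - normc y <= normc (x - y).
Proof. by rewrite lerBlDr -{1}[x](subrK y) normcD. Qed.

Lemma dist_normc x y : `|normc x - normc y| <= normc (x - y).
Proof. by rewrite ler_norml lerB_normc andbT lerNl opprB normc_subC lerB_normc. Qed.

Lemma normc_prod (I : Type) (s : seq I) (f : I -> C) :
  normc (\prod_(i <- s) f i) = \prod_(i <- s) normc (f i).
Proof. exact: (big_morph (@normc R) normcM normc1). Qed.

Lemma normc_sum (I : Type) (s : seq I) (f : I -> C) :
  normc (\sum_(i <- s) f i) <= \sum_(i <- s) normc (f i).
Proof.
elim: s => [|i s IH]; first by rewrite !big_nil normc0.
by rewrite !big_cons (le_trans (normcD _ _))// lerD2l.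
Qed.

Lemma sqr_normc_ReIm x : normc x ^+ 2 = complex.Re x ^+ 2 + complex.Im x ^+ 2.
Proof. by case: x => a b /=; rewrite sqr_sqrtr// addr_ge0 ?sqr_ge0. Qed.

Lemma Re_le_normc x : `|complex.Re x| <= normc x.
Proof.
rewrite -(ler_pXn2r (n := 2)) ?nnegrE ?normc_ge0// sqr_normc_ReIm real_normK ?num_real//.
by rewrite lerDl sqr_ge0.
Qed.

Lemma Im_le_normc x : `|complex.Im x| <= normc x.
Proof.
rewrite -(ler_pXn2r (n := 2)) ?nnegrE ?normc_ge0// sqr_normc_ReIm real_normK ?num_real//.
by rewrite lerDr sqr_ge0.
Qed.

Lemma ReD x y : complex.Re (x + y) = complex.Re x + complex.Re y.
Proof. by case: x; case: y. Qed.

Lemma ImD x y : complex.Im (x + y) = complex.Im x + complex.Im y.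
Proof. by case: x; case: y. Qed.

End ComplexNorm.

#[global] Arguments ComplexField.Normc.normc : simpl never.

Section Polar.
Variable R : realType.
Local Notation C := R[i].
Implicit Types (s t u v : R).

Definition cexp t u : C := (expR t * cos u) +i* (expR t * sin u).

Lemma normc_cexp t u : normc (cexp t u) = expR t.
Proof.
by rewrite /normc/= !exprMn -mulrDr cos2Dsin2 mulr1 sqrtr_sqr ger0_norm// expR_ge0.
Qed.

Lemma cexpD s t u v : cexp (s + t) (u + v) = cexp s u * cexp t v.
Proof.
apply/eqP; rewrite eq_complex /= expRD cosD sinD.
by apply/andP; split; apply/eqP; ring.
Qed.

Lemma cexp2pi t u : cexp t (u + pi *+ 2) = cexp t u.
Proof. by rewrite /cexp cosD2pi sinD2pi. Qed.

Lemma cexp_polar (w : C) : w != 0 ->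
  exists2 u, 0 <= u <= pi *+ 2 & w = cexp (ln (normc w)) u.
Proof.
move=> w0; have n0 : 0 < normc w by rewrite normc_gt0.
have nE : expR (ln (normc w)) = normc w by rewrite lnK// posrE.
set c := complex.Re w / normc w.
have c1 : -1 <= c <= 1.
  rewrite -ler_norml normrM normfV (ger0_norm (ltW n0)) ler_pdivrMr// mul1r.
  exact: Re_le_normc.
have cK : normc w * c = complex.Re w by rewrite mulrC divfK// gt_eqF.
have sE : normc w * sin (acos c) = `|complex.Im w|.
  rewrite sin_acos// -{1}(ger0_norm (ltW n0)) -sqrtr_sqr -sqrtrM ?sqr_ge0//.
  by rewrite mulrBr mulr1 -exprMn cK sqr_normc_ReIm addrAC subrr add0r sqrtr_sqr.
have a0 := acos_ge0 c1; have a1 := acos_lepi c1.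
have cac : cos (acos c) = c by rewrite acosK// in_itv.
have pi0 := @pi_ge0 R.
have [Im0|Im0] := leP 0 (complex.Im w).
  exists (acos c).
    by rewrite a0/= (le_trans a1)// mulr2n lerDl.
  apply/eqP; rewrite eq_complex /cexp/= nE cac cK sE ger0_norm//.
  by rewrite !eqxx.
exists (- acos c + pi *+ 2).
  by rewrite addrC subr_ge0 gerBl a0 andbT (le_trans a1)// mulr2n lerDl.
apply/eqP; rewrite cexp2pi eq_complex /cexp/= nE cosN sinN cac cK mulrN sE ltr0_norm//.
by rewrite opprK !eqxx.
Qed.

End Polar.

Section PolyEstimates.
Variable R : realType.
Local Notation C := R[i].
Implicit Types (P : {poly C}) (x y z : C) (M : R).

Lemma poly_bounded P M : exists2 K, 0 < K &
  forall z, normc z <= M -> normc P.[z] <= K.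
Proof.
elim/poly_ind: P => [|P c [K K0 HK]].
  by exists 1 => // z _; rewrite horner0 normc0.
exists (K * `|M| + normc c + 1).
  by rewrite ltr_wpDl// addr_ge0 ?normc_ge0// mulr_ge0// ltW.
move=> z zM; rewrite hornerMXaddC (le_trans (normcD _ _))// -addrA lerD//.
  rewrite normcM ler_pM ?normc_ge0 ?HK//.
  by rewrite (le_trans zM) ?ler_norm.
by rewrite lerDl.
Qed.

Lemma poly_lipschitz P M : exists2 K, 0 < K &
  forall x y, normc x <= M -> normc y <= M ->
    normc (P.[x] - P.[y]) <= K * normc (x - y).
Proof.
elim/poly_ind: P => [|P c [K K0 HK]].
  by exists 1 => // x y _ _; rewrite !horner0 subrr normc0 mul1r normc_ge0.
have [B B0 HB] := poly_bounded P M.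
exists (K * `|M| + B).
  by rewrite ltr_wpDl// mulr_ge0// ltW.
move=> x y xM yM; rewrite !hornerMXaddC.
have -> : P.[x] * x + c - (P.[y] * y + c) = (P.[x] - P.[y]) * x + P.[y] * (x - y).
  by ring.
rewrite (le_trans (normcD _ _))// !normcM mulrDl lerD//; last first.
  by rewrite ler_wpM2r ?normc_ge0// HB.
rewrite mulrAC ler_pM ?normc_ge0 ?HK//.
by rewrite (le_trans xM) ?ler_norm.
Qed.

Lemma poly_two_point P M : exists2 K, 0 < K &
  forall x y z, normc x <= M -> normc y <= M -> normc z <= M ->
    normc (P.[x] - P.[y] - P^`().[z] * (x - y)) <=
      K * normc (x - y) * (normc (x - z) + normc (y - z)).
Proof.
elim/poly_ind: P => [|P c [K K0 HK]].
  exists 1 => // x y z _ _ _; rewrite deriv0 !horner0 subrr mul0r subr0 normc0.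
  by rewrite mul1r mulr_ge0 ?addr_ge0 ?normc_ge0.
have [B B0 HB] := poly_lipschitz P M.
exists (K * `|M| + B *+ 2).
  by rewrite ltr_wpDl ?mulrn_wgt0// mulr_ge0// ltW.
move=> x y z xM yM zM; rewrite derivMXaddC !hornerMXaddC hornerD hornerMX.
have -> : P.[x] * x + c - (P.[y] * y + c) - (P.[z] + P^`().[z] * z) * (x - y) =
    (P.[x] - P.[y] - P^`().[z] * (x - y)) * z + (P.[x] - P.[y]) * (x - z) +
    (P.[y] - P.[z]) * (x - y).
  by ring.
rewrite (le_trans (normcD _ _))// (le_trans (lerD (normcD _ _) (lexx _)))// !normcM.
have h1 := HK x y z xM yM zM; have h2 := HB x y xM yM; have h3 := HB y z yM zM.
have zM' : normc z <= `|M| by rewrite (le_trans zM) ?ler_norm.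
have n1 := normc_ge0 (x - y); have n2 := normc_ge0 (x - z); have n3 := normc_ge0 (y - z).
set a := normc (P.[x] - P.[y] - _) in h1 *.
set b := normc (P.[x] - _) in h2 *; set e := normc (P.[y] - _) in h3 *.
have e1 : a * normc z <= K * normc (x - y) * (normc (x - z) + normc (y - z)) * `|M|.
  by rewrite ler_pM ?normc_ge0.
have e2 : b * normc (x - z) <= B * normc (x - y) * normc (x - z) by rewrite ler_wpM2r.
have e3 : e * normc (x - y) <= B * normc (y - z) * normc (x - y) by rewrite ler_wpM2r.
have e4 : 0 <= B * normc (x - y) * normc (y - z) by rewrite !mulr_ge0// ltW.
have e5 : 0 <= B * normc (x - y) * normc (x - z) by rewrite !mulr_ge0// ltW.
by rewrite mulr2n; lra.
Qed.

Lemma poly_taylor2 P M : exists2 K, 0 < K &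
  forall z y, normc z <= M -> normc y <= M ->
    normc (P.[z + y] - P.[z] - P^`().[z] * y - P^`()^`().[z] / 2%:R * y ^+ 2) <=
      K * normc y ^+ 3.
Proof.
elim/poly_ind: P => [|P c [K K0 HK]].
  exists 1 => // z y _ _; rewrite !deriv0 !horner0 !mul0r !subr0 normc0.
  by rewrite mul1r exprn_ge0 ?normc_ge0.
have [B B0 HB] := poly_bounded P^`()^`() M.
exists (K * (`|M| + `|M|) + B).
  by rewrite ltr_wpDl// mulr_ge0 ?addr_ge0// ltW.
move=> z y zM yM.
rewrite !derivMXaddC !derivD derivM derivX mulr1 !hornerMXaddC !hornerD !hornerMX.
have -> : P.[z + y] * (z + y) + c - (P.[z] * z + c) - (P.[z] + P^`().[z] * z) * y -
    (P^`().[z] + (P^`()^`().[z] * z + P^`().[z])) / 2%:R * y ^+ 2 =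
  (P.[z + y] - P.[z] - P^`().[z] * y - P^`()^`().[z] / 2%:R * y ^+ 2) * (z + y) +
  P^`()^`().[z] / 2%:R * y ^+ 3.
  by field.
rewrite (le_trans (normcD _ _))// [leRHS]mulrDl lerD//.
  rewrite normcM [leRHS]mulrAC; apply: ler_pM; rewrite ?normc_ge0//; first exact: HK.
  rewrite (le_trans (normcD _ _))// lerD//.
    by rewrite (le_trans zM)// ler_norm.
  by rewrite (le_trans yM)// ler_norm.
rewrite normcM normcX ler_wpM2r ?exprn_ge0 ?normc_ge0// normcM normcV normc_nat.
by rewrite (le_trans _ (HB z zM))// ler_piMr ?normc_ge0// invf_le1 ?ltr0n ?ler1n.
Qed.

End PolyEstimates.

(** * Fibres of a polynomial *)

Section Seq.

Lemma seq_min (R : realDomainType) (T : eqType) (s : seq T) (f : T -> R) :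
  (0 < size s)%N -> exists2 x, x \in s & forall y, y \in s -> f x <= f y.
Proof.
elim: s => [//|a [_ _|b s IH _]].
  by exists a; rewrite ?mem_head// => y; rewrite inE => /eqP ->.
have [//|x xs Hx] := IH.
have [fax|fxa] := leP (f a) (f x).
  exists a; first exact: mem_head.
  by move=> y; rewrite inE => /predU1P[->//|/Hx]; exact: le_trans.
exists x; first by rewrite inE xs orbT.
by move=> y; rewrite inE => /predU1P[->|/Hx//]; exact: ltW.
Qed.

Lemma exp_lt_prod (R : realDomainType) (T : eqType) (s : seq T) (f : T -> R) (e : R) :
  0 <= e -> (0 < size s)%N -> (forall x, x \in s -> e < f x) ->
  e ^+ size s < \prod_(x <- s) f x.
Proof.
move=> e0; elim: s => [//|a [_ _ H|b s IH _ H]].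
  by rewrite big_cons big_nil mulr1 expr1 H ?mem_head.
rewrite big_cons [size _]/= exprS.
have ltb : e ^+ size (b :: s) < \prod_(x <- b :: s) f x.
  by apply: IH => // x xs; apply: H; rewrite inE xs orbT.
by rewrite ltr_pM ?exprn_ge0// H ?mem_head.
Qed.

Lemma exp_le_prod (R : realDomainType) (T : eqType) (s : seq T) (f : T -> R) (e : R) :
  0 <= e -> (forall x, x \in s -> e <= f x) ->
  e ^+ size s <= \prod_(x <- s) f x.
Proof.
move=> e0; elim: s => [|a s IH H]; first by rewrite big_nil.
rewrite big_cons [size _]/= exprS ler_pM ?exprn_ge0 ?H ?mem_head//.
by apply: IH => x xs; apply: H; rewrite inE xs orbT.
Qed.

Lemma prod_le_exp (R : realDomainType) (T : eqType) (l : seq T) (f : T -> R) (e : R) :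
  (forall x, x \in l -> 0 <= f x <= e) -> \prod_(x <- l) f x <= e ^+ size l.
Proof.
elim: l => [|a l IH H]; first by rewrite big_nil.
have /andP[fa0 fae] := H a (mem_head _ _).
rewrite big_cons [size _]/= exprS ler_pM//.
  rewrite big_seq prodr_ge0// => x xl.
  by have /andP[] : 0 <= f x <= e by apply: H; rewrite inE xl orbT.
by apply: IH => x xl; apply: H; rewrite inE xl orbT.
Qed.

End Seq.

Section Fiber.
Variable R : realType.
Local Notation C := R[i].
Implicit Types (P : {poly C}) (w x y z : C).

Definition fiber P w : seq C := sval (closed_field_poly_normal (P - w%:P)).

Definition fiber_sum P (g : C -> R) w : R := \sum_(z <- fiber P w) g z.

Definition crit P : seq C := sval (closed_field_poly_normal P^`()).

Definition far P (eta : R) w :=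
  forall zeta, P^`().[zeta] = 0 -> eta <= normc (w - P.[zeta]).

Lemma normc_seq_bounded (s : seq C) :
  exists2 M : R, 0 <= M & forall z, z \in s -> normc z <= M.
Proof.
elim: s => [|a s [M M0 IH]]; first by exists 0.
exists (normc a + M); first by rewrite addr_ge0 ?normc_ge0.
move=> z; rewrite inE => /predU1P[->|/IH zM]; first by rewrite lerDl.
by rewrite (le_trans zM)// lerDr normc_ge0.
Qed.

Variables (n : nat) (P : {poly C}).
Hypothesis n_gt1 : (1 < n)%N.
Hypothesis P_monic : P \is monic.
Hypothesis P_size : size P = n.+1.

Let n_gt0 : (0 < n)%N. Proof. exact: ltnW. Qed.

Let size_lt w : (size (- w%:P)%R < size P)%N.
Proof. by rewrite size_polyN (leq_ltn_trans (size_polyC_leq1 _))// P_size. Qed.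

Lemma fiber_factor w : P - w%:P = \prod_(z <- fiber P w) ('X - z%:P).
Proof.
rewrite /fiber; case: closed_field_poly_normal => r /= {1}->.
by rewrite lead_coefDl// (monicP P_monic) scale1r.
Qed.

Lemma mem_fiber w z : (z \in fiber P w) = (P.[z] == w).
Proof.
by rewrite -root_prod_XsubC -fiber_factor /root hornerD hornerN hornerC subr_eq0.
Qed.

Lemma size_fiber w : size (fiber P w) = n.
Proof.
have := size_prod_XsubC (fiber P w) id.
by rewrite -fiber_factor size_polyDl// P_size => -[].
Qed.

Lemma horner_fiber w x : P.[x] - w = \prod_(z <- fiber P w) (x - z).
Proof.
have -> : P.[x] - w = (P - w%:P).[x] by rewrite hornerD hornerN hornerC.
rewrite fiber_factor horner_prod; apply: eq_bigr => z _.
by rewrite hornerXsubC.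
Qed.

Lemma fiber_uniq w :
  (forall z, P.[z] = w -> P^`().[z] != 0) -> uniq (fiber P w).
Proof.
move=> H; rewrite -separable_prod_XsubC -fiber_factor separable_poly.unlock.
apply/Pdiv.ClosedField.coprimepP => z.
rewrite {1}fiber_factor root_prod_XsubC mem_fiber => /eqP /H.
by rewrite derivB derivC subr0 /root.
Qed.

(** The product of the distances from [x] to the points of the fibre over [w] is
    [|P x - w|], so one of them is at most the [n]-th root of that number. *)
Lemma fiber_near w x e : 0 <= e -> normc (P.[x] - w) <= e ^+ n ->
  exists2 z, z \in fiber P w & normc (x - z) <= e.
Proof.
move=> e0 H; have sw := size_fiber w.
have [|z zw Hz] := @seq_min R _ (fiber P w) (fun z => normc (x - z)).
  by rewrite sw.
exists z => //; rewrite leNgt; apply/negP => ez.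
suff : e ^+ n < normc (P.[x] - w) by rewrite ltNge H.
rewrite horner_fiber normc_prod -{1}sw exp_lt_prod ?sw// => y yw.
exact: lt_le_trans ez (Hz y yw).
Qed.

Lemma fiber_bounded (B : R) :
  exists2 M, 0 < M & forall z, normc P.[z] <= B -> normc z <= M.
Proof.
have [M0 M00 HM0] := normc_seq_bounded (fiber P 0).
pose b := 1 + `|B|.
have b1 : 1 <= b by rewrite lerDl.
exists (M0 + b); first by rewrite ltr_wpDl// (lt_le_trans _ b1).
move=> z zB.
have [||x x0 zx] := @fiber_near 0 z b; first exact: le_trans b1.
  rewrite subr0 (le_trans zB)// (le_trans (ler_norm B))//.
  rewrite (@le_trans _ _ b)// ?lerDr//.
  by rewrite -{1}[b]expr1; exact: ler_weXn2l.
rewrite -[z](subrK x) (le_trans (normcD _ _))// addrC lerD//.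
exact: HM0.
Qed.

Lemma nR_neq0 : n%:R != 0 :> C.
Proof. by rewrite pnatr_eq0 -lt0n. Qed.

Let coef_n : P`_n = 1.
Proof. by have := monicP P_monic; rewrite lead_coefE P_size. Qed.

Lemma size_deriv_monic : size P^`() = n.
Proof.
have P0 : P != 0 by rewrite -size_poly_gt0 P_size.
apply/eqP; rewrite eqn_leq -ltnS -P_size lt_size_deriv//= leqNgt; apply/negP => lt.
have : P^`()`_n.-1 = 0 by rewrite nth_default// -ltnS prednK.
by rewrite coef_deriv prednK// coef_n => /eqP; rewrite (negPf nR_neq0).
Qed.

Lemma deriv_lead : lead_coef P^`() = n%:R.
Proof. by rewrite lead_coefE size_deriv_monic coef_deriv prednK// coef_n. Qed.

Lemma deriv_factor : P^`() = n%:R *: \prod_(z <- crit P) ('X - z%:P).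
Proof.
rewrite /crit; case: closed_field_poly_normal => r /= {1}->.
by rewrite deriv_lead.
Qed.

Lemma size_crit : size (crit P) = n.-1.
Proof.
have := size_deriv_monic; rewrite deriv_factor size_scale ?nR_neq0//.
by rewrite size_prod_XsubC => <-.
Qed.

Lemma mem_crit z : (z \in crit P) = (P^`().[z] == 0).
Proof.
by rewrite deriv_factor hornerZ mulf_eq0 (negPf nR_neq0)/= -rootE root_prod_XsubC.
Qed.

Lemma normc_deriv z : normc P^`().[z] = n%:R * \prod_(c <- crit P) normc (z - c).
Proof.
rewrite deriv_factor hornerZ normcM normc_nat horner_prod normc_prod.
by congr (_ * _); apply: eq_bigr => c _; rewrite hornerXsubC.
Qed.

(** Each of the terms, at most [2 ^ size s] in number, that make up the coefficient
    of ['X^i] is the product of all the [c] with [i] factors left out, and every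
    factor left out has modulus at least [D]. *)
Lemma coef_prod_le (s : seq C) (D : R) : 0 <= D ->
  (forall c, c \in s -> D <= normc c) -> forall i,
  normc (\prod_(c <- s) ('X + c%:P))`_i * D ^+ i <=
    2 ^+ size s * \prod_(c <- s) normc c.
Proof.
move=> D0; elim: s => [_ i|c s IH H i].
  rewrite !big_nil expr0 mulr1 coef1; case: i => [|i]; first by rewrite normc1 mul1r.
  by rewrite normc0 mul0r.
have {IH}IH := IH (fun c' cs => H c' (mem_behead (s := c :: s) cs)).
have Dc : D <= normc c by rewrite H ?mem_head.
rewrite !big_cons mulrDl coefD coefCM coefXM.
set A := \prod_(c <- s) _ in IH *; set p := \prod_(c <- s) _ in IH *.
have p0 : 0 <= 2 ^+ size s * p.
  by rewrite mulr_ge0 ?exprn_ge0// prodr_ge0// => *; exact: normc_ge0.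
have -> : 2 ^+ size (c :: s) * (normc c * p) =
  normc c * (2 ^+ size s * p) + normc c * (2 ^+ size s * p) by rewrite /= exprS; ring.
rewrite (le_trans (ler_wpM2r _ (normcD _ _))) ?exprn_ge0// mulrDl lerD//.
  case: i => [|i] /=; first by rewrite normc0 mul0r mulr_ge0 ?normc_ge0.
  by rewrite exprS mulrCA ler_pM// mulr_ge0 ?normc_ge0 ?exprn_ge0.
by rewrite normcM -mulrA ler_wpM2l ?normc_ge0.
Qed.

(** Taylor expansion at [z]: the coefficients of [P'] there are bounded in terms of
    its value [P' z], because [z] is at least as far from every critical point as
    from [zeta]. *)
Lemma deriv_controls_increment z zeta :
  (forall c, c \in crit P -> normc (z - zeta) <= normc (z - c)) ->
  normc (P.[z] - P.[zeta]) <= n%:R * 2 ^+ n.-1 * normc P^`().[z] * normc (z - zeta).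
Proof.
move=> H; set D := normc (z - zeta) in H *.
pose Q := P \Po ('X + z%:P).
have D0 : 0 <= D := normc_ge0 _.
have Q'E : Q^`() = n%:R *: \prod_(c <- [seq z - c | c <- crit P]) ('X + c%:P).
  rewrite /Q deriv_comp derivD derivX derivC addr0 mulr1 deriv_factor comp_polyZ.
  congr (_ *: _); rewrite big_map rmorph_prod; apply: eq_bigr => c _.
  by rewrite /= comp_polyB comp_polyX comp_polyC polyCB addrA.
have PQ x : P.[z + x] = Q.[x] by rewrite horner_comp !hornerE addrC.
have sQ : size Q = n.+1.
  by rewrite size_comp_poly2 ?P_size// size_XaddC.
have coefQ i : normc Q`_i.+1 * D ^+ i.+1 <= 2 ^+ n.-1 * normc P^`().[z] * D.
  rewrite exprSr mulrA ler_wpM2r//.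
  apply: (@le_trans _ _ (normc Q^`()`_i * D ^+ i)).
    rewrite ler_wpM2r ?exprn_ge0// coef_deriv normcMn.
    by rewrite -mulr_natr ler_peMr ?normc_ge0// ler1n.
  rewrite Q'E coefZ normcM normc_nat -[leLHS]mulrA normc_deriv [leRHS]mulrCA ler_wpM2l ?ler0n//.
  have Hm c : c \in [seq z - c | c <- crit P] -> D <= normc c.
    by move=> /mapP[d dP ->]; exact: H.
  have := coef_prod_le D0 Hm i.
  by rewrite size_map size_crit [X in _ <= _ * X]big_map.
rewrite normc_subC; have -> : P.[zeta] = Q.[zeta - z] by rewrite -PQ addrC subrK.
have -> : P.[z] = Q.[0] by rewrite -PQ addr0.
rewrite horner_coef0 horner_coef sQ big_ord_recl expr0 mulr1 addrC addKr.
rewrite (le_trans (normc_sum _ _))//.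
rewrite (@le_trans _ _ (\sum_(i < n) 2 ^+ n.-1 * normc P^`().[z] * D))//.
  apply: ler_sum => i _; rewrite normcM normcX lift0 normc_subC.
  exact: coefQ.
by rewrite sumr_const card_ord -[leLHS]mulr_natl !mulrA.
Qed.

(** A Lojasiewicz type inequality. If [zeta] is the critical point nearest to
    [z], then [P z - P zeta] is at most a constant times [P' z] times the distance
    of [z] and [zeta], and the power [n - 1] of that distance is itself bounded by
    [P' z]. The resulting exponent [(n - 1) / n] is less than [1], which is what
    makes [1 / P'] integrable along level curves through critical points. *)
Lemma lojasiewicz : exists2 kappa, 0 < kappa & forall z eta, 0 <= eta ->
  far P eta P.[z] -> kappa * eta ^+ n.-1 <= normc P^`().[z] ^+ n.
Proof.
pose K : R := n%:R * 2 ^+ n.-1.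
have K0 : 0 < K by rewrite mulr_gt0 ?exprn_gt0 ?ltr0n.
exists ((K ^+ n.-1)^-1); first by rewrite invr_gt0 exprn_gt0.
move=> z eta eta0 farz.
have [|zeta zc Hz] := @seq_min R _ (crit P) (fun c => normc (z - c)).
  by rewrite size_crit -ltnS prednK.
set D := normc (z - zeta) in Hz *.
have D0 : 0 <= D := normc_ge0 _.
have p0 : 0 <= normc P^`().[z] := normc_ge0 _.
have le1 : eta <= K * normc P^`().[z] * D.
  apply: le_trans (deriv_controls_increment Hz).
  by apply: farz; apply/eqP; rewrite -mem_crit.
have le2 : D ^+ n.-1 <= normc P^`().[z].
  rewrite normc_deriv -size_crit.
  apply: (@le_trans _ _ (\prod_(c <- crit P) normc (z - c))).
    by apply: exp_le_prod.
  rewrite ler_peMl ?ler1n// prodr_ge0// => *; exact: normc_ge0.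
rewrite ler_pdivrMl ?exprn_gt0//.
apply: (@le_trans _ _ ((K * normc P^`().[z] * D) ^+ n.-1)).
  by rewrite lerXn2r ?nnegrE// !mulr_ge0// ltW.
rewrite !exprMn -mulrA ler_wpM2l ?exprn_ge0 ?(ltW K0)//.
by rewrite -[in leRHS](prednK n_gt0) exprSr ler_wpM2l ?exprn_ge0.
Qed.

Lemma far_deriv eta : 0 < eta ->
  exists2 m, 0 < m & forall z, far P eta P.[z] -> m <= normc P^`().[z].
Proof.
move=> eta0; have [k k0 H] := lojasiewicz.
pose m := Num.min 1 (k * eta ^+ n.-1).
have m0 : 0 < m by rewrite lt_min ltr01 mulr_gt0 ?exprn_gt0.
exists m => // z /H - /(_ (ltW eta0)) {}H.
rewrite leNgt; apply/negP => zm.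
have p0 : 0 <= normc P^`().[z] := normc_ge0 _.
have p1 : normc P^`().[z] <= 1 by rewrite (le_trans (ltW zm))// ge_min lexx.
have : normc P^`().[z] < k * eta ^+ n.-1 by rewrite (lt_le_trans zm)// ge_min lexx orbT.
rewrite ltNge (le_trans H)//.
by rewrite -[in leRHS](expr1 (normc _)) ler_wiXn2l.
Qed.

Lemma far_shift eta w w0 : far P (eta + eta) w0 -> normc (w - w0) <= eta -> far P eta w.
Proof.
move=> H ww0 zeta /H {}H.
have := normc_dist w w0 P.[zeta]; rewrite [normc (w0 - w)]normc_subC => h.
by rewrite -(lerD2l eta) (le_trans H)// (le_trans h)// lerD2r.
Qed.

Lemma farS eta eta' w : eta' <= eta -> far P eta w -> far P eta' w.
Proof. by move=> ee' H zeta /H; exact: le_trans. Qed.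

Lemma far_exists w : (forall zeta, P^`().[zeta] = 0 -> P.[zeta] != w) ->
  exists2 eta, 0 < eta & far P eta w.
Proof.
move=> H.
have [|zeta zc Hz] := @seq_min R _ (crit P) (fun c => normc (w - P.[c])).
  by rewrite size_crit -ltnS prednK.
exists (normc (w - P.[zeta])).
  rewrite normc_gt0 subr_eq0 eq_sym H//.
  by apply/eqP; rewrite -mem_crit.
by move=> c /eqP; rewrite -mem_crit => /Hz.
Qed.

(** Strict differentiability, with an error relative to [P' z] and a radius that is
    uniform over a bounded set of values [P z] away from the critical ones. *)
Lemma near_linear (B eta e : R) : 0 < eta -> 0 < e ->
  exists2 r, 0 < r & forall z x y, normc P.[z] <= B -> far P eta P.[z] ->
    normc (x - z) <= r -> normc (y - z) <= r ->
    normc (P.[x] - P.[y] - P^`().[z] * (x - y)) <=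
      e * normc P^`().[z] * normc (x - y).
Proof.
move=> eta0 e0; have [m m0 Hm] := far_deriv eta0.
have [M M0 HM] := fiber_bounded B.
have [K K0 HK] := poly_two_point P (M + 1).
pose r := Num.min 1 (e * m / (K *+ 2)).
have r0 : 0 < r by rewrite lt_min ltr01 divr_gt0 ?mulr_gt0// pmulrn_lgt0.
exists r => // z x y /HM zM /Hm mz xz yz.
have bnd u : normc (u - z) <= r -> normc u <= M + 1.
  move=> uz; rewrite -[u](subrK z) (le_trans (normcD _ _))// addrC lerD//.
  by rewrite (le_trans uz)// ge_min lexx.
have zM1 : normc z <= M + 1 by rewrite (le_trans zM)// lerDl.
apply: (le_trans (HK x y z (bnd _ xz) (bnd _ yz) zM1)).
rewrite mulrAC ler_wpM2r ?normc_ge0//.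
apply: (@le_trans _ _ (e * m)); last by rewrite ler_wpM2l// ltW.
apply: (@le_trans _ _ (K * (r + r))); first by rewrite ler_wpM2l ?(ltW K0)// lerD.
have : r <= e * m / (K *+ 2) by rewrite /r ge_min lexx orbT.
rewrite ler_pdivlMr ?pmulrn_lgt0// mulr2n => h; lra.
Qed.

Lemma far_uniq eta w : 0 < eta -> far P eta w -> uniq (fiber P w).
Proof.
move=> eta0 H; apply: fiber_uniq => z Pz; apply/eqP => /H.
by rewrite Pz subrr normc0 leNgt eta0.
Qed.

(** Each point of one fibre has a point of the other within [r], because the
    product of its distances to that other fibre is [w - w0]. Near a
    point where [P'] is not small [P] is injective on the scale [r], so this
    assignment is injective; the two fibres have the same cardinality [n]. *)
Lemma fiber_matching (B eta : R) : 0 < eta ->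
  exists2 r0, 0 < r0 & forall r w0 w, 0 <= r <= r0 -> normc w0 <= B -> normc w <= B ->
    far P eta w0 -> far P eta w -> normc (w - w0) <= r ^+ n ->
    exists2 phi : C -> C, perm_eq [seq phi y | y <- fiber P w0] (fiber P w) &
      forall y, y \in fiber P w0 -> normc (y - phi y) <= r.
Proof.
move=> eta0.
have half0 : 0 < 2^-1 :> R by rewrite invr_gt0.
have [r0 r00 Hr] := near_linear B eta0 half0.
have [m m0 Hm] := far_deriv eta0.
exists r0 => // r w0 w /andP[rge0 rr0] w0B wB fw0 fw ww0.
pose phi y := nth 0 (fiber P w) (find (fun x => normc (y - x) <= r) (fiber P w)).
have hasphi y : y \in fiber P w0 -> has (fun x => normc (y - x) <= r) (fiber P w).
  rewrite mem_fiber => /eqP Py.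
  have [//||x xw yx] := @fiber_near w y r; first by rewrite Py normc_subC.
  by apply/hasP; exists x.
have phi1 y : y \in fiber P w0 -> normc (y - phi y) <= r.
  by move=> /hasphi; exact: nth_find.
have phi2 y : y \in fiber P w0 -> phi y \in fiber P w.
  by move=> /hasphi h; apply: mem_nth; rewrite -has_find.
exists phi => //.
have phi_inj : {in fiber P w0 &, injective phi}.
  move=> y y' yw0 y'w0 e.
  have := phi1 _ y'w0; have := phi1 _ yw0; have := phi2 _ yw0; rewrite -e.
  rewrite mem_fiber => /eqP Px; set x := phi y in Px * => h1 h2.
  have fx : far P eta P.[x] by rewrite Px.
  have := Hr x y y'; rewrite Px => /(_ wB fw (le_trans h1 rr0) (le_trans h2 rr0)).
  have -> : P.[y] - P.[y'] = 0.
    by move: yw0 y'w0; rewrite !mem_fiber => /eqP -> /eqP ->; rewrite subrr.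
  rewrite sub0r normc_opp normcM => h.
  have px : 0 < normc P^`().[x] := lt_le_trans m0 (Hm _ fx).
  apply/eqP; rewrite -subr_eq0 -normc_eq0 eq_le normc_ge0 andbT leNgt; apply/negP => h0.
  move: h; rewrite ler_pM2r// ler_pMl// => ?; lra.
have um : uniq [seq phi y | y <- fiber P w0].
  by rewrite map_inj_in_uniq// (far_uniq eta0).
apply: uniq_perm => //; first exact: far_uniq fw.
have sub : {subset [seq phi y | y <- fiber P w0] <= fiber P w}.
  by move=> x /mapP[y yw ->]; exact: phi2.
have [|_ //] := uniq_min_size um sub.
by rewrite size_map !size_fiber.
Qed.

Lemma fiber_sum_continuous (g : C -> R) w0 :
  (forall zeta, P^`().[zeta] = 0 -> P.[zeta] != w0) ->
  (forall z, P.[z] = w0 -> forall e, 0 < e -> exists2 d, 0 < d &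
     forall x, normc (x - z) <= d -> `|g x - g z| <= e) ->
  forall e, 0 < e -> exists2 d, 0 < d &
    forall w, normc (w - w0) <= d -> `|fiber_sum P g w - fiber_sum P g w0| <= e.
Proof.
move=> /far_exists[eta2 eta20 feta2] gc e e0.
have nR0 : 0 < n%:R :> R by rewrite ltr0n.
have [d d0 Hd] : exists2 d, 0 < d & forall z, z \in fiber P w0 ->
    forall x, normc (x - z) <= d -> `|g x - g z| <= e / n%:R.
  have : forall z, z \in fiber P w0 -> P.[z] = w0 by move=> z; rewrite mem_fiber => /eqP.
  elim: (fiber P w0) => [_|a s IH Hs]; first by exists 1.
  have [|d1 d10 H1] := IH; first by move=> z zs; apply: Hs; rewrite inE zs orbT.
  have [d2 d20 H2] := gc a (Hs _ (mem_head _ _)) (e / n%:R) (divr_gt0 e0 nR0).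
  exists (Num.min d1 d2); first by rewrite lt_min d10.
  move=> z; rewrite inE => /predU1P[->|zs] x; rewrite le_min => /andP[h1 h2].
    exact: H2.
  exact: (H1 z zs).
pose eta := eta2 / 2.
have eta0 : 0 < eta by rewrite divr_gt0.
have etaE : eta + eta = eta2 by rewrite /eta -splitr.
have [r0 r00 Hr0] := fiber_matching (normc w0 + eta) eta0.
pose r := Num.min r0 d.
have rp : 0 < r by rewrite lt_min r00.
exists (Num.min eta (r ^+ n)); first by rewrite lt_min eta0 exprn_gt0.
move=> w; rewrite le_min => /andP[ww1 ww2].
have [||||||phi ph1 ph2] := Hr0 r w0 w.
- by rewrite (ltW rp) ge_min lexx.
- by rewrite lerDl ltW.
- by rewrite -[w](subrK w0) (le_trans (normcD _ _))// addrC lerD2l.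
- by apply: farS feta2; rewrite -etaE lerDl ltW.
- by apply: far_shift ww1; rewrite etaE.
- exact: ww2.
rewrite /fiber_sum -(perm_big _ ph1)/= big_map -sumrB.
rewrite (le_trans (ler_norm_sum _ _ _))//.
rewrite big_seq (@le_trans _ _ (\sum_(z <- fiber P w0 | z \in fiber P w0) e / n%:R))//.
  apply: ler_sum => z zw; apply: Hd => //.
  by rewrite normc_subC (le_trans (ph2 _ zw))// ge_min lexx orbT.
rewrite -big_seq big_const_seq count_predT size_fiber iter_addr addr0.
by rewrite -[leLHS]mulr_natr divfK// gt_eqF.
Qed.

End Fiber.

(** * Chords of a circle and a singular integral *)

Section RealEstimates.
Variable R : realType.
Implicit Types (x t u v : R).

Lemma increment_le (f df : R -> R) (K r : R) (k : nat) : f 0 = 0 -> 0 <= K ->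
  (forall x, is_derive x 1 f (df x)) ->
  (forall x, `|x| <= r -> `|df x| <= K * `|x| ^+ k) ->
  forall x, `|x| <= r -> `|f x| <= K * `|x| ^+ k.+1.
Proof.
move=> f0 K0 dF Hdf x xr.
have cf : continuous f.
  move=> y; apply: differentiable_continuous; apply/derivable1_diffP.
  exact: (@ex_derive _ _ _ _ _ _ _ (dF y)).
have aux a b : a <= b -> exists2 c, a <= c <= b & f b - f a = df c * (b - a).
  move=> ab; have [c|c cab ->] := @MVT_segment R f df a b ab (fun y _ => dF y).
    exact: continuous_subspaceT.
  by exists c => //; move: cab; rewrite in_itv.
have [c cx fE] : exists2 c, `|c| <= `|x| & `|f x| = `|df c| * `|x|.
  have [x0|x0] := leP 0 x.
    have [c /andP[c0 cx]] := aux _ _ x0; rewrite f0 !subr0 => ->.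
    by exists c; rewrite ?normrM// !ger0_norm// (le_trans c0).
  have [c /andP[c0 cx]] := aux _ _ (ltW x0); rewrite f0 !sub0r => e.
  exists c; first by rewrite !ler0_norm ?(ltW x0)// lerN2.
  by rewrite -normrN e normrM normrN.
rewrite fE exprSr mulrA ler_wpM2r//.
apply: (le_trans (Hdf c (le_trans cx xr))).
by rewrite ler_wpM2l// lerXn2r ?nnegrE.
Qed.

Lemma sin_le x : `|sin x| <= `|x|.
Proof.
rewrite -[leRHS]expr1 -[leRHS]mul1r; apply: (@increment_le sin cos _ `|x| 0) => //.
  exact: sin0.
by move=> y _; rewrite expr0 mulr1 cos_max.
Qed.

Lemma cos_sub1_le x : `|cos x - 1| <= `|x| ^+ 2.
Proof.
rewrite -[leRHS]mul1r; apply: (@increment_le (fun y => cos y - 1) (fun y => - sin y) 1 `|x| 1) => //; first by rewrite cos0 subrr.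
- by move=> y; apply: is_derive_eq; rewrite subr0.
- by move=> y _; rewrite normrN mul1r expr1 sin_le.
Qed.

Lemma sin_subx_le x : `|sin x - x| <= `|x| ^+ 3.
Proof.
rewrite -[leRHS]mul1r; apply: (@increment_le (fun y => sin y - y) (fun y => cos y - 1) 1 `|x| 2) => //; first by rewrite sin0 subrr.
by move=> y _; rewrite mul1r cos_sub1_le.
Qed.

Lemma cos_taylor2 x : `|cos x - 1 + x ^+ 2 / 2| <= `|x| ^+ 4.
Proof.
rewrite -[leRHS]mul1r; apply: (@increment_le (fun y => cos y - 1 + y ^+ 2 / 2) (fun y => - (sin y - y)) 1 `|x| 3) => //; first by rewrite cos0 subrr expr0n mul0r addr0.
- move=> y; apply: is_derive_eq; rewrite /GRing.scale/=; by field.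
- by move=> y _; rewrite normrN mul1r sin_subx_le.
Qed.

Lemma expR_taylor2 x : `|x| <= 1 -> `|expR x - 1 - x - x ^+ 2 / 2| <= expR 1 * `|x| ^+ 3.
Proof.
move=> x1; have E0 : 0 <= expR 1 :> R := expR_ge0 1.
have h0 (y : R) : `|y| <= 1 -> `|expR y - 1| <= expR 1 * `|y| ^+ 1.
  apply: (@increment_le (fun y => expR y - 1) expR (expR 1) 1 0) => //.
  - by rewrite expR0 subrr.
  - by move=> z; apply: is_derive_eq; rewrite subr0.
  - move=> z z1; rewrite expr0 mulr1 ger0_norm ?expR_ge0// ler_expR.
    exact: le_trans (ler_norm z) z1.
have h1 (y : R) : `|y| <= 1 -> `|expR y - 1 - y| <= expR 1 * `|y| ^+ 2.
  apply: (@increment_le (fun y => expR y - 1 - y) (fun y => expR y - 1) (expR 1) 1 1) => //.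
  - by rewrite expR0 !subrr.
  - by move=> z; apply: is_derive_eq; rewrite subr0.
apply: (@increment_le (fun y => expR y - 1 - y - y ^+ 2 / 2) (fun y => expR y - 1 - y) (expR 1) 1 2) => //.
- by rewrite expR0 !subrr expr0n/= mul0r subrr.
- by move=> z; apply: is_derive_eq; rewrite /GRing.scale/=; by field.
Qed.

Lemma chord t u v :
  normc (cexp t u - cexp t v) = expR t * (2 * `|sin ((u - v) / 2)|).
Proof.
have e0 := expR_ge0 t.
apply/eqP; rewrite -(@eqrXn2 _ 2) ?normc_ge0 ?mulr_ge0//; apply/eqP.
rewrite sqr_normc_ReIm /cexp /= -!mulrBr !exprMn -mulrDr; congr (_ * _).
rewrite real_normK ?num_real//.
have -> : (cos u - cos v) ^+ 2 + (sin u - sin v) ^+ 2 =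
  (cos u ^+ 2 + sin u ^+ 2) + (cos v ^+ 2 + sin v ^+ 2) -
   2 * (cos u * cos v + sin u * sin v) by ring.
rewrite !cos2Dsin2 -cosB.
have -> : cos (u - v) = cos ((u - v) / 2) ^+ 2 *+ 2 - 1.
  by rewrite -cos_mulr2n; congr cos; rewrite mulr2n; by field.
have := cos2Dsin2 ((u - v) / 2) => h.
set c := cos _ in h *; set s := sin _ in h *.
have -> : s ^+ 2 = 1 - c ^+ 2 by rewrite -h; ring.
ring.
Qed.

Lemma chord_le t u v : normc (cexp t u - cexp t v) <= expR t * `|u - v|.
Proof.
rewrite chord ler_wpM2l ?expR_ge0//.
have := sin_le ((u - v) / 2); rewrite [`|(u - v) / 2|]normrM normfV (@ger0_norm _ 2)//.
by lra.
Qed.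

Lemma chord_ge_near t u v (e : R) : 0 < e < 1 -> `|u - v| <= e ->
  (1 - e) * (expR t * `|u - v|) <= normc (cexp t u - cexp t v).
Proof.
move=> /andP[e0 e1] uve; rewrite chord mulrCA ler_wpM2l ?expR_ge0//.
set d := `|u - v| in uve *.
have d0 : 0 <= d := normr_ge0 _.
have dE : `|(u - v) / 2| = d / 2 by rewrite normrM normfV (@ger0_norm _ 2).
have := sin_subx_le ((u - v) / 2); rewrite dE => h1.
have h2 : d / 2 - `|sin ((u - v) / 2)| <= `|sin ((u - v) / 2) - (u - v) / 2|.
  by rewrite -dE distrC lerB_dist.
have h3 : (d / 2) ^+ 3 <= e * (d / 2).
  rewrite exprSr ler_wpM2r ?divr_ge0// expr2.
  have : d / 2 * (d / 2) <= e / 2 * (e / 2) by rewrite ler_pM ?divr_ge0// ?ler_pM2r.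
  have : e * e <= e * 1 by rewrite ler_pM2l// ltW.
  have : e / 2 * (e / 2) = e * e / 4 by field.
  move: e0 => /ltW; lra.
set s := `|sin _| in h2 *; lra.
Qed.

Lemma sin_ge_lin x : 0 <= x <= pi / 2 -> x / 8 <= sin x.
Proof.
move=> /andP[x0 xp].
have small (y : R) : 0 <= y <= 2^-1 -> y / 2 <= sin y.
  move=> /andP[y0 y1]; have := sin_subx_le y; rewrite ler_norml (ger0_norm y0) => /andP[h _].
  have : y ^+ 3 <= y / 2.
    rewrite exprS ler_wpM2l// expr2.
    have : y * y <= 2^-1 * 1 by rewrite ler_pM//; lra.
    lra.
  lra.
have [xh|xh] := leP x 2^-1.
  have := small x; rewrite x0 xh => /(_ isT); lra.
have p2 := @pihalf_lt2 R; have p1 := @pihalf_ge1 R.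
have s1 : 2^-1 / 2 <= sin 2^-1 :> R by apply: small; rewrite lexx invr_ge0 ler0n.
have s2 : sin 2^-1 <= sin x :> R.
  by apply: ltW; rewrite ltr_sin ?in_itv//=; apply/andP; split; lra.
lra.
Qed.

(** Both arcs between the two points have to be long, since the circle closes up. *)
Lemma chord_ge t u v (eta : R) : 0 <= eta -> eta <= `|u - v| ->
  eta <= pi *+ 2 - `|u - v| ->
  expR t * (eta / 8) <= normc (cexp t u - cexp t v).
Proof.
move=> eta0 h1 h2; rewrite chord ler_wpM2l ?expR_ge0//.
set d := `|u - v| in h1 h2.
have d0 : 0 <= d := normr_ge0 _.
have sE : `|sin ((u - v) / 2)| = `|sin (d / 2)|.
  rewrite /d; have [uv|uv] := leP 0 (u - v); first by rewrite (ger0_norm uv).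
  by rewrite (ltr0_norm uv) mulNr sinN normrN.
rewrite sE mulr2n in h2 *.
have p1 := @pihalf_ge1 R.
have [dp|dp] := leP (d / 2) (pi / 2).
  have := @sin_ge_lin (d / 2); rewrite dp divr_ge0// => /(_ isT) h.
  have := ler_norm (sin (d / 2)); lra.
have sE2 : sin (d / 2) = sin (pi - d / 2).
  by rewrite sinB sinpi cospi mul0r sub0r mulN1r opprK.
have := @sin_ge_lin (pi - d / 2).
have -> : 0 <= pi - d / 2 <= pi / 2 :> bool by apply/andP; split; lra.
move=> /(_ isT); rewrite -sE2 => h.
have := ler_norm (sin (d / 2)); lra.
Qed.

End RealEstimates.

Section SingularIntegral.
Variable R : realType.
Local Notation mu := (@lebesgue_measure R).

Lemma measurable_norm_powR (tau a : R) (D : set R) :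
  measurable_fun D (fun x : R => `|x - tau| `^ a).
Proof.
apply: (@measurableT_comp _ _ _ _ _ _ (@powR R ^~ a)) => //.
by apply: measurableT_comp => //; exact: measurable_funB.
Qed.

(** The sign [s] of [x - tau] lets one primitive serve on both sides of [tau]. *)
Lemma integral_norm_powR_segment (tau a s c d : R) : 0 < a -> s * s = 1 -> c < d ->
  (forall x, c <= x <= d -> 0 < s * (x - tau)) ->
  (\int[mu]_(x in `[c, d]) (`|x - tau| `^ (a - 1))%:E)%E =
  (s / a * (s * (d - tau)) `^ a - s / a * (s * (c - tau)) `^ a)%:E.
Proof.
move=> a0 ss cd H.
pose F (x : R) := s / a * (s * (x - tau)) `^ a.
have dF x : c <= x <= d -> is_derive x 1 F (`|x - tau| `^ (a - 1)).
  move=> /H sx; rewrite /F.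
  have -> : `|x - tau| = s * (x - tau).
    rewrite -[LHS]mul1r -(gtr0_norm sx) normrM; congr (_ * _).
    have : `|s| * `|s| = 1 by rewrite -normrM ss normr1.
    move=> h; apply/esym/eqP; rewrite -(@eqrXn2 _ 2)//; first by rewrite expr2 h expr1n.
  have h1 : is_derive x 1 (fun x => s * (x - tau)) s.
    by apply: is_derive_eq; rewrite subr0 /GRing.scale/= mulr1.
  have h2 := @is_derive1_comp R (fun y => y `^ a) (fun x => s * (x - tau)) x _ _
    (is_derive1_powR a sx) h1.
  have h3 := @is_deriveZ R R R ((fun y => y `^ a) \o (fun x => s * (x - tau)))
    (s / a) x 1 _ h2.
  apply: (is_derive_eq h3); rewrite /GRing.scale/=.
  have -> : s / a * (a * (s * (x - tau)) `^ (a - 1) * s) =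
    s * s * (s * (x - tau)) `^ (a - 1) by field; rewrite gt_eqF.
  by rewrite ss mul1r.
have cF x : c <= x <= d -> {for x, continuous F}.
  move=> /dF h; apply: differentiable_continuous; apply/derivable1_diffP.
  exact: (@ex_derive _ _ _ _ _ _ _ h).
have cg x : c <= x <= d -> {for x, continuous (fun x => `|x - tau| `^ (a - 1))}.
  move=> /H sx.
  have nx : 0 < `|x - tau|.
    by rewrite normr_gt0; apply/eqP => e; move: sx; rewrite e mulr0 ltxx.
  apply: (@continuous_comp _ _ _ (fun x => `|x - tau|) (fun x => x `^ (a - 1))).
    apply: (@continuous_comp _ _ _ (fun x => x - tau) (fun x => `|x|)).
      by apply: cvgB; [exact: cvg_id|exact: cvg_cst].
    exact: norm_continuous.
  apply: differentiable_continuous; apply/derivable1_diffP.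
  exact: (@ex_derive _ _ _ _ _ _ _ (is_derive1_powR (a - 1) nx)).
rewrite (@continuous_FTC2 _ _ F)//.
- rewrite continuous_within_itvP//; split.
  + by move=> x; rewrite in_itv/= => /andP[cx xd]; apply: cg; rewrite !ltW.
  + by apply: cvg_at_right_filter; apply: cg; rewrite lexx ltW.
  + by apply: cvg_at_left_filter; apply: cg; rewrite lexx ltW.
- split.
  + move=> x; rewrite in_itv/= => /andP[cx xd].
    by apply: (@ex_derive _ _ _ _ _ _ _ (dF x _)); rewrite !ltW.
  + by apply: cvg_at_right_filter; apply: cF; rewrite lexx ltW.
  + by apply: cvg_at_left_filter; apply: cF; rewrite lexx ltW.
- move=> x; rewrite in_itv/= => /andP[cx xd].
  rewrite derive1E; apply: derive_val.
  by apply: dF; rewrite !ltW.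
Qed.

(** Removing shrinking intervals around [tau] leaves integrals that increase and stay
    below a fixed bound, because the primitive tends to [0] at [tau]. *)
Lemma integrable_norm_powR (tau a M : R) : 0 < a -> 0 < M ->
  mu.-integrable `[tau - M, tau + M] (EFin \o (fun x : R => `|x - tau| `^ (a - 1))).
Proof.
move=> a0 M0; set g := (fun x : R => _).
apply/integrableP; split.
  by apply/measurable_EFinP; exact: measurable_norm_powR.
have g0 x : 0 <= g x by exact: powR_ge0.
have -> : (\int[mu]_(x in `[(tau - M)%R, (tau + M)%R]) `|(EFin \o g) x| =
    \int[mu]_(x in `[(tau - M)%R, (tau + M)%R]) (EFin \o g) x)%E.
  by apply: eq_integral => x _ /=; rewrite ger0_norm.
pose ek (k : nat) : R := M / k.+2%:R.
have ek0 k : 0 < ek k by rewrite divr_gt0.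
have ekM k : ek k < M by rewrite ltr_pdivrMr// ltr_pMr// ltr1n.
pose Fk (k : nat) : set R := `[tau - M, tau - ek k] `|` `[tau + ek k, tau + M].
have Fk_le k : (\int[mu]_(x in Fk k) (g x)%:E <= (2 / a * M `^ a)%:E)%E.
  rewrite ge0_integral_setU//=; first last.
  - apply/eqP/seteqP; split => // x [/=]; rewrite !in_itv/= => /andP[_ h1] /andP[h2 _].
    have := ek0 k; lra.
  - by move=> x _; rewrite lee_fin.
  - by apply/measurable_EFinP; exact: measurable_norm_powR.
  rewrite (@integral_norm_powR_segment tau a (-1))//; first last.
  - by move=> x /andP[_ h]; have := ek0 k; lra.
  - by have := ekM k; lra.
  - by rewrite mulrNN mulr1.
  rewrite (@integral_norm_powR_segment tau a 1)//; first last.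
  - by move=> x /andP[h _]; have := ek0 k; lra.
  - by have := ekM k; lra.
  - by rewrite mulr1.
  rewrite -EFinD lee_fin.
  have -> : -1 * (tau - M - tau) = M by ring.
  have -> : 1 * (tau + M - tau) = M by ring.
  have -> : -1 * (tau - ek k - tau) = ek k by ring.
  have -> : 1 * (tau + ek k - tau) = ek k by ring.
  have : 0 <= 1 / a * ek k `^ a by rewrite mulr_ge0 ?powR_ge0// divr_ge0// ltW.
  rewrite !mulNr; set A := M `^ a; set B := ek k `^ a => h.
  have -> : 2 / a * A = 1 / a * A + 1 / a * A by field; rewrite gt_eqF.
  lra.
have mono : {homo Fk : n m / (n <= m)%N >-> (n <= m)%O}.
  move=> k l kl; apply/subsetPset => x.
  have ekl : ek l <= ek k by rewrite ler_wpM2l ?(ltW M0)// lef_pV2 ?posrE// ler_nat.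
  case=> /=; rewrite in_itv/= => /andP[h1 h2].
    by left; rewrite /= in_itv/= h1/= (le_trans h2)// lerB.
  by right; rewrite /= in_itv/= h2 andbT (le_trans _ h1)// lerD2l.
have := @ge0_nondecreasing_set_cvg_integral _ (measurableTypeR R) R Fk (EFin \o g) lebesgue_measure mono.
have mFk k : measurable (Fk k) by apply: measurableU; exact: measurable_itv.
move=> /(_ mFk) cvgF.
have UFk : \bigcup_k Fk k = `[tau - M, tau + M] `\ tau.
  apply/seteqP; split => x.
    move=> [k _] [] /=; rewrite !in_itv/= => /andP[h1 h2]; have h := ek0 k; have h' := ekM k.
      by split; [apply/andP; split; lra|lra].
    by split; [apply/andP; split; lra|lra].
  move=> [] /=; rewrite in_itv/= => /andP[h1 h2] /eqP xt.
  have dx : 0 < `|x - tau| by rewrite normr_gt0 subr_eq0.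
  have [k kP] : exists k, ek k <= `|x - tau|.
    exists (Num.bound (M / `|x - tau|)).
    rewrite /ek ler_pdivrMr// -ler_pdivrMl// mulrC.
    by rewrite (le_trans (ltW (archi_boundP (ltW (divr_gt0 M0 dx)))))// ler_nat -addn2 leq_addr.
  exists k => //; have [xt'|xt'] := leP x tau.
    left; rewrite /= in_itv/= h1/=; move: kP; rewrite ler0_norm ?subr_le0//; lra.
  right; rewrite /= in_itv/= h2 andbT; move: kP; rewrite gtr0_norm ?subr_gt0//; lra.
rewrite -(@integral_setD1 _ _ tau)//; [|exact: measurableD|]; last first.
  by apply/measurable_EFinP; exact: measurable_norm_powR.
rewrite -UFk.
have -> : (\int[mu]_(x in \bigcup_i Fk i) (EFin \o g) x)%E =
   limn (fun i => \int[mu]_(x in Fk i) (EFin \o g) x)%E.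
  apply/esym/cvg_lim => //; apply: cvgF.
  - by move=> i; apply/measurable_EFinP; exact: measurable_norm_powR.
  - by move=> i x _; rewrite lee_fin.
apply: (@le_lt_trans _ _ (2 / a * M `^ a)%:E); last by rewrite ltry.
apply: lime_le; last by apply: nearW => k; exact: Fk_le.
apply/cvg_ex; eexists; apply: cvgF.
- by move=> i; apply/measurable_EFinP; exact: measurable_norm_powR.
- by move=> i x _; rewrite lee_fin.
Qed.

End SingularIntegral.

(** * The density of the length in the argument of the polynomial *)

Section PlaneFilter.
Variable R : realType.
Local Notation C := R[i].

(** Neighbourhoods for the real-valued modulus, in terms of which the estimates
    above are stated. *)
Definition nbc (z : C) : set_system C :=
  [set A | exists2 d : R, 0 < d & forall x, normc (x - z) <= d -> A x].

Global Instance nbc_filter z : ProperFilter (nbc z).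
Proof.
split.
  by move=> [d d0 H]; apply: (H z); rewrite subrr normc0 ltW.
split.
- by exists 1.
- move=> A B [d d0 Hd] [e e0 He]; exists (Num.min d e); first by rewrite lt_min d0.
  by move=> x; rewrite le_min => /andP[xd xe]; split; [exact: Hd|exact: He].
- by move=> A B AB [d d0 Hd]; exists d => // x /Hd /AB.
Qed.

Lemma nbc_cvgP (g : C -> R) z (l : R) :
  (g x @[x --> nbc z] --> l) <->
  (forall e, 0 < e -> exists2 d, 0 < d & forall x, normc (x - z) <= d -> `|g x - l| <= e).
Proof.
split=> [/cvgrPdist_le H e /H [d d0 Hd]|H].
  by exists d => // x /Hd; rewrite distrC.
apply/cvgrPdist_le => e /H[d d0 Hd]; exists d => // x /Hd.
by rewrite /= distrC.
Qed.

Lemma normc_poly_cvg (Q : {poly C}) z :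
  normc Q.[x] @[x --> nbc z] --> normc Q.[z].
Proof.
apply/nbc_cvgP => e e0.
have [K K0 HK] := poly_lipschitz Q (normc z + 1).
exists (Num.min 1 (e / K)); first by rewrite lt_min ltr01 divr_gt0.
move=> x; rewrite le_min => /andP[x1 xe].
apply: (le_trans (dist_normc _ _)).
have xM : normc x <= normc z + 1.
  by rewrite -[x](subrK z) (le_trans (normcD _ _))// addrC lerD2l.
have zM : normc z <= normc z + 1 by rewrite lerDl.
apply: (le_trans (HK x z xM zM)).
by rewrite -ler_pdivlMl// mulrC.
Qed.

Lemma cexp_cvg_arg (t u : R) (A : set C) : nbc (cexp t u) A ->
  \forall v \near u, A (cexp t v).
Proof.
move=> [d d0 Hd]; exists (d / expR t) => /=; first by rewrite divr_gt0// expR_gt0.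
move=> v /=; rewrite distrC => uv; apply: Hd; rewrite (le_trans (chord_le _ _ _))//.
by rewrite -ler_pdivlMl ?expR_gt0// mulrC ltW.
Qed.

Lemma normc_cexpB (s t u : R) : normc (cexp s u - cexp t u) = `|expR s - expR t|.
Proof.
have -> : cexp s u - cexp t u = (expR s - expR t)%:C * cexp 0 u.
  by apply/eqP; rewrite eq_complex /= !expR0; apply/andP; split; apply/eqP; ring.
by rewrite normcM normc_real normc_cexp expR0 mulr1.
Qed.

Lemma cexp_cvg_mod (t u : R) (A : set C) : nbc (cexp t u) A ->
  \forall s \near t, A (cexp s u).
Proof.
move=> [d d0 Hd].
have /cvgrPdist_le/(_ d d0) := @continuous_expR R t.
apply: filterS => s h; apply: Hd.
by rewrite normc_cexpB distrC.
Qed.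

End PlaneFilter.

Section Density.
Variable R : realType.
Local Notation C := R[i].
Local Notation mu := (@lebesgue_measure R).
Implicit Types (P : {poly C}) (t u v tau eta : R).

(** The length element of the level curve [|P| = exp t] when its points are
    parametrised by the argument [u] of [P]. *)
Definition speed P (z : C) : R := normc P.[z] / normc P^`().[z].

Definition level_density P t u : R := fiber_sum P (speed P) (cexp t u).

Definition angle (w : C) : R :=
  get [set u | 0 <= u <= pi *+ 2 /\ w = cexp (ln (normc w)) u].

(* The endpoints are included so that arcs of [0, 2 pi] avoiding this list stay
   away from the point where the circle closes up. *)
Definition crit_angles P : seq R :=
  [:: 0, pi *+ 2 & [seq angle P.[c] | c <- crit P & P.[c] != 0]].

Definition regular_args P : set R :=
  `]0, pi *+ 2[ `\` [set` crit_angles P].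

Definition clear P eta u := forall tau, tau \in crit_angles P -> eta <= `|u - tau|.

Definition level_integral P t : R :=
  \int[mu]_(u in regular_args P) level_density P t u.

Lemma angleP (w : C) : w != 0 ->
  0 <= angle w <= pi *+ 2 /\ w = cexp (ln (normc w)) (angle w).
Proof.
move=> w0; have [u u1 u2] := cexp_polar w0.
by apply: (@getPex _ [set u | 0 <= u <= pi *+ 2 /\ w = cexp (ln (normc w)) u]); exists u.
Qed.

Lemma crit_angles_itv P tau : tau \in crit_angles P -> 0 <= tau <= pi *+ 2.
Proof.
have p0 : 0 <= pi *+ 2 :> R by rewrite mulrn_wge0// pi_ge0.
rewrite !inE => /or3P[/eqP->|/eqP->|]; rewrite ?lexx ?p0//.
by move=> /mapP[c]; rewrite mem_filter => /andP[c0 _] ->; case: (angleP c0).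
Qed.

Lemma closed_set_seq (s : seq R) : closed [set` s].
Proof.
have /accessible_finite_set_closed : accessible_space R.
  by apply: hausdorff_accessible; exact: Rhausdorff.
by apply; exact: finite_seq.
Qed.

Lemma open_regular_args P : open (regular_args P).
Proof.
apply: openI; first exact: interval_open.
by apply: closed_openC; exact: closed_set_seq.
Qed.

Lemma measurable_regular_args P : measurable (regular_args P).
Proof. by apply: open_measurable; exact: open_regular_args. Qed.

Lemma regular_args_itv P u : regular_args P u -> 0 <= u <= pi *+ 2.
Proof. by move=> [/=]; rewrite in_itv/= => /andP[/ltW -> /ltW ->]. Qed.

Lemma clear_nearest P u : exists2 tau, tau \in crit_angles P & clear P `|u - tau| u.
Proof. by have [//|tau h1 h2] := @seq_min R _ (crit_angles P) (fun tau => `|u - tau|); exists tau. Qed.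

Lemma clear_regular_args P u : regular_args P u -> exists2 eta, 0 < eta & clear P eta u.
Proof.
move=> [_ /= uD]; have [tau h1 h2] := clear_nearest P u.
exists `|u - tau| => //; rewrite normr_gt0 subr_eq0; apply/eqP => e.
by apply: uD; rewrite e.
Qed.

Lemma clear_regular P u eta : 0 <= u <= pi *+ 2 -> 0 < eta -> clear P eta u ->
  regular_args P u.
Proof.
move=> /andP[u0 u1] eta0 cl.
have ne tau : tau \in crit_angles P -> u != tau.
  by move=> /cl h; apply/eqP => e; move: h; rewrite e subrr normr0 leNgt eta0.
split => /=.
  by rewrite in_itv/= !lt_neqAle u0 u1 eq_sym !ne// ?inE ?eqxx ?orbT.
by move=> /ne; rewrite eqxx.
Qed.

Variables (n : nat) (P : {poly C}).
Hypothesis n_gt1 : (1 < n)%N.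
Hypothesis P_monic : P \is monic.
Hypothesis P_size : size P = n.+1.

Let n_gt0 : (0 < n)%N. Proof. exact: ltnW. Qed.

(** A nonzero critical value [v] is at distance [| |v| - exp t |] from the point of the circle
    with the same argument, which is at most its distance from [cexp t u]. So [v] is
    at least half as far from [cexp t u] as that point, and [chord_ge] applies. *)
Lemma far_cexp t u eta : 0 <= u <= pi *+ 2 -> 0 <= eta -> clear P eta u ->
  far P (expR t * (eta / 16)) (cexp t u).
Proof.
move=> /andP[u0 u1] eta0 cl zeta zc.
have e0 := expR_gt0 t.
have eta_u : eta <= u by have := cl 0; rewrite subr0 ger0_norm//; apply; rewrite inE eqxx.
have eta_2 : eta <= pi *+ 2 - u.
  have := cl (pi *+ 2); rewrite distrC ger0_norm ?subr_ge0//; apply.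
  by rewrite !inE eqxx orbT.
set w := cexp t u; set v := P.[zeta].
have [v0|v0] := eqVneq v 0.
  rewrite v0 subr0 normc_cexp ler_piMr ?ltW//.
  have := @pihalf_lt2 R; have : eta <= pi *+ 2 by rewrite (le_trans eta_u).
  rewrite mulr2n; lra.
have [/andP[tau0 tau1] vE] := angleP v0; set tau := angle v in tau0 tau1 vE.
have tauA : tau \in crit_angles P.
  rewrite !inE; apply/orP; right; apply/orP; right; apply/mapP; exists zeta => //.
  by rewrite mem_filter v0 (mem_crit n_gt1 P_monic P_size) zc eqxx.
have h1 : expR t * (eta / 8) <= normc (w - cexp t tau).
  apply: chord_ge => //; first exact: cl.
  have : `|u - tau| <= pi *+ 2 - eta; last by lra.
  by rewrite ler_norml; apply/andP; split; lra.
have h2 : normc (v - cexp t tau) <= normc (w - v).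
  rewrite vE normc_cexpB lnK ?posrE ?normc_gt0// -vE distrC -(normc_cexp t u).
  exact: dist_normc.
have := normc_dist v w (cexp t tau).
by move: h1 h2; set a := normc _; set b := normc _; set c := normc _; lra.
Qed.

Lemma regular_not_crit t u : regular_args P u ->
  forall zeta, P^`().[zeta] = 0 -> P.[zeta] != cexp t u.
Proof.
move=> uD zeta zc; have [eta eta0 cl] := clear_regular_args uD.
have := far_cexp t (regular_args_itv uD) (ltW eta0) cl zc.
move=> h; apply/eqP => e; move: h.
by rewrite e subrr normc0 leNgt mulr_gt0 ?expR_gt0// divr_gt0.
Qed.

Lemma speed_ge0 z : 0 <= speed P z.
Proof. by rewrite divr_ge0 ?normc_ge0. Qed.

Lemma fiber_sum_ge0 (g : C -> R) w : (forall z, 0 <= g z) -> 0 <= fiber_sum P g w.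
Proof. by move=> g0; rewrite /fiber_sum sumr_ge0. Qed.

Lemma level_density_ge0 t u : 0 <= level_density P t u.
Proof. by apply: fiber_sum_ge0; exact: speed_ge0. Qed.

Lemma speed_cvg z : P^`().[z] != 0 -> speed P x @[x --> nbc z] --> speed P z.
Proof.
move=> Pz; apply: cvgM; first exact: normc_poly_cvg.
by apply: cvgV; [rewrite normc_eq0|exact: normc_poly_cvg].
Qed.

Lemma fiber_sum_cvg (g : C -> R) w0 :
  (forall zeta, P^`().[zeta] = 0 -> P.[zeta] != w0) ->
  (forall z, P^`().[z] != 0 -> g x @[x --> nbc z] --> g z) ->
  fiber_sum P g w @[w --> nbc w0] --> fiber_sum P g w0.
Proof.
move=> nc gc; apply/nbc_cvgP; apply: (fiber_sum_continuous n_gt1 P_monic P_size nc).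
move=> z Pz; apply/nbc_cvgP; apply: gc.
by apply/eqP => /nc; rewrite Pz eqxx.
Qed.

Lemma fiber_sum_continuous_arg (g : C -> R) t u :
  (forall zeta, P^`().[zeta] = 0 -> P.[zeta] != cexp t u) ->
  (forall z, P^`().[z] != 0 -> g x @[x --> nbc z] --> g z) ->
  {for u, continuous (fun u => fiber_sum P g (cexp t u))}.
Proof.
by move=> nc gc A /(fiber_sum_cvg nc gc) /cexp_cvg_arg.
Qed.

Lemma fiber_sum_continuous_mod (g : C -> R) t u :
  (forall zeta, P^`().[zeta] = 0 -> P.[zeta] != cexp t u) ->
  (forall z, P^`().[z] != 0 -> g x @[x --> nbc z] --> g z) ->
  {for t, continuous (fun t => fiber_sum P g (cexp t u))}.
Proof.
by move=> nc gc A /(fiber_sum_cvg nc gc) /cexp_cvg_mod.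
Qed.

Lemma measurable_level_density t : measurable_fun (regular_args P) (level_density P t).
Proof.
apply: open_continuous_measurable_fun; first exact: open_regular_args.
move=> u; rewrite inE => uD.
by apply: fiber_sum_continuous_arg; [exact: regular_not_crit|exact: speed_cvg].
Qed.

(** An integrable function of the argument that dominates the density locally
    uniformly in the level. *)
Definition envelope u : R := \sum_(tau <- crit_angles P) `|u - tau| `^ (n%:R^-1 - 1).

Lemma envelope_ge0 u : 0 <= envelope u.
Proof. by apply: sumr_ge0 => *; exact: powR_ge0. Qed.

Lemma integrable_envelope : mu.-integrable (regular_args P) (EFin \o envelope).
Proof.
have -> : EFin \o envelope =
    (fun u => \sum_(tau <- crit_angles P) (`|u - tau| `^ (n%:R^-1 - 1))%:E)%E.
  by apply/funext => u /=; rewrite sumEFin.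
under eq_fun do rewrite big_seq.
apply: integrable_sum; first exact: measurable_regular_args.
move=> tau /crit_angles_itv /andP[tau0 tau1].
have p0 : 0 < pi *+ 2 :> R by rewrite mulrn_wgt0// pi_gt0.
apply: (@integrableS _ (measurableTypeR R) R lebesgue_measure
  (`[tau - pi *+ 2, tau + pi *+ 2]%classic : set R) (regular_args P)).
- exact: measurable_itv.
- exact: measurable_regular_args.
- move=> u /regular_args_itv /andP[u0 u1]; rewrite /= in_itv/=; apply/andP; split; lra.
- by apply: integrable_norm_powR => //; rewrite invr_gt0 ltr0n.
Qed.

Lemma integrable_envelopeZ K :
  mu.-integrable (regular_args P) (EFin \o (fun u => K * envelope u)).
Proof.
exact: (@integrableZl _ (measurableTypeR R) R lebesgue_measure _
  (measurable_regular_args P) K _ integrable_envelope).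
Qed.

(** By [far_cexp] the point [cexp t u] is at distance of order [|u - tau|] from the
    critical values, [tau] being the nearest critical argument, so [lojasiewicz]
    bounds [|P'|] below by a multiple of the power [1 - 1/n] of [|u - tau|]. *)
Lemma level_density_le_envelope a b : exists2 K, 0 < K &
  forall t u, a <= t <= b -> regular_args P u -> level_density P t u <= K * envelope u.
Proof.
have [k k0 Hk] := lojasiewicz n_gt1 P_monic P_size.
pose k' := k * (expR a / 16) ^+ n.-1.
have k'0 : 0 < k' by rewrite mulr_gt0 ?exprn_gt0// divr_gt0 ?expR_gt0.
have nR0 : 0 < n%:R :> R by rewrite ltr0n.
have nV0 : 0 <= n%:R^-1 :> R by rewrite invr_ge0 ltW.
pose K := n%:R * (expR b / k' `^ n%:R^-1).
have K0 : 0 < K by rewrite !mulr_gt0 ?expR_gt0 ?invr_gt0 ?powR_gt0.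
exists K => // t u /andP[ta tb] uD.
have [tau tauA cl] := clear_nearest P u.
set eta := `|u - tau| in cl.
have eta0 : 0 < eta.
  rewrite normr_gt0 subr_eq0; apply/eqP => e.
  by case: uD => _; apply; rewrite /= e.
apply: (@le_trans _ _ (K * eta `^ (n%:R^-1 - 1))); last first.
  rewrite ler_wpM2l ?(ltW K0)// /envelope (big_rem tau tauA)/= lerDl.
  by apply: sumr_ge0 => *; exact: powR_ge0.
have bnd z : z \in fiber P (cexp t u) ->
    speed P z <= expR b / k' `^ n%:R^-1 * eta `^ (n%:R^-1 - 1).
  rewrite (mem_fiber n_gt1 P_monic P_size) => /eqP Pz.
  have e0 := expR_ge0 t; have ea0 := expR_ge0 a.
  have := Hk z (expR t * (eta / 16)); rewrite mulr_ge0 ?divr_ge0 ?(ltW eta0)//.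
  rewrite Pz => /(_ isT (far_cexp t (regular_args_itv uD) (ltW eta0) cl)) h.
  have {}h : k' * eta ^+ n.-1 <= normc P^`().[z] ^+ n.
    apply: le_trans h; rewrite /k' -mulrA ler_wpM2l ?(ltW k0)// -exprMn.
    rewrite lerXn2r ?nnegrE ?mulr_ge0 ?divr_ge0 ?(ltW eta0)//.
    have : expR a * eta <= expR t * eta by rewrite ler_wpM2r ?(ltW eta0)// ler_expR.
    by lra.
  have {}h : k' `^ n%:R^-1 * eta `^ (1 - n%:R^-1) <= normc P^`().[z].
    have p1 : normc P^`().[z] = (normc P^`().[z] ^+ n) `^ n%:R^-1.
      by rewrite -powR_mulrn ?normc_ge0// -powRrM mulfV ?gt_eqF// powRr1 ?normc_ge0.
    rewrite p1.
    have -> : k' `^ n%:R^-1 * eta `^ (1 - n%:R^-1) = (k' * eta ^+ n.-1) `^ n%:R^-1.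
      rewrite (@powRM _ k') ?exprn_ge0 ?(ltW k'0) ?(ltW eta0)//; congr (_ * _).
      rewrite -powR_mulrn ?(ltW eta0)// -powRrM; congr (_ `^ _).
      by rewrite -subn1 natrB// mulrBl mulfV ?gt_eqF// mul1r.
    apply: ge0_ler_powR => //; rewrite nnegrE ?exprn_ge0 ?normc_ge0//.
    by rewrite mulr_ge0 ?exprn_ge0 ?(ltW k'0) ?(ltW eta0).
  have q0 : 0 < k' `^ n%:R^-1 * eta `^ (1 - n%:R^-1) by rewrite mulr_gt0 ?powR_gt0.
  rewrite /speed Pz normc_cexp.
  apply: (@le_trans _ _ (expR b * (k' `^ n%:R^-1 * eta `^ (1 - n%:R^-1))^-1)).
    rewrite ler_pM ?invr_ge0 ?normc_ge0 ?ler_expR//.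
    by rewrite lef_pV2 ?posrE// (lt_le_trans q0).
  by rewrite invfM -(powRN eta) opprB mulrA.
rewrite /level_density /fiber_sum big_seq.
apply: (le_trans (ler_sum _ bnd)).
rewrite -big_seq big_const_seq count_predT (size_fiber n_gt1 P_monic P_size).
by rewrite iter_addr addr0 -[leLHS]mulr_natl /K !mulrA.
Qed.

Lemma integrable_level_density t :
  mu.-integrable (regular_args P) (EFin \o level_density P t).
Proof.
have [K K0 HK] := level_density_le_envelope t t.
apply: (@le_integrable _ (measurableTypeR R) R lebesgue_measure _
  (measurable_regular_args P) (EFin \o level_density P t) (EFin \o (fun u => K * envelope u))).
- by apply/measurable_EFinP; exact: measurable_level_density.
- move=> u uD /=; rewrite lee_fin !ger0_norm ?level_density_ge0 ?mulr_ge0 ?envelope_ge0 ?(ltW K0)//.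
  by apply: HK => //; rewrite lexx.
- exact: integrable_envelopeZ.
Qed.

(** For a fixed regular argument the density is continuous in [t], and the envelope
    dominates it locally uniformly in [t], also at critical levels. *)
Lemma continuous_level_integral : continuous (level_integral P).
Proof.
move=> t; pose a := t - 1; pose b := t + 1.
have [K K0 HK] := level_density_le_envelope a b.
have := @continuity_under_integral R _ _ mu (level_density P) (regular_args P)
  (measurable_regular_args P) a b.
have i1 x : `]a, b[%classic x -> mu.-integrable (regular_args P) (EFin \o level_density P x).
  by move=> _; exact: integrable_level_density.
have i2 : {ae mu, forall y, regular_args P y ->
    {in `]a, b[%classic, continuous (level_density P ^~ y)}}.
  apply: aeW => u uD s _.
  by apply: fiber_sum_continuous_mod; [exact: regular_not_crit|exact: speed_cvg].
move=> /(_ i1 i2 (fun u => K * envelope u)).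
have i3 : mu.-integrable (regular_args P) (EFin \o (fun u => K * envelope u)).
  exact: integrable_envelopeZ.
have i4 x : `]a, b[%classic x -> {ae mu, forall y, regular_args P y ->
    `|level_density P x y| <= K * envelope y}.
  move=> /=; rewrite in_itv/= => /andP[xa xb]; apply: aeW => u uD.
  by rewrite ger0_norm ?level_density_ge0// HK// !ltW.
move=> /(_ i3 i4 t); apply.
by rewrite inE/= in_itv/= /a /b gtrBl ltrDl ltr01.
Qed.

Lemma level_integralE t : (level_integral P t)%:E =
  (\int[mu]_(u in regular_args P) (level_density P t u)%:E)%E.
Proof.
rewrite /level_integral /Rintegral fineK//.
apply: integrable_fin_num; first exact: measurable_regular_args.
exact: integrable_level_density.
Qed.

End Density.

(** * Coverings and the Hausdorff measure *)

Section Hausdorff.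
Variable R : realType.
Local Notation C := R[i].
Implicit Types (A V : set C) (b d : R).

Lemma diam_ge0 A : (0 <= diam A)%E.
Proof. by apply: ereal_sup_ubound; left. Qed.

Lemma le_diam A x y : A x -> A y -> ((normc (x - y))%:E <= diam A)%E.
Proof. by move=> Ax Ay; apply: ereal_sup_ubound; right; exists x => //; exists y. Qed.

Lemma diam_le A b : 0 <= b -> (forall x y, A x -> A y -> normc (x - y) <= b) ->
  (diam A <= b%:E)%E.
Proof.
move=> b0 H; apply/ereal_supP => _ [->|[x Ax [y Ay <-]]]; rewrite lee_fin//.
exact: H.
Qed.

Lemma hausdorff1_pre_set0 d : 0 <= d -> (hausdorff1_pre d (@set0 C) <= 0)%E.
Proof.
move=> d0; apply: ge_ereal_inf; exists 0%E => //.
have d00 : diam (@set0 C) = 0%E.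
  by apply/eqP; rewrite eq_le diam_ge0 andbT diam_le.
exists (fun=> set0); last by rewrite eseries0.
by split => // k; rewrite d00 lee_fin.
Qed.

Lemma hausdorff1_pre_setU d A V b : 0 <= b <= d ->
  (forall x y, V x -> V y -> normc (x - y) <= b) ->
  (hausdorff1_pre d (A `|` V) <= hausdorff1_pre d A + b%:E)%E.
Proof.
move=> /andP[b0 bd] HV; have dV := diam_le b0 HV.
rewrite -leeBlDr//; apply/ereal_infP => _ [U [AU dU] <-].
rewrite leeBlDr//; apply: ge_ereal_inf.
pose W k := if k is k'.+1 then U k' else V.
exists (\sum_(0 <= k <oo) diam (W k))%E.
  exists W => //; split.
    move=> x [/AU[k _ Uk]|Vx]; first by exists k.+1.
    by exists 0%N.
  by move=> [|k] /=; [rewrite (le_trans dV)// lee_fin|exact: dU].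
rewrite nneseries_recl//; last by move=> k _; exact: diam_ge0.
have -> : (\sum_(1 <= k <oo) diam (W k) = \sum_(0 <= k <oo) diam (U k))%E.
  rewrite -(@nneseries_addn R (fun k => diam (W k)) 1%N); last by move=> k; exact: diam_ge0.
  by apply: eq_eseriesr => k _; rewrite addn1.
by rewrite addeC leeD2l.
Qed.

Lemma hausdorff1_pre_subset d A V : A `<=` V ->
  (hausdorff1_pre d A <= hausdorff1_pre d V)%E.
Proof.
move=> AV; apply: ereal_inf_le_tmp => _ [U [VU dU] <-].
by exists U => //; split => // x /AV /VU.
Qed.

Lemma hausdorff1_pre_cover (I : eqType) (s : seq I) (V : I -> set C) (b : I -> R) d A :
  0 <= d ->
  (forall i, i \in s -> 0 <= b i <= d /\ forall x y, V i x -> V i y -> normc (x - y) <= b i) ->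
  (forall x, A x -> exists2 i, i \in s & V i x) ->
  (hausdorff1_pre d A <= (\sum_(i <- s) b i)%:E)%E.
Proof.
move=> d0; elim: s A => [|i s IH] A Hs HA.
  rewrite big_nil (le_trans _ (hausdorff1_pre_set0 d0))//.
  by apply: hausdorff1_pre_subset => x /HA[].
have [bi Vi] := Hs i (mem_head _ _).
pose A' := [set x | exists2 i, i \in s & V i x].
apply: (@le_trans _ _ (hausdorff1_pre d (A' `|` V i))%E).
  apply: hausdorff1_pre_subset => x /HA[j]; rewrite inE => /predU1P[->|js] Vx; first by right.
  by left; exists j.
apply: (le_trans (hausdorff1_pre_setU A' bi Vi)).
rewrite big_cons EFinD addeC leeD2r//; apply: IH => // j js.
by apply: Hs; rewrite inE js orbT.
Qed.

Lemma hausdorff1_pre_le d A : 0 < d -> (hausdorff1_pre d A <= hausdorff1 A)%E.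
Proof. by move=> d0; apply: ereal_sup_ubound; exists d. Qed.

End Hausdorff.

Section MeasureTools.
Variable R : realType.
Local Notation mu := (@lebesgue_measure R).

Lemma sum_uniq_le_nneseries (f : nat -> \bar R) (s : seq nat) :
  (forall k, 0 <= f k)%E -> uniq s ->
  (\sum_(k <- s) f k <= \sum_(0 <= k <oo) f k)%E.
Proof.
move=> f0 us; pose N := (\max_(k <- s) k).+1.
apply: (@le_trans _ _ (\sum_(0 <= k < N) f k)%E); last exact: nneseries_lim_ge.
have -> : (\sum_(k <- s) f k = \sum_(k <- index_iota 0 N | k \in s) f k)%E.
  rewrite -[RHS]big_filter; apply: perm_big; apply: uniq_perm => //.
    by rewrite filter_uniq// iota_uniq.
  move=> k; rewrite mem_filter mem_index_iota /= ltnS.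
  by case ks : (k \in s) => //=; rewrite (leq_bigmax_seq k)//.
by rewrite big_mkcond/=; apply: lee_sum => k _; case: ifP.
Qed.

Lemma within_interval (J : set R) (l : R) : 0 <= l ->
  (forall x y, J x -> J y -> `|x - y| <= l) ->
  exists a, forall x, J x -> a <= x <= a + l.
Proof.
move=> l0 H; have [J0|/set0P[x0 Jx0]] := eqVneq J set0.
  by exists 0 => x; rewrite J0.
have lbJ : has_lbound J.
  by exists (x0 - l) => y Jy; have := H x0 y Jx0 Jy; rewrite ler_norml => /andP[_]; lra.
exists (inf J) => x Jx; apply/andP; split; first exact: ge_inf.
have : x - l <= inf J; last by lra.
apply: lb_le_inf; first by exists x.
by move=> y Jy; have := H x y Jx Jy; rewrite ler_norml => /andP[_]; lra.
Qed.

Lemma integral_step_le (D : set R) (G a l : R) : measurable D -> 0 <= G -> 0 <= l ->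
  (\int[mu]_(u in D) (G * \1_(`[a, (a + l)%R]%classic : set R) u)%:E <= (G * l)%:E)%E.
Proof.
move=> mD G0 l0; rewrite (@integralZl_indic _ _ R mu D mD (fun=> `[a, a + l]%classic : set R))//; last by rewrite ltNge G0.
rewrite integral_indic// EFinM lee_wpmul2l ?lee_fin//.
apply: (@le_trans _ _ (mu `[a, a + l]%classic)).
  apply: le_measure; rewrite ?inE//; exact: measurableI.
rewrite lebesgue_measure_itv/= lte_fin; case: ifP => _; rewrite ?lee_fin//.
by rewrite addrAC subrr add0r.
Qed.

End MeasureTools.

(** * The integral of the density is at most the length *)

Section SmallPieces.
Variable R : realType.
Local Notation C := R[i].
Local Notation mu := (@lebesgue_measure R).
Implicit Types (t u v eta e : R).

Definition level_curve (P : {poly C}) t : set C := [set z | normc P.[z] = expR t].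

Definition clear_args (P : {poly C}) eta : set R :=
  [set u | 0 <= u <= pi *+ 2 /\ clear P eta u].

Lemma level_curve_arg (P : {poly C}) t z : level_curve P t z ->
  exists2 u, 0 <= u <= pi *+ 2 & P.[z] = cexp t u.
Proof.
rewrite /level_curve/= => Pz.
have P0 : P.[z] != 0 by rewrite -normc_gt0 Pz expR_gt0.
by have [u u1 u2] := cexp_polar P0; exists u => //; rewrite u2 Pz expRK.
Qed.

Lemma measurable_clear_args (P : {poly C}) eta : measurable (clear_args P eta).
Proof.
have -> : clear_args P eta = `[0, pi *+ 2]%classic `&`
    \bigcap_(tau in [set` crit_angles P])
      (`]-oo, tau - eta]%classic `|` `[tau + eta, +oo[%classic).
  apply/seteqP; split => u.
    move=> [u02 cl]; split; first by rewrite /= in_itv.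
    move=> tau /= /cl; rewrite ler_normr => /orP[h|h].
      by right; rewrite /= in_itv/= andbT; lra.
    by left; rewrite /= in_itv/=; lra.
  move=> [+ H]; rewrite /= in_itv/= => u02; split => // tau /H.
  by rewrite ler_normr => -[] /=; rewrite in_itv/= ?andbT => h; apply/orP; [right|left]; lra.
apply: measurableI => //; apply: fin_bigcap_measurable; first exact: finite_seq.
by move=> tau _; apply: measurableU.
Qed.

Variables (n : nat) (P : {poly C}).
Hypothesis n_gt1 : (1 < n)%N.
Hypothesis P_monic : P \is monic.
Hypothesis P_size : size P = n.+1.

Lemma near_deriv (B eta e : R) : 0 < eta -> 0 < e ->
  exists2 r, 0 < r & forall z a, normc P.[z] <= B -> far P eta P.[z] ->
    normc (a - z) <= r -> normc (P^`().[a] - P^`().[z]) <= e * normc P^`().[z].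
Proof.
move=> eta0 e0; have [m m0 Hm] := far_deriv n_gt1 P_monic P_size eta0.
have [M M0 HM] := fiber_bounded n_gt1 P_monic P_size B.
have [K K0 HK] := poly_lipschitz P^`() (M + 1).
pose r := Num.min 1 (e * m / K).
have r0 : 0 < r by rewrite lt_min ltr01 divr_gt0 ?mulr_gt0.
exists r => // z a /HM zM /Hm mz az.
have zM1 : normc z <= M + 1 by rewrite (le_trans zM)// lerDl.
have aM1 : normc a <= M + 1.
  rewrite -[a](subrK z) (le_trans (normcD _ _))// addrC lerD//.
  by rewrite (le_trans az)// ge_min lexx.
apply: (le_trans (HK a z aM1 zM1)).
apply: (@le_trans _ _ (e * m)); last by rewrite ler_wpM2l// ltW.
rewrite -ler_pdivlMl// mulrC (le_trans az)//.
by rewrite /r ge_min lexx orbT.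
Qed.

(** Near a point of the level curve where [P'] does not vanish, [P] is almost
    the similarity of ratio [|P'|], so a small piece of the curve of diameter [delta]
    occupies an arc of length about [|P'| * delta], while each of its points
    contributes about [exp t / |P'|] to the density. *)
Lemma small_piece t eta e : 0 < eta -> 0 < e <= 4^-1 ->
  exists2 d0, 0 < d0 & forall (U : set C) delta, 0 <= delta <= d0 ->
    (forall x y, U x -> U y -> normc (x - y) <= delta) ->
    (forall u z z', clear_args P eta u -> U z -> U z' ->
       P.[z] = cexp t u -> P.[z'] = cexp t u -> z = z') /\
    exists a G l, [/\ 0 <= G, 0 <= l, G * l <= (1 + 8 * e) * delta &
      forall u z, clear_args P eta u -> U z -> P.[z] = cexp t u ->
        a <= u <= a + l /\ speed P z <= G].
Proof.
move=> eta0 /andP[e0 e4].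
have E0 := expR_gt0 t.
pose eta' := expR t * (eta / 16).
have eta'0 : 0 < eta' by rewrite mulr_gt0// divr_gt0.
have [r1 r10 H1] := near_linear n_gt1 P_monic P_size (expR t) eta'0 e0.
have [r2 r20 H2] := near_deriv (expR t) eta'0 e0.
have [M M0 HM] := fiber_bounded n_gt1 P_monic P_size (expR t).
have [B B0 HB] := poly_bounded P^`() M.
have [m m0 Hm] := far_deriv n_gt1 P_monic P_size eta'0.
pose d3 := expR t * (Num.min e eta / 16) / (2 * B).
have me0 : 0 < Num.min e eta by rewrite lt_min e0.
have d30 : 0 < d3 by rewrite divr_gt0 ?mulr_gt0// divr_gt0.
exists (Num.min (Num.min r1 r2) d3); first by rewrite !lt_min r10 r20.
move=> U delta; rewrite !le_min => /andP[dl0 /andP[/andP[dl1 dl2] dl3]] HU.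
have cfar u z : clear_args P eta u -> P.[z] = cexp t u -> far P eta' P.[z].
  by move=> [u02 cl] ->; apply: (far_cexp n_gt1 P_monic P_size) => //; exact: ltW.
have nPz u z : P.[z] = cexp t u -> normc P.[z] = expR t by move=> ->; rewrite normc_cexp.
split.
  move=> u z z' Ku Uz Uz' Pz Pz'.
  have fz := cfar u z Ku Pz.
  have := H1 z z z'; rewrite (nPz _ _ Pz) lexx subrr normc0 (ltW r10).
  move=> /(_ isT fz isT (le_trans (HU _ _ Uz' Uz) dl1)).
  rewrite Pz' Pz subrr sub0r normc_opp normcM => h.
  have pz : 0 < normc P^`().[z] := lt_le_trans m0 (Hm _ fz).
  apply/eqP; rewrite -subr_eq0 -normc_eq0 eq_le normc_ge0 andbT leNgt; apply/negP => h0.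
  by move: h; rewrite ler_pM2r// ler_pMl// => h; lra.
have [[u0 [z0 [Ku0 Uz0 Pz0]]]|no] := pselect (exists u z, [/\ clear_args P eta u, U z &
    P.[z] = cexp t u]); last first.
  exists 0, 0, 0; split => //; first by rewrite mul0r mulr_ge0//; lra.
  by move=> u z Ku Uz Pz; exfalso; apply: no; exists u, z.
have fz0 := cfar _ _ Ku0 Pz0.
set p := normc P^`().[z0].
have p0 : 0 < p := lt_le_trans m0 (Hm _ fz0).
have pB : p <= B by apply: HB; apply: HM; rewrite (nPz _ _ Pz0).
pose l := (1 + e) / (1 - e) * (p / expR t) * delta.
pose G := expR t / ((1 - e) * p).
have e1 : 0 < 1 - e by lra.
have ep1 : 0 < 1 + e by lra.
have l0 : 0 <= l.
  by rewrite !mulr_ge0// ?invr_ge0 ltW.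
have G0 : 0 <= G by rewrite divr_ge0// ?mulr_ge0// ltW.
have incr z z' : U z -> U z' -> normc (P.[z] - P.[z']) <= (1 + e) * p * delta.
  move=> Uz Uz'.
  have := H1 z0 z z'; rewrite (nPz _ _ Pz0) lexx.
  move=> /(_ isT fz0 (le_trans (HU _ _ Uz Uz0) dl1) (le_trans (HU _ _ Uz' Uz0) dl1)) h.
  rewrite -[P.[z] - _](subrK (P^`().[z0] * (z - z'))) (le_trans (normcD _ _))//.
  rewrite normcM -/p in h *.
  have := HU _ _ Uz Uz' => hzz.
  have : p * normc (z - z') <= p * delta by rewrite ler_wpM2l// ltW.
  have : e * (p * normc (z - z')) <= e * (p * delta) by rewrite !ler_wpM2l// ltW.
  rewrite -mulrA in h; lra.
pose J := [set u | exists z, [/\ clear_args P eta u, U z & P.[z] = cexp t u]].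
have [a Ha] : exists a, forall u, J u -> a <= u <= a + l.
  apply: within_interval => // u v [z [Ku Uz Pz]] [z' [Kv Uz' Pz']].
  have ch : normc (cexp t u - cexp t v) <= (1 + e) * p * delta.
    by rewrite -Pz -Pz'; exact: incr.
  have uve : `|u - v| <= e.
    rewrite leNgt; apply/negP => h.
    have [/andP[u_0 u_2] cu] := Ku; have [/andP[v_0 v_2] cv] := Kv.
    have o1 : 0 \in crit_angles P by rewrite inE eqxx.
    have o2 : pi *+ 2 \in crit_angles P by rewrite !inE eqxx orbT.
    have := cu _ o1; have := cu _ o2; have := cv _ o1; have := cv _ o2.
    rewrite !subr0 (ger0_norm u_0) (ger0_norm v_0) !ler0_norm ?subr_le0//.
    move=> hv2 hv0 hu2 hu0.
    have := @chord_ge R t u v (Num.min e eta) (ltW me0).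
    have -> : Num.min e eta <= `|u - v| by rewrite ge_min (ltW h).
    have : Num.min e eta <= eta by rewrite ge_min lexx orbT.
    set mn := Num.min e eta in me0 dl3 *.
    move=> mneta.
    have -> : mn <= pi *+ 2 - `|u - v|.
      have : `|u - v| <= pi *+ 2 - eta; last by lra.
      by rewrite ler_norml; apply/andP; split; lra.
    move=> /(_ isT isT) h3.
    have : (1 + e) * p * delta <= 2 * B * d3.
      rewrite ler_pM// ?mulr_ge0// ?(ltW ep1) ?(ltW p0)//.
      by rewrite ler_pM// ?(ltW ep1) ?(ltW p0)//; lra.
    have -> : 2 * B * d3 = expR t * (mn / 16).
      by rewrite /d3 -/mn; field; rewrite gt_eqF.
    have : 0 < expR t * (mn / 16) by rewrite mulr_gt0// divr_gt0.
    lra.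
  have e01 : 0 < e < 1 by rewrite e0/=; lra.
  have := chord_ge_near t e01 uve => h.
  have {}h := le_trans h ch.
  have lE : l = ((1 + e) * p * delta) / ((1 - e) * expR t).
    by rewrite /l; field; rewrite !gt_eqF.
  rewrite lE ler_pdivlMr ?mulr_gt0//; move: h; lra.
exists a, G, l; split => //.
  have -> : G * l = (1 + e) / (1 - e) ^+ 2 * delta.
    by rewrite /G /l; field; rewrite !gt_eqF.
  rewrite ler_wpM2r// ler_pdivrMr ?exprn_gt0// expr2.
  have : e * e <= 4^-1 * e by rewrite ler_wpM2r// ltW.
  have : 0 <= e * e * e by rewrite !mulr_ge0// ltW.
  lra.
move=> u z Ku Uz Pz; split; first by apply: Ha; exists z.
rewrite /speed (nPz _ _ Pz) /G ler_wpM2l ?(ltW E0)//.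
have hz : (1 - e) * p <= normc P^`().[z].
  have := H2 z0 z; rewrite (nPz _ _ Pz0) lexx.
  move=> /(_ isT fz0 (le_trans (HU _ _ Uz Uz0) dl2)); rewrite -/p => h.
  have := lerB_normc P^`().[z0] P^`().[z]; rewrite normc_subC -/p; lra.
by rewrite lef_pV2 ?posrE ?mulr_gt0// (lt_le_trans _ hz)// mulr_gt0.
Qed.

End SmallPieces.

Section LowerBound.
Variable R : realType.
Local Notation C := R[i].
Local Notation mu := (@lebesgue_measure R).
Implicit Types (t u v eta e : R).

Variables (n : nat) (P : {poly C}).
Hypothesis n_gt1 : (1 < n)%N.
Hypothesis P_monic : P \is monic.
Hypothesis P_size : size P = n.+1.

Lemma clear_args_sub eta : 0 < eta -> clear_args P eta `<=` regular_args P.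
Proof. by move=> eta0 u [u02 cl]; exact: clear_regular cl. Qed.

(** By [small_piece] a set of a fine covering contributes to the density at most a step
    function whose integral is about its diameter. These step functions add up
    to at least the density, because distinct points of a fibre lie in distinct
    sets of the covering. *)
Lemma integral_le_hausdorff1 t eta e : 0 < eta -> 0 < e <= 4^-1 ->
  (\int[mu]_(u in clear_args P eta) (level_density P t u)%:E <=
     (1 + 8 * e)%:E * hausdorff1 (level_curve P t))%E.
Proof.
move=> eta0 e4; have [d0 d00 Hd] := small_piece n_gt1 P_monic P_size t eta0 e4.
have c0 : 0 < 1 + 8 * e by case/andP: e4 => ? _; lra.
have mK := measurable_clear_args P eta.
apply: (@le_trans _ _ ((1 + 8 * e)%:E * hausdorff1_pre d0 (level_curve P t))%E); last first.
  by rewrite lee_wpmul2l ?lee_fin ?(ltW c0)// hausdorff1_pre_le.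
rewrite -lee_pdivrMl//; apply/ereal_infP => _ [U [cU dU] <-].
rewrite lee_pdivrMl//.
pose delta k := fine (diam (U k)).
have deltaE k : (delta k)%:E = diam (U k).
  rewrite fineK// ge0_fin_numE ?diam_ge0//.
  by rewrite (le_lt_trans (dU k))// ltry.
have delta0 k : 0 <= delta k <= d0.
  by rewrite -!lee_fin deltaE diam_ge0 dU.
have Udelta k x y : U k x -> U k y -> normc (x - y) <= delta k.
  by move=> Ux Uy; rewrite -lee_fin deltaE; exact: le_diam.
have inj k := (Hd (U k) (delta k) (delta0 k) (Udelta k)).1.
have /choice[f Hf] : forall k, exists agl : R * R * R,
    [/\ 0 <= agl.1.2, 0 <= agl.2, agl.1.2 * agl.2 <= (1 + 8 * e) * delta k &
      forall u z, clear_args P eta u -> U k z -> P.[z] = cexp t u ->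
        agl.1.1 <= u <= agl.1.1 + agl.2 /\ speed P z <= agl.1.2].
  move=> k; have [_ [a [G [l H]]]] := Hd (U k) (delta k) (delta0 k) (Udelta k).
  by exists (a, G, l).
pose h k : R -> \bar R := fun u =>
  ((f k).1.2 * \1_(`[(f k).1.1, ((f k).1.1 + (f k).2)%R]%classic : set R) u)%:E.
have h0 k u : (0 <= h k u)%E.
  by rewrite lee_fin mulr_ge0//; case: (Hf k).
have mh k : measurable_fun (clear_args P eta) (h k).
  by apply/measurable_EFinP; apply: measurable_funM.
apply: (@le_trans _ _ (\int[mu]_(u in clear_args P eta) \sum_(0 <= k <oo) h k u)%E).
  apply: ge0_le_integral => //.
  - by move=> u _; rewrite lee_fin level_density_ge0.
  - apply/measurable_EFinP.
    apply: (measurable_funS (measurable_regular_args P) (clear_args_sub eta0)).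
    exact: (measurable_level_density n_gt1 P_monic P_size).
  - exact: (ge0_emeasurable_sum (P := xpredT) (fun k u _ _ => h0 k u) (fun k _ => mh k)).
  move=> u Ku.
  have inE_ z : z \in fiber P (cexp t u) -> P.[z] = cexp t u.
    by rewrite (mem_fiber n_gt1 P_monic P_size) => /eqP.
  have /choice[kap Hkap] : forall z, exists k, P.[z] = cexp t u -> U k z.
    move=> z; have [Pz|nPz] := pselect (P.[z] = cexp t u); last by exists 0%N.
    have [|k _ Uk] := cU z; last by exists k.
    by rewrite /level_curve/= Pz normc_cexp.
  have uf : uniq (fiber P (cexp t u)).
    case: Ku => u02 cl.
    apply: (far_uniq n_gt1 P_monic P_size _ (far_cexp n_gt1 P_monic P_size t u02 (ltW eta0) cl)).
    by rewrite mulr_gt0 ?expR_gt0// divr_gt0.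
  have uk : uniq [seq kap z | z <- fiber P (cexp t u)].
    rewrite map_inj_in_uniq// => z z' /inE_ Pz /inE_ Pz' ekk.
    apply: (inj (kap z) u) => //; first exact: Hkap.
    by rewrite ekk; exact: Hkap.
  apply: le_trans (sum_uniq_le_nneseries (fun k => h0 k u) uk).
  rewrite big_map /level_density /fiber_sum -sumEFin big_seq [leRHS]big_seq.
  apply: lee_sum => z /inE_ Pz; rewrite lee_fin.
  have [_ _ _ /(_ u z Ku (Hkap z Pz) Pz)[au sG]] := Hf (kap z).
  by rewrite indicE mem_set ?mulr1// /= in_itv.
rewrite integral_nneseries//.
rewrite -nneseriesZl; last by move=> k _; exact: diam_ge0.
apply: lee_nneseries.
  by move=> k _ _; apply: integral_ge0 => u _; exact: h0.
move=> k _; case: (Hf k) => G0 l0 Gl _.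
apply: (@le_trans _ _ ((f k).1.2 * (f k).2)%:E).
  exact: integral_step_le.
by rewrite -deltaE -EFinM lee_fin.
Qed.

Lemma clear_args_union :
  \bigcup_k clear_args P k.+1%:R^-1 = regular_args P.
Proof.
apply/seteqP; split => u.
  by move=> [k _]; apply: clear_args_sub; rewrite invr_gt0.
move=> uD; have [eta eta0 cl] := clear_regular_args uD.
exists (Num.bound eta^-1) => //; split; first exact: regular_args_itv uD.
move=> tau /cl; apply: le_trans.
rewrite -[leRHS]invrK lef_pV2 ?posrE ?invr_gt0//.
have := archi_boundP (ltW (eqbRL (invr_gt0 _) eta0)) => h.
by rewrite (le_trans (ltW h))// ler_nat.
Qed.

Lemma level_integral_le_hausdorff1 t :
  ((level_integral P t)%:E <= hausdorff1 (level_curve P t))%E.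
Proof.
have H0 : (0 <= hausdorff1 (level_curve P t))%E.
  apply: le_trans (hausdorff1_pre_le _ ltr01).
  apply/ereal_infP => _ [U _ <-]; apply: nneseries_ge0 => k _ _; exact: diam_ge0.
rewrite (level_integralE n_gt1 P_monic P_size).
have step e : 0 < e <= 4^-1 -> (\int[mu]_(u in regular_args P) (level_density P t u)%:E <=
     (1 + 8 * e)%:E * hausdorff1 (level_curve P t))%E.
  move=> e4; rewrite -clear_args_union.
  have mono : {homo (fun k => clear_args P k.+1%:R^-1) : k l / (k <= l)%N >-> (k <= l)%O}.
    move=> k l kl; apply/subsetPset => u [u02 cl]; split => // tau /cl.
    by apply: le_trans; rewrite lef_pV2 ?posrE// ler_nat ltnS.
  have := @ge0_nondecreasing_set_cvg_integral _ (measurableTypeR R) R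
    (fun k => clear_args P k.+1%:R^-1) (EFin \o level_density P t) lebesgue_measure mono
    (fun k => measurable_clear_args P _).
  have i1 k : measurable_fun (clear_args P k.+1%:R^-1) (EFin \o level_density P t).
    apply/measurable_EFinP; apply: (measurable_funS (measurable_regular_args P)).
      by apply: clear_args_sub; rewrite invr_gt0.
    exact: (measurable_level_density n_gt1 P_monic P_size).
  move=> /(_ i1 (fun k u _ => level_density_ge0 P t u)) cvgF.
  rewrite -(cvg_lim _ cvgF)//; apply: lime_le; first by apply/cvg_ex; eexists; exact: cvgF.
  by apply: nearW => k; apply: integral_le_hausdorff1.
have [Hfin|] := boolP (hausdorff1 (level_curve P t) \is a fin_num); last first.
  by rewrite ge0_fin_numE// -leNgt leye_eq => /eqP ->; rewrite leey.
rewrite -(fineK Hfin) in step H0 *; set H := fine _ in step H0 *.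
rewrite lee_fin in H0.
apply/lee_addgt0Pr => e e0.
pose e' := Num.min 4^-1 (e / (8 * (H + 1))).
have H1 : 0 < 8 * (H + 1) by lra.
apply: (le_trans (step e' _)); first by rewrite lt_min invr_gt0 ltr0n divr_gt0//= ge_min lexx.
rewrite -EFinM -EFinD lee_fin.
have : e' <= e / (8 * (H + 1)) by rewrite /e' ge_min lexx orbT.
rewrite ler_pdivlMr// => h.
have : 0 <= e' by rewrite le_min invr_ge0 ler0n divr_ge0// ltW.
lra.
Qed.

End LowerBound.

(** * The length is at most the integral of the density *)

Section UpperBound.
Variable R : realType.
Local Notation C := R[i].
Local Notation mu := (@lebesgue_measure R).
Implicit Types (t u v eta e : R).

Lemma grid_cell (h u : R) (N : nat) : 0 <= u -> u <= N.+1%:R * h ->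
  exists2 k, (k < N.+1)%N & k%:R * h <= u <= k%:R * h + h.
Proof.
move=> u0; elim: N => [|N IH] uN.
  by exists 0%N => //; rewrite mul0r u0 add0r; rewrite mul1r in uN.
have [/IH[k kN ku]|lt] := leP u (N.+1%:R * h); first by exists k => //; exact: ltnW.
by exists N.+1 => //; rewrite (ltW lt)/=; move: uN; rewrite -natr1 mulrDl mul1r.
Qed.

Variables (n : nat) (P : {poly C}).
Hypothesis n_gt1 : (1 < n)%N.
Hypothesis P_monic : P \is monic.
Hypothesis P_size : size P = n.+1.

Let n_gt0 : (0 < n)%N. Proof. exact: ltnW. Qed.

Definition arc_piece t (a h r : R) (y : C) : set C :=
  [set z | normc (z - y) <= r /\ exists2 u, a <= u <= a + h & P.[z] = cexp t u].

(** Over an arc of arguments of length [h] avoiding the critical ones, the curve is covered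
    by [n] pieces, one near each point [y] of a fibre over the arc, of
    diameter at most about [h * speed y]. *)
Lemma arc_piece_cover t eta e d : 0 < eta -> 0 < e < 1 -> 0 < d ->
  exists r h0, 0 < h0 /\ forall a h, 0 < h <= h0 ->
    (forall u, a <= u <= a + h -> clear_args P eta u) ->
    forall u0, a <= u0 <= a + h ->
    (forall y, y \in fiber P (cexp t u0) ->
      0 <= h * speed P y / (1 - e) <= d /\
      forall x x', arc_piece t a h r y x -> arc_piece t a h r y x' ->
        normc (x - x') <= h * speed P y / (1 - e)) /\
    (forall z u, a <= u <= a + h -> P.[z] = cexp t u ->
      exists2 y, y \in fiber P (cexp t u0) & arc_piece t a h r y z).
Proof.
move=> eta0 /andP[e0 e1] d0; have E0 := expR_gt0 t.
pose eta' := expR t * (eta / 16).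
have eta'0 : 0 < eta' by rewrite mulr_gt0// divr_gt0.
have [r r0 Hr] := near_linear n_gt1 P_monic P_size (expR t) eta'0 e0.
have [m m0 Hm] := far_deriv n_gt1 P_monic P_size eta'0.
have e10 : 0 < 1 - e by rewrite subr_gt0.
exists r, (Num.min (r ^+ n / expR t) (d * (m * (1 - e)) / expR t)).
split; first by rewrite lt_min !divr_gt0 ?exprn_gt0 ?mulr_gt0.
move=> a h; rewrite le_min => /andP[h0 /andP[h1 h2]] cl u0 u0a.
have dist_arc u v : a <= u <= a + h -> a <= v <= a + h ->
    normc (cexp t u - cexp t v) <= expR t * h.
  move=> /andP[ua ub] /andP[va vb]; rewrite (le_trans (chord_le _ _ _))// ler_wpM2l ?(ltW E0)//.
  by rewrite ler_norml; apply/andP; split; lra.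
split.
  move=> y; rewrite (mem_fiber n_gt1 P_monic P_size) => /eqP Py.
  have nPy : normc P.[y] = expR t by rewrite Py normc_cexp.
  have [u02 clu0] := cl _ u0a.
  have fy : far P eta' P.[y].
    by rewrite Py; apply: (far_cexp n_gt1 P_monic P_size) => //; exact: ltW.
  have my := Hm _ fy.
  have py : 0 < normc P^`().[y] := lt_le_trans m0 my.
  have bE : h * speed P y / (1 - e) = (expR t * h) / (normc P^`().[y] * (1 - e)).
    by rewrite /speed nPy; field; rewrite !gt_eqF.
  split.
    rewrite bE divr_ge0 ?mulr_ge0 ?(ltW E0) ?(ltW h0) ?(ltW py) ?(ltW e10)//=.
    rewrite ler_pdivrMr ?mulr_gt0//.
    apply: (@le_trans _ _ (d * (m * (1 - e)))).
      by rewrite mulrC -ler_pdivlMr.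
    by rewrite ler_wpM2l ?(ltW d0)// ler_wpM2r ?(ltW e10).
  move=> x x' [xy [u ua Px]] [x'y [v va Px']].
  rewrite bE ler_pdivlMr ?mulr_gt0//.
  have hh := Hr y x x'; rewrite nPy lexx in hh; have {}hh := hh isT fy xy x'y.
  apply: le_trans (dist_arc u v ua va); rewrite -Px -Px'.
  have h3 : normc (P^`().[y] * (x - x')) - normc (P.[x] - P.[x']) <=
      normc (P.[x] - P.[x'] - P^`().[y] * (x - x')).
    by rewrite -[leRHS]normc_opp opprB lerB_normc.
  rewrite normcM in h3; move: hh h3.
  set a1 := normc _; set a2 := normc (x - x'); set a3 := normc _; set a4 := normc _.
  lra.
move=> z u ua Pz.
have [||y yf zy] := @fiber_near R n P n_gt1 P_monic P_size (cexp t u0) z r.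
- exact: ltW.
- rewrite Pz (le_trans (dist_arc u u0 ua u0a))// mulrC -ler_pdivlMr//.
by exists y => //; split => //; exists u.
Qed.

(** The circle of arguments is cut into short arcs. Over an arc with a point far
    from the critical arguments the curve is covered as in [arc_piece_cover], and
    evaluating the speeds where the density is smallest on the arc makes the
    diameters add up to a lower Riemann sum. The other arguments are so close to
    critical ones that by [fiber_near] the curve over them lies in boundedly many
    discs of small radius [r], centred at the points of the critical fibres. *)
Lemma hausdorff1_pre_upper t d e : 0 < d -> 0 < e <= 2^-1 ->
  (hausdorff1_pre d (level_curve P t) <=
    ((1 + 2 * e) * level_integral P t + e)%:E)%E.
Proof.
move=> d0 /andP[e0 e2]; have E0 := expR_gt0 t.
have p0 : 0 < pi *+ 2 :> R by rewrite mulrn_wgt0// pi_gt0.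
pose A : R := (size (crit_angles P) * n)%:R.
have A0 : 0 < A by rewrite ltr0n muln_gt0.
pose r := Num.min (d / 2) (e / (2 * A)).
have r0 : 0 < r by rewrite lt_min !divr_gt0// mulr_gt0.
have rd : 2 * r <= d.
  have : r <= d / 2 by rewrite /r ge_min lexx.
  lra.
have re : A * (2 * r) <= e.
  have : r <= e / (2 * A) by rewrite /r ge_min lexx orbT.
  by rewrite ler_pdivlMr ?mulr_gt0// [A * _]mulrC [2 * r]mulrC mulrA.
pose eta := r ^+ n / expR t.
have eta0 : 0 < eta by rewrite divr_gt0 ?exprn_gt0.
have eta20 : 0 < eta / 2 by rewrite divr_gt0.
have e01 : 0 < e < 1 by rewrite e0/=; lra.
have [r1 [h0 [h00 Hgood]]] := arc_piece_cover t eta20 e01 d0.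
pose hm : R := Num.min h0 (eta / 2).
have hm0 : 0 < hm by rewrite lt_min h00.
pose N := (Num.bound (pi *+ 2 / hm)).+1.
pose h : R := pi *+ 2 / N%:R.
have hp : 0 < h by rewrite divr_gt0.
have hhm : h <= hm.
  rewrite /h ler_pdivrMr ?ltr0n// mulrC -ler_pdivrMr//.
  rewrite (le_trans (ltW (archi_boundP (ltW (divr_gt0 p0 hm0)))))//.
  by rewrite ler_nat.
have hh0 : h <= h0 by rewrite (le_trans hhm)// ge_min lexx.
have heta : h <= eta / 2 by rewrite (le_trans hhm)// ge_min lexx orbT.
have NhE : N%:R * h = pi *+ 2 by rewrite /h mulrC divfK// pnatr_eq0.
pose inI k u := k%:R * h <= u <= k%:R * h + h.
pose good k : bool := `[< exists2 u, inI k u & clear P eta u >].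
have goodI k : (k < N)%N -> good k -> forall u, inI k u -> clear_args P (eta / 2) u.
  move=> kN /asboolP[v /andP[v1 v2] clv] u /andP[u1 u2]; split.
    apply/andP; split; first by rewrite (le_trans _ u1)// mulr_ge0// ltW.
    rewrite (le_trans u2)// -NhE -{2}[h]mul1r -mulrDl ler_wpM2r ?(ltW hp)//.
    by rewrite natr1 ler_nat.
  move=> tau /clv h1.
  have : `|v - tau| <= `|v - u| + `|u - tau| by rewrite -[v - tau](subrKA u) ler_normD.
  have : `|v - u| <= h by rewrite ler_norml; apply/andP; split; lra.
  lra.
(* [um k] is where the density is smallest on the [k]-th arc. *)
have /choice[um Hum] : forall k, exists u, (k < N)%N -> good k ->
    inI k u /\ forall v, inI k v -> level_density P t u <= level_density P t v.
  move=> k; have [kN|] := boolP (k < N)%N; last by exists 0.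
  have [gk|] := boolP (good k); last by exists 0.
  have cf : {within `[k%:R * h, k%:R * h + h], continuous (level_density P t)}.
    apply: continuous_in_subspaceT => u; rewrite inE/= in_itv/= => ku.
    apply: (fiber_sum_continuous_arg n_gt1 P_monic P_size); last exact: speed_cvg.
    apply: (regular_not_crit n_gt1 P_monic P_size).
    exact: (clear_args_sub eta20 (goodI k kN gk u ku)).
  have [|u uI umin] := EVT_min _ cf; first by rewrite lerDl ltW.
  exists u => _ _; split; first by move: uI; rewrite in_itv.
  by move=> v vI; apply: umin; rewrite in_itv.
pose Gs := [seq k <- iota 0 N | good k].
have GsP k : k \in Gs -> (k < N)%N /\ good k.
  by rewrite mem_filter mem_iota /= add0n => /andP[gk kN].
(* Centres of the discs over critical arguments, and of the pieces over good arcs. *)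
pose bad := [seq (tau, y) | tau <- crit_angles P, y <- fiber P (cexp t tau)].
pose gd := [seq (k, y) | k <- Gs, y <- fiber P (cexp t (um k))].
pose s : seq ((R * C) + (nat * C)) := map inl bad ++ map inr gd.
pose V (i : (R * C) + (nat * C)) : set C := match i with
  | inl p => [set z | normc (z - p.2) <= r]
  | inr p => arc_piece t (p.1%:R * h) h r1 p.2 end.
pose b (i : (R * C) + (nat * C)) : R := match i with
  | inl _ => 2 * r
  | inr p => h * speed P p.2 / (1 - e) end.
have hN : 0 < h <= h0 by rewrite hp.
apply: (le_trans (@hausdorff1_pre_cover R _ s V b d (level_curve P t) (ltW d0) _ _)).
- move=> [[tau y]|[k y]]; rewrite mem_cat => /orP[] /mapP[[x1 x2] //] + [-> ->].
    move=> _ /=; rewrite mulr_ge0 ?(ltW r0)//=; split => // x x' xy x'y.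
    rewrite (le_trans (normc_dist x2 _ _))// [normc (x2 - _)]normc_subC; lra.
  move=> /allpairsPdep[k' [y' [kG yf [ek ey]]]]; rewrite /= ek ey.
  have [kN gk] := GsP _ kG; have [uI _] := Hum _ kN gk.
  have [H1 _] := Hgood _ _ hN (goodI _ kN gk) _ uI.
  exact: H1 yf.
- move=> z /level_curve_arg[u u02 Pz].
  have [clu|nclu] := pselect (clear P eta u).
    have [k kN ku] : exists2 k, (k < N)%N & inI k u.
      by have /andP[u0 u2] := u02; apply: grid_cell => //; rewrite NhE.
    have gk : good k by apply/asboolP; exists u.
    have kG : k \in Gs by rewrite mem_filter gk mem_iota.
    have [uI _] := Hum _ kN gk.
    have [_ H2] := Hgood _ _ hN (goodI _ kN gk) _ uI.
    have [y yf Vy] := H2 _ _ ku Pz.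
    exists (inr (k, y)) => //; rewrite mem_cat; apply/orP; right; apply/mapP.
    by exists (k, y) => //; apply/allpairsPdep; exists k, y.
  have [tau [tA tu]] : exists tau, tau \in crit_angles P /\ `|u - tau| < eta.
    apply: contrapT => nex; apply: nclu => tau tA; rewrite leNgt; apply/negP => lt.
    by apply: nex; exists tau.
  have [||y yf zy] := @fiber_near R n P n_gt1 P_monic P_size (cexp t tau) z r.
  - exact: ltW.
  - rewrite Pz (le_trans (chord_le _ _ _))// mulrC -ler_pdivlMr// ltW//.
  exists (inl (tau, y)) => //; rewrite mem_cat; apply/orP; left; apply/mapP.
  by exists (tau, y) => //; apply/allpairsPdep; exists tau, y.
have sumb : \sum_(i <- s) b i = A * (2 * r) +
    \sum_(k <- Gs) h * level_density P t (um k) / (1 - e).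
  rewrite big_cat !big_map !big_allpairs_dep /=; congr (_ + _).
    under eq_bigr do rewrite big_const_seq count_predT (size_fiber n_gt1 P_monic P_size) iter_addr addr0.
    rewrite big_const_seq count_predT iter_addr addr0 /A natrM.
    by rewrite -mulrnA -[LHS]mulr_natl mulnC natrM.
  apply: eq_bigr => k _; rewrite /level_density /fiber_sum.
  by rewrite -mulr_suml mulr_sumr.
have int_le : \sum_(k <- Gs) h * level_density P t (um k) <= level_integral P t.
  rewrite -lee_fin (level_integralE n_gt1 P_monic P_size) -sumEFin.
  pose J (k : nat) : set R := `[k%:R * h, k%:R * h + h[%classic.
  have mJ k : measurable (J k) by exact: measurable_itv.
  have JI k u : J k u -> inI k u by rewrite /J/= in_itv/= => /andP[u1 u2]; rewrite /inI u1 ltW.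
  have JD k : k \in Gs -> J k `<=` regular_args P.
    by move=> /GsP[kN gk] u /JI uI; exact: (clear_args_sub eta20 (goodI k kN gk u uI)).
  have mF : measurable_fun (regular_args P) (fun u => (level_density P t u)%:E).
    by apply/measurable_EFinP; exact: (measurable_level_density n_gt1 P_monic P_size).
  have mD := measurable_regular_args P.
  have F0 u : (0 <= (level_density P t u)%:E)%E by rewrite lee_fin level_density_ge0.
  have mU : measurable (\big[setU/set0]_(k <- Gs) J k : set R).
    by apply: bigsetU_measurable => k _; exact: mJ.
  have UD : \big[setU/set0]_(k <- Gs) J k `<=` regular_args P.
    rewrite big_seq; elim/big_ind : _ => //; first by move=> X Y XD YD u [/XD|/YD].
  apply: (@le_trans _ _ (\int[mu]_(u in \big[setU/set0]_(k <- Gs) J k) (level_density P t u)%:E)%E);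
    last first.
    exact: ge0_subset_integral.
  rewrite ge0_integral_bigsetU//; first last.
  - exact: measurable_funS mF.
  - move=> k l _ _ [u [/=]]; rewrite /J/= !in_itv/= => /andP[k1 k2] /andP[l1 l2].
    have aux (i j : nat) : i%:R * h < j%:R * h + h -> (i <= j)%N.
      by move=> ij; rewrite -ltnS -(ltr_nat R) -natr1 -(ltr_pM2r hp) mulrDl mul1r.
    apply/eqP; rewrite eqn_leq; apply/andP; split; apply: aux; lra.
  - by rewrite filter_uniq// iota_uniq.
  rewrite big_seq [leRHS]big_seq; apply: lee_sum => k kG.
  have [kN gk] := GsP k kG; have [_ umin] := Hum k kN gk.
  apply: (@le_trans _ _ (\int[mu]_(u in J k) (level_density P t (um k))%:E)%E).
    rewrite integral_cst; last exact: mJ.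
    rewrite [X in (_ <= _ * X)%E](_ : _ = h%:E); first by rewrite EFinM muleC.
    by rewrite -[LHS]/(mu (J k)) /J lebesgue_measure_itv/= lte_fin ltrDl hp -EFinD addrAC subrr add0r.
  apply: ge0_le_integral.
  - exact: mJ.
  - by move=> u _; exact: F0.
  - exact: measurable_cst.
  - exact: (measurable_funS mD (JD k kG) mF).
  - by move=> u /JI /umin; rewrite lee_fin.
rewrite lee_fin sumb addrC lerD// -mulr_suml ler_pdivrMr; last by lra.
have L0 : 0 <= level_integral P t.
  by apply: Rintegral_ge0 => u _; exact: level_density_ge0.
have : e * (1 - 2 * e) * level_integral P t >= 0.
  by rewrite !mulr_ge0// ?(ltW e0)//; lra.
lra.
Qed.

End UpperBound.

Section LengthFormula.
Variable R : realType.
Local Notation C := R[i].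
Implicit Types (t u v eta e : R).

Lemma lemniscateE (P : {poly C}) t : lemniscate P t = level_curve P t.
Proof.
apply/seteqP; split => z; rewrite /lemniscate /level_curve /= /lne.
  by case: ifPn => // n0 [<-]; rewrite lnK// posrE ltNge.
by move=> ->; rewrite leNgt expR_gt0/= expRK.
Qed.

Variables (n : nat) (P : {poly C}).
Hypothesis n_gt1 : (1 < n)%N.
Hypothesis P_monic : P \is monic.
Hypothesis P_size : size P = n.+1.

Lemma hausdorff1_level_curve t :
  hausdorff1 (level_curve P t) = (level_integral P t)%:E.
Proof.
apply/eqP; rewrite eq_le (level_integral_le_hausdorff1 n_gt1 P_monic P_size) andbT.
have L0 : 0 <= level_integral P t.
  by apply: Rintegral_ge0 => u _; exact: level_density_ge0.
set L := level_integral P t in L0 *.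
apply/ereal_supP => _ [d d0 <-]; apply/lee_addgt0Pr => e e0.
pose e' := Num.min 2^-1 (e / (2 * L + 1)).
have L1 : 0 < 2 * L + 1 by lra.
have e'0 : 0 < e' by rewrite lt_min invr_gt0 ltr0n divr_gt0.
have e'2 : 0 < e' <= 2^-1 by rewrite e'0 ge_min lexx.
apply: (le_trans (hausdorff1_pre_upper n_gt1 P_monic P_size t d0 e'2)).
rewrite -EFinD lee_fin -/L.
have : e' <= e / (2 * L + 1) by rewrite /e' ge_min lexx orbT.
rewrite ler_pdivlMr// => h; lra.
Qed.

End LengthFormula.

(** * Second order expansions *)

Section Jets.
Variable R : realType.
Local Notation C := R[i].

Variables (T : Type) (V : T -> Prop) (base dl : T -> C).
Hypothesis dl_le1 : forall x, V x -> normc (dl x) <= 1.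

Definition isO (k : nat) (f : T -> C) :=
  exists2 K : R, 0 <= K & forall x, V x -> normc (f x) <= K * normc (dl x) ^+ k.

Lemma isO_weaken k l f : (k <= l)%N -> isO l f -> isO k f.
Proof.
move=> kl [K K0 HK]; exists K => // x Vx; rewrite (le_trans (HK x Vx))// ler_wpM2l//.
by rewrite ler_wiXn2l ?normc_ge0 ?dl_le1.
Qed.

Lemma isO_add k f g : isO k f -> isO k g -> isO k (fun x => f x + g x).
Proof.
move=> [K K0 HK] [L L0 HL]; exists (K + L); first exact: addr_ge0.
move=> x Vx; rewrite (le_trans (normcD _ _))// mulrDl lerD//; [exact: HK|exact: HL].
Qed.

Lemma isO_opp k f : isO k f -> isO k (fun x => - f x).
Proof. by move=> [K K0 HK]; exists K => // x Vx; rewrite normc_opp HK. Qed.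

Lemma isO_sub k f g : isO k f -> isO k g -> isO k (fun x => f x - g x).
Proof. by move=> Hf Hg; apply: isO_add => //; exact: isO_opp. Qed.

Lemma isO_mul k l f g : isO k f -> isO l g -> isO (k + l) (fun x => f x * g x).
Proof.
move=> [K K0 HK] [L L0 HL]; exists (K * L); first exact: mulr_ge0.
move=> x Vx; rewrite normcM exprD.
rewrite (@le_trans _ _ (K * normc (dl x) ^+ k * (L * normc (dl x) ^+ l)))//.
  by rewrite ler_pM ?normc_ge0 ?HK ?HL.
by rewrite mulrACA.
Qed.

Lemma isO_dl : isO 1 dl.
Proof. by exists 1 => // x _; rewrite mul1r. Qed.

Lemma isO_ext k f g : (forall x, V x -> f x = g x) -> isO k f -> isO k g.
Proof. by move=> fg [K K0 HK]; exists K => // x Vx; rewrite -fg// HK. Qed.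

(** [jet f a0 a1]: second order expansion in [dl], uniform in the family, whose
    coefficients depend on the base point only; of the coefficient
    of [dl ^+ 2] only a bound is recorded, since it cancels in the four-point mean. *)
Definition jet (f : T -> C) (a0 a1 : C -> C) := exists a2 : C -> C,
  [/\ isO 0 (a0 \o base), isO 0 (a1 \o base), isO 0 (a2 \o base) &
   isO 3 (fun x => f x - (a0 (base x) + a1 (base x) * dl x + a2 (base x) * dl x ^+ 2))].

Lemma isO_exp2 : isO 2 (fun x => dl x ^+ 2).
Proof. exact: (isO_mul isO_dl isO_dl). Qed.

Lemma jet_isO0 f a0 a1 : jet f a0 a1 -> isO 0 f.
Proof.
move=> [a2 [h0 h1 h2 h3]].
apply: (isO_ext (f := fun x => (f x - (a0 (base x) + a1 (base x) * dl x + a2 (base x) * dl x ^+ 2)) +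
  (a0 (base x) + a1 (base x) * dl x + a2 (base x) * dl x ^+ 2))).
  by move=> x _; rewrite subrK.
apply: isO_add; first exact: isO_weaken h3.
apply: isO_add.
  by apply: isO_add => //; apply: isO_weaken (isO_mul h1 isO_dl).
by apply: isO_weaken (isO_mul h2 isO_exp2).
Qed.

Lemma jet_ext f g a0 a1 b0 b1 : (forall x, V x -> f x = g x) ->
  (forall x, V x -> a0 (base x) = b0 (base x)) ->
  (forall x, V x -> a1 (base x) = b1 (base x)) ->
  jet f a0 a1 -> jet g b0 b1.
Proof.
move=> fg e0 e1 [a2 [h0 h1 h2 h3]]; exists a2; split => //.
- exact: isO_ext h0.
- exact: isO_ext h1.
- by apply: isO_ext h3 => x Vx; rewrite fg// e0// e1.
Qed.

Lemma jet_base (a : C -> C) : isO 0 (a \o base) -> jet (a \o base) a (fun=> 0).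
Proof.
have z k : isO k (fun=> 0).
  by exists 0 => // x _; rewrite normc0 mul0r.
move=> h; exists (fun=> 0); split => //.
by apply: isO_ext (z 3) => x _ /=; rewrite !mul0r !addr0 subrr.
Qed.

Lemma jet_add f g a0 a1 b0 b1 : jet f a0 a1 -> jet g b0 b1 ->
  jet (fun x => f x + g x) (fun z => a0 z + b0 z) (fun z => a1 z + b1 z).
Proof.
move=> [a2 [h0 h1 h2 h3]] [b2 [k0 k1 k2 k3]]; exists (fun z => a2 z + b2 z).
split; [exact: isO_add h0 k0|exact: isO_add h1 k1|exact: isO_add h2 k2|].
by apply: isO_ext (isO_add h3 k3) => x _ /=; ring.
Qed.

Lemma jet_mul f g a0 a1 b0 b1 : jet f a0 a1 -> jet g b0 b1 ->
  jet (fun x => f x * g x) (fun z => a0 z * b0 z) (fun z => a0 z * b1 z + a1 z * b0 z).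
Proof.
move=> jf jg; have g0 := jet_isO0 jg.
case: jf => a2 [h0 h1 h2 h3]; case: jg => b2 [k0 k1 k2 k3].
exists (fun z => a0 z * b2 z + a1 z * b1 z + a2 z * b0 z).
split; [exact: isO_mul h0 k0|by apply: isO_add; [exact: isO_mul h0 k1|exact: isO_mul h1 k0]|
  by apply: isO_add; [apply: isO_add; [exact: isO_mul h0 k2|exact: isO_mul h1 k1]|exact: isO_mul h2 k0]|].
have pa : isO 0 (fun x => a0 (base x) + a1 (base x) * dl x + a2 (base x) * dl x ^+ 2).
  apply: isO_add; [apply: isO_add => //|].
    by apply: isO_weaken (isO_mul h1 isO_dl).
  by apply: isO_weaken (isO_mul h2 isO_exp2).
have d3 : isO 3 (fun x => dl x ^+ 3).
  by apply: isO_ext (isO_mul isO_dl isO_exp2) => x _; rewrite -exprS.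
have d4 : isO 3 (fun x => dl x ^+ 4).
  apply: (@isO_weaken 3 4) => //.
  by apply: isO_ext (isO_mul isO_exp2 isO_exp2) => x _; rewrite -exprD.
have t1 := isO_mul h3 g0; have t2 := isO_mul pa k3.
have t3 : isO 3 (fun x => (a1 (base x) * b2 (base x) + a2 (base x) * b1 (base x)) * dl x ^+ 3).
  by apply: (@isO_mul 0 3) => //; apply: (@isO_add 0); [exact: isO_mul h1 k2|exact: isO_mul h2 k1].
have t4 : isO 3 (fun x => (a2 (base x) * b2 (base x)) * dl x ^+ 4).
  by apply: (@isO_mul 0 3) => //; exact: isO_mul h2 k2.
by apply: isO_ext (isO_add (isO_add t1 t2) (isO_add t3 t4)) => x _ /=; ring.
Qed.

Lemma jet_opp f a0 a1 : jet f a0 a1 -> jet (fun x => - f x) (fun z => - a0 z) (fun z => - a1 z).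
Proof.
move=> [a2 [h0 h1 h2 h3]]; exists (fun z => - a2 z).
split; [exact: isO_opp h0|exact: isO_opp h1|exact: isO_opp h2|].
by apply: isO_ext (isO_opp h3) => x _ /=; ring.
Qed.

(** With [y = f - 1] one has [1 / f = 1 - y + y^2 - y^3 / f]. *)
Lemma jet_inv f a1 : (forall x, V x -> 2^-1 <= normc (f x)) ->
  jet f (fun=> 1) a1 -> jet (fun x => (f x)^-1) (fun=> 1) (fun z => - a1 z).
Proof.
move=> Hf jf.
have one : isO 0 (fun=> 1 : C) by exists 1 => // x _; rewrite normc1 mul1r.
have y1 : isO 1 (fun x => f x - 1).
  case: (jf) => a2 [h0 h1 h2 h3].
  have t1 : isO 1 (fun x => a1 (base x) * dl x) := isO_mul h1 isO_dl.
  have t2 : isO 1 (fun x => a2 (base x) * dl x ^+ 2) := isO_weaken (isT : 1 <= 2)%N (isO_mul h2 isO_exp2).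
  apply: isO_ext (isO_add (isO_weaken (isT : 1 <= 3)%N h3) (isO_add t1 t2)) => x _ /=; ring.
have iO : isO 0 (fun x => (f x)^-1).
  exists 2 => // x /Hf h; rewrite expr0 mulr1 normcV -[leRHS]invrK lef_pV2 ?posrE ?invr_gt0//.
  by rewrite (lt_le_trans _ h)// invr_gt0.
have jone := jet_base (a := fun=> 1) one.
have jy := jet_add jf (jet_opp jone).
have [a2 [h0 h1 h2 h3]] := jet_add (jet_add jone (jet_opp jy)) (jet_mul jy jy).
exists a2; split => //.
- apply: isO_ext h1 => x _ /=; ring.
- have y3 := isO_mul (isO_mul (isO_mul y1 y1) y1) iO.
  apply: isO_ext (isO_sub h3 y3) => x Vx /=.
  have fx : f x != 0 by rewrite -normc_gt0 (lt_le_trans _ (Hf x Vx))// invr_gt0.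
  field.
  exact: fx.
Qed.

End Jets.

Section NormExpansion.
Variable R : realType.
Local Notation C := R[i].

(** With [N = |1 + x|] one has [(N - (1 + Re x)) * (N + (1 + Re x)) = (Im x)^2]. *)
Lemma normc_1D_ge (x : C) : normc x < 1 ->
  1 + complex.Re x + complex.Im x ^+ 2 / 2 - normc x ^+ 3 / 2 <= normc (1 + x).
Proof.
move=> x1; set r := normc x in x1 *.
have r0 : 0 <= r := normc_ge0 x.
set s := complex.Re x; set v := complex.Im x; set N := normc (1 + x).
have sr : `|s| <= r := Re_le_normc x.
have vr : `|v| <= r := Im_le_normc x.
have N0 : 0 <= N := normc_ge0 _.
have NE : N ^+ 2 = (1 + s) ^+ 2 + v ^+ 2.
  by rewrite /N sqr_normc_ReIm ReD ImD /= add0r.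
have N1 : N <= 1 + r by rewrite /N (le_trans (normcD _ _))// normc1.
have A0 : 0 < 1 + s by move: sr; rewrite ler_norml => /andP[]; lra.
have A1 : 1 + s <= 1 + r by move: sr; rewrite ler_norml => /andP[]; lra.
have AN : 1 + s <= N.
  by rewrite -(@ler_pXn2r _ 2) ?nnegrE ?(ltW A0)// NE lerDl sqr_ge0.
have v2 : v ^+ 2 <= r ^+ 2 by rewrite -real_normK ?num_real// lerXn2r ?nnegrE.
have h : (N - (1 + s)) * (N + (1 + s)) = v ^+ 2.
  have -> : v ^+ 2 = N ^+ 2 - (1 + s) ^+ 2 by rewrite NE; ring.
  by ring.
have h1 : v ^+ 2 <= (N - (1 + s)) * (2 * (1 + r)).
  by rewrite -h ler_wpM2l ?subr_ge0//; lra.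
have h2 : v ^+ 2 * (1 - r) <= (N - (1 + s)) * (2 * (1 + r)) * (1 - r).
  by rewrite ler_wpM2r// subr_ge0 ltW.
have h3 : (N - (1 + s)) * (2 * (1 + r)) * (1 - r) <= 2 * (N - (1 + s)).
  have -> : (N - (1 + s)) * (2 * (1 + r)) * (1 - r) =
     2 * (N - (1 + s)) - 2 * ((N - (1 + s)) * r ^+ 2) by ring.
  have : 0 <= (N - (1 + s)) * r ^+ 2 by rewrite mulr_ge0 ?exprn_ge0// subr_ge0.
  lra.
have h4 : v ^+ 2 * r <= r ^+ 3 by rewrite [r ^+ 3]exprSr ler_wpM2r.
lra.
Qed.

(** The mean of a subharmonic function over the four points [rho], [- rho],
    [i rho], [- i rho]: the linear and quadratic terms cancel and the
    squares of the imaginary parts of the linear terms add up to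
    [2 * rho ^ 2 * |a| ^ 2]. *)
Lemma four_point_mean (A B K : R) : 0 <= A -> 0 <= B -> 0 <= K ->
  exists2 K', 0 < K' & exists2 rho0, 0 < rho0 & forall (rho : R) (a b x1 x2 x3 x4 : C),
    0 < rho <= rho0 -> normc a <= A -> normc b <= B ->
    normc (x1 - (1 + a * rho%:C + b * rho%:C ^+ 2)) <= K * rho ^+ 3 ->
    normc (x2 - (1 + a * (- rho%:C) + b * (- rho%:C) ^+ 2)) <= K * rho ^+ 3 ->
    normc (x3 - (1 + a * ('i * rho%:C) + b * ('i * rho%:C) ^+ 2)) <= K * rho ^+ 3 ->
    normc (x4 - (1 + a * (- ('i * rho%:C)) + b * (- ('i * rho%:C)) ^+ 2)) <= K * rho ^+ 3 ->
    4 + rho ^+ 2 * normc a ^+ 2 - K' * rho ^+ 3 <=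
      normc x1 + normc x2 + normc x3 + normc x4.
Proof.
move=> A0 B0 K0; pose S := A + B + K.
have S0 : 0 <= S by rewrite !addr_ge0.
(* One point: [x] is [1 + l + q + err] with [|l| <= A rho], [|q| <= B rho ^ 2]. *)
have one (rho : R) (l q x : C) : 0 < rho -> rho <= 1 -> S * rho < 1 ->
    normc l <= A * rho -> normc q <= B * rho ^+ 2 -> normc (x - (1 + l + q)) <= K * rho ^+ 3 ->
    1 + complex.Re l + complex.Re q + complex.Im l ^+ 2 / 2 -
      (K + A * S + S ^+ 3) * rho ^+ 3 <= normc x.
  move=> rho0 rho1 Sr lA qB; set err := x - _ => eK.
  have -> : x = 1 + (l + q + err) by rewrite /err; ring.
  set y := q + err.
  have r0 := ltW rho0.
  have rr : rho ^+ 3 <= rho ^+ 2 by rewrite exprS ler_piMl ?exprn_ge0.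
  have rr2 : rho ^+ 2 <= rho by rewrite expr2 ler_piMl.
  have yle : normc y <= S * rho ^+ 2.
    rewrite (le_trans (normcD _ _))// (le_trans (lerD qB eK))//.
    have : K * rho ^+ 3 <= K * rho ^+ 2 by rewrite ler_wpM2l.
    have : 0 <= A * rho ^+ 2 by rewrite mulr_ge0 ?exprn_ge0.
    rewrite /S; lra.
  have tot : normc (l + q + err) <= S * rho.
    rewrite (le_trans (normcD _ _))// (le_trans (lerD (normcD _ _) (lexx _)))//.
    have : B * rho ^+ 2 <= B * rho by rewrite ler_wpM2l.
    have : K * rho ^+ 3 <= K * rho by rewrite ler_wpM2l// (le_trans rr).
    rewrite /S; lra.
  apply: le_trans (normc_1D_ge (le_lt_trans tot Sr)).
  have lqE : l + q + err = l + y by rewrite -addrA.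
  rewrite lqE in tot *.
  have ReE : complex.Re (l + y) = complex.Re l + (complex.Re q + complex.Re err).
    by rewrite /y !ReD.
  rewrite ReE [complex.Im (l + y)]ImD.
  have e1 : `|complex.Re err| <= K * rho ^+ 3 := le_trans (Re_le_normc _) eK.
  have e2 : normc (l + y) ^+ 3 <= S ^+ 3 * rho ^+ 3.
    by rewrite -exprMn lerXn2r ?nnegrE ?normc_ge0 ?mulr_ge0.
  have e3 : `|complex.Im l * complex.Im y| <= A * S * rho ^+ 3.
    rewrite normrM (@le_trans _ _ (A * rho * (S * rho ^+ 2)))//.
      by rewrite ler_pM//; [exact: le_trans (Im_le_normc _) lA|exact: le_trans (Im_le_normc _) yle].
    by rewrite exprS; lra.
  have e4 : (complex.Im l + complex.Im y) ^+ 2 =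
     complex.Im l ^+ 2 + 2 * (complex.Im l * complex.Im y) + complex.Im y ^+ 2 by ring.
  have e5 : 0 <= complex.Im y ^+ 2 := sqr_ge0 _.
  rewrite e4.
  move: e1 e3; rewrite !ler_norml => /andP[e1 _] /andP[e3 _].
  have : 0 <= S ^+ 3 * rho ^+ 3 by rewrite mulr_ge0 ?exprn_ge0.
  move: e1 e2 e3 e5; set im := complex.Im l * _; set m2 := complex.Im y ^+ 2.
  set m1 := complex.Im l ^+ 2; set n3 := normc _ ^+ 3; set r3 := rho ^+ 3.
  lra.
exists (4 * (K + A * S + S ^+ 3) + 1).
  by rewrite ltr_wpDl// mulr_ge0// !addr_ge0 ?mulr_ge0 ?exprn_ge0.
exists (Num.min 1 ((S + 1)^-1 / 2)).
  by rewrite lt_min ltr01 divr_gt0 ?invr_gt0// ltr_wpDl.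
move=> rho a b x1 x2 x3 x4 /andP[rho0]; rewrite le_min => /andP[rho1 rhoS] aA bB.
have Sr : S * rho < 1.
  have S1 : 0 < S + 1 by rewrite ltr_wpDl.
  have : (S + 1) * rho <= 2^-1.
    by rewrite -ler_pdivlMl// (le_trans rhoS).
  lra.
have r0 := ltW rho0.
have nr : normc rho%:C = rho by rewrite normc_real ger0_norm.
have bnd1 (d : C) : normc d = rho -> normc (a * d) <= A * rho.
  by move=> dE; rewrite normcM dE ler_wpM2r.
have bnd2 (d : C) : normc d = rho -> normc (b * d ^+ 2) <= B * rho ^+ 2.
  by move=> dE; rewrite normcM normcX dE ler_wpM2r// exprn_ge0.
have normc_i' : normc ('i * rho%:C) = rho by rewrite normcM normc_i mul1r.
have one' d x : normc d = rho -> normc (x - (1 + a * d + b * d ^+ 2)) <= K * rho ^+ 3 ->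
    1 + complex.Re (a * d) + complex.Re (b * d ^+ 2) + complex.Im (a * d) ^+ 2 / 2 -
      (K + A * S + S ^+ 3) * rho ^+ 3 <= normc x.
  by move=> dE; exact: one rho0 rho1 Sr (bnd1 _ dE) (bnd2 _ dE).
move=> /(one' _ _ nr) h1 h2 /(one' _ _ normc_i') h3 h4.
move: h2 => /(one' _ _ (etrans (normc_opp _) nr)) h2.
move: h4 => /(one' _ _ (etrans (normc_opp _) normc_i')) h4.
rewrite sqr_normc_ReIm.
have r3 : 0 <= rho ^+ 3 by rewrite exprn_ge0.
move: h1 h2 h3 h4; clear one' bnd1 bnd2 aA bB; case: a => a1 a2; case: b => b1 b2.
have -> : ('i * rho%:C) ^+ 2 = - (rho ^+ 2)%:C.
  by rewrite exprMn sqr_i mulN1r rmorphXn.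
have -> : (- rho%:C) ^+ 2 = (rho ^+ 2)%:C by rewrite sqrrN rmorphXn.
have -> : (- ('i * rho%:C)) ^+ 2 = - (rho ^+ 2)%:C.
  by rewrite sqrrN exprMn sqr_i mulN1r rmorphXn.
have -> : rho%:C ^+ 2 = (rho ^+ 2)%:C by rewrite rmorphXn.
rewrite /= !(mulr0, mul0r, subr0, sub0r, addr0, add0r, mulr1, mul1r, oppr0, mulrN, opprK, sqrrN).
clear -r3; set T := K + A * S + S ^+ 3; move: (normc x1) (normc x2) (normc x3) (normc x4).
move=> y1 y2 y3 y4 h1 h2 h3 h4; lra.
Qed.

End NormExpansion.

(** * Second order expansion of the density *)

Section SpeedExpansion.
Variable R : realType.
Local Notation C := R[i].
Implicit Types (t u v eta e : R).

Lemma cexp_taylor2_real (x : R) : `|x| <= 1 ->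
  normc (cexp x 0 - (1 + x%:C + x%:C ^+ 2 / 2)) <= (expR 1 + 2) * `|x| ^+ 3.
Proof.
move=> x1.
have -> : cexp x 0 - (1 + x%:C + x%:C ^+ 2 / 2) = (expR x - 1 - x - x ^+ 2 / 2)%:C.
  have -> : cexp x 0 = (expR x)%:C by rewrite /cexp cos0 sin0 mulr1 mulr0.
  rewrite !(rmorphB, rmorphM, rmorphXn, rmorph1)/= fmorphV rmorph_nat; ring.
rewrite normc_real (le_trans (expR_taylor2 x1))// ler_wpM2r ?exprn_ge0//.
by rewrite lerDl.
Qed.

Lemma cexp_taylor2_imag (x : R) : `|x| <= 1 ->
  normc (cexp 0 x - (1 + 'i * x%:C + ('i * x%:C) ^+ 2 / 2)) <= (expR 1 + 2) * `|x| ^+ 3.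
Proof.
move=> x1.
have -> : cexp 0 x - (1 + 'i * x%:C + ('i * x%:C) ^+ 2 / 2) =
    (cos x - 1 + x ^+ 2 / 2)%:C + 'i * (sin x - x)%:C.
  have -> : cexp 0 x = (cos x)%:C + 'i * (sin x)%:C.
    by apply/eqP; rewrite eq_complex /= expR0; apply/andP; split; apply/eqP; ring.
  rewrite exprMn sqr_i !(rmorphB, rmorphD, rmorphM, rmorphXn, rmorph1)/= fmorphV rmorph_nat; ring.
rewrite (le_trans (normcD _ _))// normcM normc_i mul1r !normc_real.
have h1 := cos_taylor2 x; have h2 := sin_subx_le x.
have h3 : `|x| ^+ 4 <= `|x| ^+ 3 by rewrite exprS ler_piMl ?exprn_ge0.
have h4 : 0 <= expR 1 * `|x| ^+ 3 by rewrite mulr_ge0 ?expR_ge0 ?exprn_ge0.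
lra.
Qed.

Variables (n : nat) (P : {poly C}).
Hypothesis n_gt1 : (1 < n)%N.
Hypothesis P_monic : P \is monic.
Hypothesis P_size : size P = n.+1.

(** With [exp s = P z], the map [s |-> z] has derivative [G' = P / P'], and
    [log_deriv c] is the logarithmic derivative [G'' / G' - c] of
    [exp (- c s) G' s]. *)
Definition log_deriv (c : R) (z : C) : C :=
  1 - c%:C - P.[z] * P^`()^`().[z] / P^`().[z] ^+ 2.

(** Second order expansion of [exp (- c s) * G' s] about a point of the level
    curve, divided by its value there. It is obtained by solving [P z = lam * P z0]
    for [z] up to third order errors and substituting in [P']. Here [lam] and [m]
    stand for [exp d] and [exp (- c d)]. The constants are uniform over the curve;
    the coefficient [b] only has to be bounded, since it cancels in the four-point mean. *)
Lemma speed_jet t eta (c K0 : R) : 0 < eta -> 0 <= K0 ->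
  (forall z, normc P.[z] = expR t -> far P eta P.[z]) ->
  exists r A B K (b : C -> C), [/\ 0 < r, 0 <= A, 0 <= B, 0 <= K &
    forall z0 z d lam m : C, normc P.[z0] = expR t -> normc (z - z0) <= r ->
      normc d <= 1 -> P.[z] = lam * P.[z0] ->
      normc (lam - (1 + d + d ^+ 2 / 2)) <= K0 * normc d ^+ 3 ->
      normc (m - (1 - c%:C * d + (c%:C * d) ^+ 2 / 2)) <= K0 * normc d ^+ 3 ->
      [/\ normc (log_deriv c z0) <= A, normc (b z0) <= B &
        normc (lam * m / (P^`().[z] / P^`().[z0]) -
          (1 + log_deriv c z0 * d + b z0 * d ^+ 2)) <= K * normc d ^+ 3]].
Proof.
move=> eta0 K00 Hfar.
have half0 : 0 < 2^-1 :> R by rewrite invr_gt0.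
have [r1 r10 Hr1] := near_linear n_gt1 P_monic P_size (expR t) eta0 half0.
have [r2 r20 Hr2] := near_deriv n_gt1 P_monic P_size (expR t) eta0 half0.
have [p' p'0 Hp'] := far_deriv n_gt1 P_monic P_size eta0.
have [M M0 HM] := fiber_bounded n_gt1 P_monic P_size (expR t).
pose r := Num.min r1 r2.
have r0 : 0 < r by rewrite lt_min r10.
(* The expansion calculus is applied to the family of all admissible data. *)
pose T := (C * C * C * C * C)%type.
pose base (x : T) := x.1.1.1.1; pose zz (x : T) := x.1.1.1.2.
pose dl (x : T) := x.1.1.2; pose lam (x : T) := x.1.2; pose mm (x : T) := x.2.
pose V (x : T) := [/\ normc P.[base x] = expR t, normc (zz x - base x) <= r,
   normc (dl x) <= 1 /\ P.[zz x] = lam x * P.[base x],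
   normc (lam x - (1 + dl x + dl x ^+ 2 / 2)) <= K0 * normc (dl x) ^+ 3 &
   normc (mm x - (1 - c%:C * dl x + (c%:C * dl x) ^+ 2 / 2)) <= K0 * normc (dl x) ^+ 3].
have dl1 x : V x -> normc (dl x) <= 1 by case=> _ _ [].
have Vfar x : V x -> far P eta P.[base x] by case=> /Hfar.
have pbase x : V x -> p' <= normc P^`().[base x] by move=> /Vfar /Hp'.
have pn0 x : V x -> P^`().[base x] != 0.
  by move=> /pbase h; rewrite -normc_gt0 (lt_le_trans p'0).
have weak := isO_weaken dl1.
have one : isO V dl 0 (fun=> 1) by exists 1 => // x _; rewrite normc1 mul1r.
have cstO (a : C) : isO V dl 0 (fun=> a).
  by exists (normc a); rewrite ?normc_ge0// => x _; rewrite mulr1.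
have polyO (Q : {poly C}) : isO V dl 0 (fun x => Q.[base x]).
  have [K' K'0 HK'] := poly_bounded Q M.
  exists K'; first exact: ltW.
  by move=> x [xP _ _ _ _]; rewrite mulr1 HK'// HM ?xP.
have invO : isO V dl 0 (fun x => (P^`().[base x])^-1).
  exists p'^-1; first by rewrite invr_ge0 ltW.
  move=> x /pbase h; rewrite mulr1 normcV lef_pV2 ?posrE//.
  exact: lt_le_trans h.
pose al (z : C) := P.[z] / P^`().[z].
have alO : isO V dl 0 (al \o base) := isO_mul (polyO P) invO.
have dlO := isO_dl V dl.
have dl2O := isO_exp2 V dl.
have jlam : jet V base dl lam (fun=> 1) (fun=> 1).
  exists (fun=> 2^-1); split; [exact: cstO|exact: cstO|exact: cstO|].
  exists K0 => // x [_ _ _ h _]; apply: le_trans h.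
  by rewrite mul1r [2^-1 * _]mulrC.
have jm : jet V base dl mm (fun=> 1) (fun=> - c%:C).
  exists (fun=> c%:C ^+ 2 / 2); split; [exact: cstO|exact: cstO|exact: cstO|].
  exists K0 => // x [_ _ _ _ h]; apply: le_trans h.
  by rewrite mulNr exprMn [_ ^+ 2 / 2 * _]mulrAC.
pose y x := zz x - base x.
have lamO1 : isO V dl 1 (fun x => lam x - 1).
  have h3 : isO V dl 3 (fun x => lam x - (1 + dl x + dl x ^+ 2 / 2)).
    by exists K0 => // x [].
  have h2 : isO V dl 2 (fun x => dl x ^+ 2 / 2) := isO_mul dl2O (cstO 2^-1).
  apply: isO_ext (isO_add (weak 1 3 _ isT h3) (isO_add dlO (weak 1 2 _ isT h2))) => x _ /=.
  by ring.
have lamO2 : isO V dl 2 (fun x => lam x - 1 - dl x).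
  have h3 : isO V dl 3 (fun x => lam x - (1 + dl x + dl x ^+ 2 / 2)).
    by exists K0 => // x [].
  have h2 : isO V dl 2 (fun x => dl x ^+ 2 / 2) := isO_mul dl2O (cstO 2^-1).
  apply: isO_ext (isO_add (weak 2 3 _ isT h3) h2) => x _ /=.
  by ring.
have yO : isO V dl 1 y.
  have [K1 K10 HK1] := isO_mul lamO1 (polyO P).
  exists (2 * p'^-1 * K1); first by rewrite !mulr_ge0// invr_ge0 ltW.
  move=> x Vx; have px := pbase x Vx; have := HK1 x Vx; rewrite addn0 => hK1.
  have [xP xr [_ xl] _ _] := Vx.
  have xr1 : normc (zz x - base x) <= r1 by rewrite (le_trans xr)// /r ge_min lexx.
  have := Hr1 (base x) (zz x) (base x); rewrite xP lexx subrr normc0 (ltW r10).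
  move=> /(_ isT (Vfar x Vx) xr1 isT).
  have -> : P.[zz x] - P.[base x] = (lam x - 1) * P.[base x] by rewrite xl; ring.
  set q := (lam x - 1) * P.[base x] in hK1 *; rewrite -/(y x) => h.
  have h2 := lerB_normc (P^`().[base x] * y x) q.
  rewrite -[normc (_ - q)]normc_opp opprB normcM in h2.
  have h3 : p' * normc (y x) <= normc P^`().[base x] * normc (y x).
    by rewrite ler_wpM2r ?normc_ge0.
  have -> : 2 * p'^-1 * K1 * normc (dl x) ^+ 1 = p'^-1 * (2 * (K1 * normc (dl x) ^+ 1)).
    by ring.
  rewrite ler_pdivlMl//; move: h h2 h3 hK1.
  set a1 := normc _; set a2 := normc (y x); set a3 := normc _; set a4 := normc q.
  by rewrite expr1; lra.
have yM x : V x -> normc (base x) <= M + r /\ normc (y x) <= M + r.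
  move=> [xP xr _ _ _]; split.
    by rewrite (le_trans (HM _ _))// ?xP// lerDl ltW.
  by rewrite (le_trans xr)// lerDr ltW.
have taylorO (Q : {poly C}) : isO V dl 3 (fun x =>
    Q.[zz x] - Q.[base x] - Q^`().[base x] * y x - Q^`()^`().[base x] / 2 * y x ^+ 2).
  have [K2 K20 HK2] := poly_taylor2 Q (M + r).
  have y3 : isO V dl 3 (fun x => y x ^+ 3).
    apply: isO_ext (isO_mul (isO_mul yO yO) yO) => x _ /=; rewrite !exprS expr0; ring.
  have [K3 K30 HK3] := y3; exists (K2 * K3); first by rewrite mulr_ge0// ltW.
  move=> x Vx; have [h1 h2] := yM x Vx.
  have -> : zz x = base x + y x by rewrite /y addrC subrK.
  rewrite (le_trans (HK2 _ _ h1 h2))// -mulrA ler_wpM2l ?(ltW K20)//.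
  by rewrite -normcX HK3.
have jO3 f : isO V dl 3 f -> jet V base dl f (fun=> 0) (fun=> 0).
  move=> h; exists (fun=> 0); split; [exact: cstO|exact: cstO|exact: cstO|].
  by apply: isO_ext h => x _ /=; rewrite !mul0r !addr0 subr0.
have jbase (a : C -> C) (h : isO V dl 0 (fun x => a (base x))) :
  jet V base dl (fun x => a (base x)) a (fun=> 0) := jet_base h.
pose rem x := P.[zz x] - P.[base x] - P^`().[base x] * y x - P^`()^`().[base x] / 2 * y x ^+ 2.
have remO : isO V dl 3 rem := taylorO P.
have yE x : V x -> y x = al (base x) * (lam x - 1) -
    P^`()^`().[base x] / 2 * (P^`().[base x])^-1 * y x ^+ 2 - rem x * (P^`().[base x])^-1.
  move=> Vx; have [_ _ [_ xl] _ _] := Vx.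
  by rewrite /rem xl /al; field; exact: pn0.
have c2O : isO V dl 0 (fun x => P^`()^`().[base x] / 2 * (P^`().[base x])^-1).
  exact: (isO_mul (isO_mul (polyO _) (cstO 2^-1)) invO).
have y2O : isO V dl 2 (fun x => y x ^+ 2) := isO_mul yO yO.
have yO2 : isO V dl 2 (fun x => y x - al (base x) * dl x).
  have h1 : isO V dl 2 (fun x => al (base x) * (lam x - 1 - dl x)) := isO_mul alO lamO2.
  have h2 : isO V dl 2 (fun x => P^`()^`().[base x] / 2 * (P^`().[base x])^-1 * y x ^+ 2) :=
    isO_mul c2O y2O.
  have h3 : isO V dl 3 (fun x => rem x * (P^`().[base x])^-1) := isO_mul remO invO.
  apply: isO_ext (isO_sub (isO_sub h1 h2) (weak 2 3 _ isT h3)) => x Vx /=.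
  by rewrite [y x in RHS]yE//; ring.
have aldlO : isO V dl 1 (fun x => al (base x) * dl x) := isO_mul alO dlO.
have jy2 : jet V base dl (fun x => y x ^+ 2) (fun=> 0) (fun=> 0).
  exists (fun z => al z ^+ 2); split; [exact: cstO|exact: cstO|exact: (isO_mul alO alO)|].
  apply: isO_ext (isO_mul yO2 (isO_add yO aldlO)) => x _ /=; ring.
have jl1 := jet_add jlam (jet_opp (jbase (fun=> 1) one)).
have jy : jet V base dl y (fun=> 0) al.
  have h1 := jet_mul dl1 (jbase al alO) jl1.
  have h2 := jet_mul dl1 (jbase (fun z => P^`()^`().[z] / 2 * (P^`().[z])^-1) c2O) jy2.
  have h3 := jO3 _ (isO_mul remO invO).
  apply: jet_ext (jet_add (jet_add h1 (jet_opp h2)) (jet_opp h3)) => x Vx /=.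
  - by rewrite [RHS]yE.
  - by ring.
  - by ring.
pose fq x := P^`().[zz x] / P^`().[base x].
have jf : jet V base dl fq (fun=> 1) (fun z => P^`()^`().[z] / P^`().[z] * al z).
  have g1 : isO V dl 0 (fun x => P^`()^`().[base x] / P^`().[base x]) := isO_mul (polyO _) invO.
  have g2 : isO V dl 0 (fun x => P^`()^`()^`().[base x] / 2 * (P^`().[base x])^-1) :=
     isO_mul (isO_mul (polyO _) (cstO 2^-1)) invO.
  have h0 := jbase (fun=> 1) one.
  have h1 := jet_mul dl1 (jbase (fun z => P^`()^`().[z] / P^`().[z]) g1) jy.
  have h2 := jet_mul dl1 (jbase (fun z => P^`()^`()^`().[z] / 2 * (P^`().[z])^-1) g2) jy2.
  have h3 := jO3 _ (isO_mul (taylorO P^`()) invO).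
  apply: jet_ext (jet_add (jet_add h0 h1) (jet_add h2 h3)) => x Vx /=.
  - by rewrite /fq; field; exact: pn0.
  - by ring.
  - by ring.
have fhalf x : V x -> 2^-1 <= normc (fq x).
  move=> Vx; have [xP xr _ _ _] := Vx; have px := lt_le_trans p'0 (pbase x Vx).
  have xr2 : normc (zz x - base x) <= r2 by rewrite (le_trans xr)// /r ge_min lexx orbT.
  have := Hr2 (base x) (zz x); rewrite xP lexx => /(_ isT (Vfar x Vx) xr2) h.
  have h2 := lerB_normc P^`().[base x] P^`().[zz x]; rewrite normc_subC in h2.
  by rewrite /fq normcM normcV ler_pdivlMr//; lra.
have jfin := jet_mul dl1 (jet_mul dl1 jlam jm) (jet_inv dl1 fhalf jf).
have [b [b0 b1 b2 b3]] : jet V base dl (fun x => lam x * mm x / fq x) (fun=> 1) (log_deriv c).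
  apply: jet_ext jfin => x Vx //=; first by rewrite !mulr1.
  by rewrite /log_deriv /al; field; exact: pn0.
have [A A0 HA] := b1; have [B B0 HB] := b2; have [K KK HK] := b3.
exists r, A, B, K, b; split => // z0 z d la m h1 h2 h3 h4 h5 h6.
have Vx : V (z0, z, d, la, m) by split.
have := HA _ Vx; have := HB _ Vx; have := HK _ Vx.
by rewrite !mulr1.
Qed.

End SpeedExpansion.

Section SecondDifference.
Variable R : realType.
Local Notation C := R[i].
Implicit Types (t u v eta e : R).

Variables (n : nat) (P : {poly C}).
Hypothesis n_gt1 : (1 < n)%N.
Hypothesis P_monic : P \is monic.
Hypothesis P_size : size P = n.+1.

Let n_gt0 : (0 < n)%N. Proof. exact: ltnW. Qed.

Definition regular_level (Q : {poly C}) t :=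
  forall zeta, Q^`().[zeta] = 0 -> normc Q.[zeta] != expR t.

Lemma regular_level_far t : regular_level P t ->
  exists2 eta, 0 < eta & forall w, normc w = expR t -> far P eta w.
Proof.
move=> reg.
have [|zeta zc Hz] := @seq_min R _ (crit P) (fun c => `|expR t - normc P.[c]|).
  by rewrite (size_crit n_gt1 P_monic P_size) -ltnS prednK.
exists `|expR t - normc P.[zeta]|.
  rewrite normr_gt0 subr_eq0 eq_sym; apply: reg.
  by apply/eqP; rewrite -(mem_crit n_gt1 P_monic P_size).
move=> w wE c /eqP; rewrite -(mem_crit n_gt1 P_monic P_size) => /Hz h.
by rewrite (le_trans h)// -wE dist_normc.
Qed.

Lemma far_regular_level t eta : 0 < eta -> (forall w, normc w = expR t -> far P eta w) ->
  forall s, `|expR s - expR t| < eta -> regular_level P s.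
Proof.
move=> eta0 Hf s hs zeta zc; apply/eqP => ze.
have v0 : P.[zeta] != 0 by rewrite -normc_gt0 ze expR_gt0.
have [u _ vE] := cexp_polar v0.
have := Hf (cexp t u) (normc_cexp t u) zeta zc.
by rewrite vE normc_cexpB lnK ?posrE ?normc_gt0// ze leNgt distrC hs.
Qed.

Definition speed_energy c (z : C) : R := speed P z * normc (log_deriv P c z) ^+ 2.

(** The density is a sum of moduli [|G'|] of local analytic functions of
    [s = t + i u]; multiplied by [exp (- c t)] each of them is subharmonic, with
    Laplacian [exp (- c t) * |G'| * |G''/G' - c| ^ 2]. This is the corresponding estimate for
    the four-point mean. *)
Lemma density_second_difference t c : regular_level P t ->
  exists K rho0, [/\ 0 <= K, 0 < rho0 & forall rho u, 0 < rho <= rho0 ->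
    4 * level_density P t u + rho ^+ 2 * fiber_sum P (speed_energy c) (cexp t u) - K * rho ^+ 3 <=
    expR (- (c * rho)) * level_density P (t + rho) u + expR (c * rho) * level_density P (t - rho) u +
    level_density P t (u + rho) + level_density P t (u - rho)].
Proof.
move=> /regular_level_far[eta eta0 Hfar].
have E0 := expR_gt0 t.
have Hfar' z : normc P.[z] = expR t -> far P eta P.[z] by exact: Hfar.
have [p' p'0 Hp'] := far_deriv n_gt1 P_monic P_size eta0.
pose K1 : R := expR 1 + 2.
have K10 : 0 < K1 by rewrite addr_gt0 ?expR_gt0.
pose K0 := K1 * (1 + `|c| ^+ 3).
have K00 : 0 <= K0 by rewrite mulr_ge0 ?addr_ge0 ?exprn_ge0// ltW.
have [rj [A [B [K [b [rj0 A0 B0 KK0 Hjet]]]]]] :=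
  speed_jet n_gt1 P_monic P_size c eta0 K00 Hfar'.
have [K' K'0 [rho1 rho10 Hfour]] := four_point_mean A0 B0 KK0.
pose eta2 := eta / 2.
have eta20 : 0 < eta2 by rewrite divr_gt0.
have [rm rm0 Hmatch] := fiber_matching n_gt1 P_monic P_size (expR t + eta2) eta20.
pose r := Num.min rj rm.
have r0 : 0 < r by rewrite lt_min rj0.
pose L := 2 + K1.
have L0 : 0 < L by rewrite addr_gt0.
pose s0 := Num.min eta2 (r ^+ n) / (expR t * L).
have s00 : 0 < s0 by rewrite divr_gt0 ?lt_min ?eta20 ?exprn_gt0// mulr_gt0.
pose rho0 := Num.min (Num.min rho1 s0) (Num.min 1 (1 + `|c|)^-1).
have c1 : 0 < 1 + `|c| by rewrite ltr_wpDr.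
exists (K' * (n%:R * (expR t / p'))), rho0; split.
- by rewrite !mulr_ge0 ?ler0n ?(ltW K'0) ?(ltW E0)// invr_ge0 ltW.
- by rewrite !lt_min rho10 s00 ltr01 invr_gt0.
move=> rho u /andP[rho_gt0]; rewrite /rho0 !le_min => /andP[/andP[h1 h2] /andP[h3 h4]].
have rho_ge0 := ltW rho_gt0.
have crho : `|c * rho| <= 1.
  rewrite normrM (ger0_norm rho_ge0).
  apply: (@le_trans _ _ ((1 + `|c|) * rho)); first by rewrite ler_wpM2r// lerDr.
  by rewrite -ler_pdivlMl// mulr1.
have nr : `|rho| <= 1 by rewrite ger0_norm.
have nr' : `|- rho| <= 1 by rewrite normrN.
have ncr : `|- (c * rho)| <= 1 by rewrite normrN.
pose w0 := cexp t u.
have w0E : normc w0 = expR t by exact: normc_cexp.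
have nrc : normc rho%:C = rho by rewrite normc_real ger0_norm.
have nirc : normc ('i * rho%:C) = rho by rewrite normcM normc_i mul1r.
have K1K0 : K1 <= K0 by rewrite /K0 ler_peMr ?(ltW K10)// lerDl exprn_ge0.
have cK0 (x : R) : `|x| = `|c| * rho -> K1 * `|x| ^+ 3 <= K0 * rho ^+ 3.
  move=> ->; rewrite /K0 exprMn mulrA ler_wpM2r ?exprn_ge0// ler_wpM2l ?(ltW K10)//.
  by rewrite lerDr.
have ncrho : `|c * rho| = `|c| * rho by rewrite normrM (ger0_norm rho_ge0).
(* One of the four directions [d], with multipliers [lam ~ exp d] and [m ~ exp (- c d)]. *)
have dir (d lam : C) : normc d = rho ->
    normc (lam - (1 + d + d ^+ 2 / 2)) <= K1 * rho ^+ 3 ->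
    exists2 phi : C -> C, perm_eq [seq phi y | y <- fiber P w0] (fiber P (w0 * lam)) &
      forall y, y \in fiber P w0 -> normc (phi y - y) <= r /\ P.[phi y] = lam * P.[y].
  move=> dE lamE.
  have lam1 : normc (lam - 1) <= L * rho.
    have -> : lam - 1 = (lam - (1 + d + d ^+ 2 / 2)) + (d + d ^+ 2 / 2) by ring.
    rewrite (le_trans (normcD _ _))//.
    have := normcD d (d ^+ 2 / 2).
    rewrite normcM normcV normc_nat normcX dE.
    have : rho ^+ 3 <= rho by rewrite exprS ler_piMr// exprn_ile1.
    have : rho ^+ 2 <= rho by rewrite expr2 ler_piMr.
    move=> q2 q3 q1; have := lamE; have : K1 * rho ^+ 3 <= K1 * rho by rewrite ler_wpM2l// ltW.
    rewrite /L; lra.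
  have ww : normc (w0 * lam - w0) <= Num.min eta2 (r ^+ n).
    have -> : w0 * lam - w0 = w0 * (lam - 1) by ring.
    rewrite normcM w0E (le_trans (ler_wpM2l (ltW E0) lam1))//.
    rewrite mulrA -ler_pdivlMl ?mulr_gt0// mulrC; exact: h2.
  move: ww; rewrite le_min => /andP[ww1 ww2].
  have fw0 : far P (eta2 + eta2) w0 by rewrite /eta2 -splitr; exact: Hfar.
  have [||||||phi ph1 ph2] := Hmatch r w0 (w0 * lam).
  - by rewrite (ltW r0) /r ge_min lexx orbT.
  - by rewrite w0E lerDl ltW.
  - rewrite -[w0 * lam](subrK w0) (le_trans (normcD _ _))// w0E addrC lerD2l.
    exact: ww1.
  - by apply: farS fw0; rewrite lerDl ltW.
  - exact: far_shift fw0 ww1.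
  - exact: ww2.
  exists phi => // y yw; split; first by rewrite normc_subC ph2.
  have : phi y \in fiber P (w0 * lam) by rewrite -(perm_mem ph1) map_f.
  move: yw; rewrite !(mem_fiber n_gt1 P_monic P_size) => /eqP -> /eqP ->.
  by rewrite mulrC.
have t1 := cexp_taylor2_real nr; have t2 := cexp_taylor2_real nr'.
have t3 := cexp_taylor2_imag nr; have t4 := cexp_taylor2_imag nr'.
have m1 := cexp_taylor2_real ncr; have m2 := cexp_taylor2_real crho.
have m3 := cexp_taylor2_imag ncr; have m4 := cexp_taylor2_imag crho.
rewrite -/K1 (ger0_norm rho_ge0) in t1 t3; rewrite -/K1 normrN (ger0_norm rho_ge0) in t2 t4.
have rN (x : R) : (- x)%:C = - x%:C :> C by rewrite rmorphN.
have rM (x y : R) : (x * y)%:C = x%:C * y%:C :> C by rewrite rmorphM.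
rewrite rN in t2; rewrite rN mulrN in t4.
have e_m1 : normc (cexp (- (c * rho)) 0 - (1 - c%:C * rho%:C + (c%:C * rho%:C) ^+ 2 / 2))
    <= K0 * rho ^+ 3.
  have := le_trans m1 (cK0 _ (etrans (normrN _) ncrho)).
  by rewrite rN rM sqrrN.
have e_m2 : normc (cexp (c * rho) 0 - (1 - c%:C * (- rho%:C) + (c%:C * (- rho%:C)) ^+ 2 / 2))
    <= K0 * rho ^+ 3.
  have := le_trans m2 (cK0 _ ncrho).
  by rewrite rM mulrN opprK sqrrN.
have e_m3 : normc (cexp 0 (- (c * rho)) - (1 - c%:C * ('i * rho%:C) + (c%:C * ('i * rho%:C)) ^+ 2 / 2))
    <= K0 * rho ^+ 3.
  have := le_trans m3 (cK0 _ (etrans (normrN _) ncrho)).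
  by rewrite rN rM mulrN sqrrN [c%:C * ('i * _)]mulrCA.
have e_m4 : normc (cexp 0 (c * rho) - (1 - c%:C * (- ('i * rho%:C)) + (c%:C * (- ('i * rho%:C))) ^+ 2 / 2))
    <= K0 * rho ^+ 3.
  have := le_trans m4 (cK0 _ ncrho).
  by rewrite rM mulrN opprK sqrrN [c%:C * ('i * _)]mulrCA.
have [f1 p1 q1] := dir _ _ nrc t1.
have [f2 p2 q2] := dir _ _ (etrans (normc_opp _) nrc) t2.
have [f3 p3 q3] := dir _ _ nirc t3.
have [f4 p4 q4] := dir _ _ (etrans (normc_opp _) nirc) t4.
have Kle := ler_wpM2r (exprn_ge0 3 rho_ge0) K1K0.
have fs (phi : C -> C) w : perm_eq [seq phi y | y <- fiber P w0] (fiber P w) ->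
    fiber_sum P (speed P) w = \sum_(y <- fiber P w0) speed P (phi y).
  by move=> ph; rewrite /fiber_sum -(perm_big _ ph)/= big_map.
have w1E : cexp (t + rho) u = w0 * cexp rho 0 by rewrite -cexpD addr0.
have w2E : cexp (t - rho) u = w0 * cexp (- rho) 0 by rewrite -cexpD addr0.
have w3E : cexp t (u + rho) = w0 * cexp 0 rho by rewrite -cexpD addr0.
have w4E : cexp t (u - rho) = w0 * cexp 0 (- rho) by rewrite -cexpD addr0.
rewrite /level_density w1E w2E w3E w4E (fs _ _ p1) (fs _ _ p2) (fs _ _ p3) (fs _ _ p4).
have sp z : z \in fiber P w0 -> speed P z <= expR t / p'.
  rewrite (mem_fiber n_gt1 P_monic P_size) => /eqP Pz.
  rewrite /speed Pz w0E ler_wpM2l ?(ltW E0)//.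
  have := Hp' z; rewrite Pz => /(_ (Hfar _ w0E)) h.
  by rewrite lef_pV2 ?posrE// (lt_le_trans p'0).
have sps : \sum_(z <- fiber P w0) speed P z <= n%:R * (expR t / p').
  rewrite big_seq (le_trans (ler_sum _ sp))//.
  rewrite -big_seq big_const_seq count_predT (size_fiber n_gt1 P_monic P_size).
  by rewrite iter_addr addr0 -[leLHS]mulr_natl.
apply: (@le_trans _ _ (\sum_(z <- fiber P w0) (4 * speed P z +
   rho ^+ 2 * speed_energy c z - K' * rho ^+ 3 * speed P z))).
  rewrite sumrB big_split/= -!mulr_sumr /fiber_sum -/w0 lerB//.
  by rewrite [leRHS]mulrAC ler_wpM2l ?mulr_ge0 ?exprn_ge0 ?(ltW K'0).
rewrite !mulr_sumr -!big_split/= big_seq [leRHS]big_seq; apply: ler_sum => z zw.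
have Pz : normc P.[z] = expR t.
  by move: zw; rewrite (mem_fiber n_gt1 P_monic P_size) => /eqP ->.
have p'z : 0 < normc P^`().[z] := lt_le_trans p'0 (Hp' z (Hfar' z Pz)).
have rj' x : normc (x - z) <= r -> normc (x - z) <= rj.
  by move=> h; rewrite (le_trans h)// /r ge_min lexx.
have [c1a c1b] := q1 z zw; have [c2a c2b] := q2 z zw.
have [c3a c3b] := q3 z zw; have [c4a c4b] := q4 z zw.
have expand d lam m x : normc d = rho -> normc (x - z) <= r -> P.[x] = lam * P.[z] ->
   normc (lam - (1 + d + d ^+ 2 / 2)) <= K1 * rho ^+ 3 ->
   normc (m - (1 - c%:C * d + (c%:C * d) ^+ 2 / 2)) <= K0 * rho ^+ 3 ->
   [/\ normc (log_deriv P c z) <= A, normc (b z) <= B,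
     normc (lam * m / (P^`().[x] / P^`().[z]) - (1 + log_deriv P c z * d + b z * d ^+ 2))
       <= K * rho ^+ 3 &
     normc m * speed P x = speed P z * normc (lam * m / (P^`().[x] / P^`().[z]))].
  move=> dE xz Px lamE mE.
  have := Hjet z x d lam m Pz (rj' x xz); rewrite dE.
  move=> /(_ h3 Px (le_trans lamE Kle) mE)[g1 g2 g3]; split => //.
  rewrite /speed Px !(normcM, normcV) invfM invrK.
  set py := (normc P^`().[x])^-1.
  by field; rewrite gt_eqF.
have [aA bB e1 s1] := expand rho%:C (cexp rho 0) (cexp (- (c * rho)) 0) (f1 z) nrc c1a c1b t1 e_m1.
have [_ _ e2 s2] := expand (- rho%:C) (cexp (- rho) 0) (cexp (c * rho) 0) (f2 z)
   (etrans (normc_opp _) nrc) c2a c2b t2 e_m2.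
have [_ _ e3 s3] := expand ('i * rho%:C) (cexp 0 rho) (cexp 0 (- (c * rho))) (f3 z) nirc c3a c3b t3 e_m3.
have [_ _ e4 s4] := expand (- ('i * rho%:C)) (cexp 0 (- rho)) (cexp 0 (c * rho)) (f4 z)
   (etrans (normc_opp _) nirc) c4a c4b t4 e_m4.
have hr : 0 < rho <= rho1 by rewrite rho_gt0.
have := Hfour rho _ _ _ _ _ _ hr aA bB e1 e2 e3 e4.
rewrite !normc_cexp expR0 !mul1r in s1 s2 s3 s4.
rewrite s1 s2 s3 s4 /speed_energy.
set x1 := normc _; set x2 := normc _; set x3 := normc _; set x4 := normc _ => h.
have := ler_wpM2l (speed_ge0 P z) h.
move: (speed P z) => sz; lra.
Qed.

End SecondDifference.

(** * Integrals over the circle *)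

Section CircleIntegrals.
Variable R : realType.
Local Notation mu := (@lebesgue_measure R).

Definition circle_integral (f : R -> R) : R := \int[mu]_(u in `[0, pi *+ 2]) f u.

Lemma continuous_integrable_itv (f : R -> R) a b : continuous f ->
  mu.-integrable `[a, b] (EFin \o f).
Proof.
move=> cf; apply: continuous_compact_integrable; first exact: segment_compact.
exact: continuous_subspaceT.
Qed.

Lemma Rintegral_itv_cat (f : R -> R) a b c : continuous f -> a <= b -> b <= c ->
  \int[mu]_(u in `[a, c]) f u = \int[mu]_(u in `[a, b]) f u + \int[mu]_(u in `[b, c]) f u.
Proof.
move=> cf ab bc; have icf := @continuous_integrable_itv f a c cf.
have h := @Rintegral_itvB R f (BLeft a) (BRight c) b icf.
rewrite -[\int[mu]_(u in `[b, c]) _]Rintegral_itv_obnd_cbnd; last first.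
  apply: integrableS (continuous_integrable_itv b c cf) => //.
  by apply: subset_itvr; rewrite bnd_simp.
by rewrite -h ?bnd_simp// addrC subrK.
Qed.

Lemma Rintegral_shift (f : R -> R) a b r : continuous f -> a <= b ->
  \int[mu]_(u in `[a, b]) f (u + r) = \int[mu]_(u in `[a + r, b + r]) f u.
Proof.
move=> cf ab; rewrite /Rintegral; congr fine.
have dF (x : R) : is_derive x 1 (fun x => x + r) (1 : R).
  by apply: is_derive_eq; rewrite addr0.
have F1 : (fun x => x + r)^`()%classic = cst (1 : R).
  by apply/funext => x; rewrite derive1E; exact: derive_val.
have cF : continuous (fun x : R => x + r).
  by move=> x; apply: cvgD; [exact: cvg_id|exact: cvg_cst].
rewrite (@integration_by_substitution_increasing R (fun x => x + r) f a b ab).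
- apply: eq_integral => x _; rewrite /= F1 /=.
  by rewrite [X in X%:E](_ : _ = f (x + r) * 1) ?mulr1.
- by move=> x y _ _ xy; rewrite ltrD2r.
- by rewrite F1 => x _; exact: cvg_cst.
- by rewrite F1; apply: is_cvg_cst.
- by rewrite F1; apply: is_cvg_cst.
- split.
  + by move=> x _; exact: (@ex_derive _ _ _ _ _ _ _ (dF x)).
  + by apply: cvg_at_right_filter; exact: cF.
  + by apply: cvg_at_left_filter; exact: cF.
- exact: continuous_subspaceT.
Qed.

Lemma circle_integral_shift (f : R -> R) r : continuous f ->
  (forall u, f (u + pi *+ 2) = f u) -> 0 <= r <= pi *+ 2 ->
  circle_integral (fun u => f (u + r)) = circle_integral f.
Proof.
move=> cf pf /andP[r0 r1]; rewrite /circle_integral.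
have p0 : 0 <= pi *+ 2 :> R by exact: le_trans r1.
rewrite Rintegral_shift// add0r (@Rintegral_itv_cat f r (pi *+ 2))//; last by rewrite lerDl.
rewrite (@Rintegral_itv_cat f 0 r)// addrC; congr (_ + _).
rewrite -[X in `[X, _]](add0r (pi *+ 2)) [pi *+ 2 + r]addrC -Rintegral_shift//.
by apply: eq_Rintegral => u _; rewrite pf.
Qed.

Lemma circle_integral_shiftN (f : R -> R) r : continuous f ->
  (forall u, f (u + pi *+ 2) = f u) -> 0 <= r <= pi *+ 2 ->
  circle_integral (fun u => f (u - r)) = circle_integral f.
Proof.
move=> cf pf /andP[r0 r1]; rewrite -(@circle_integral_shift f (pi *+ 2 - r))//; last first.
  by rewrite subr_ge0 r1/= gerBl.
by congr circle_integral; apply/funext => u; rewrite addrCA addrC pf.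
Qed.

Lemma circle_integralD (f g : R -> R) : continuous f -> continuous g ->
  circle_integral (fun u => f u + g u) = circle_integral f + circle_integral g.
Proof. by move=> cf cg; rewrite /circle_integral RintegralD//; exact: continuous_integrable_itv. Qed.

Lemma circle_integralZ (k : R) (f : R -> R) : continuous f ->
  circle_integral (fun u => k * f u) = k * circle_integral f.
Proof. by move=> cf; rewrite /circle_integral RintegralZl//; exact: continuous_integrable_itv. Qed.

Lemma Rintegral_itv_cst (a b k : R) : a <= b ->
  \int[mu]_(u in `[a, b]) k = k * (b - a).
Proof.
move=> ab; rewrite Rintegral_cst//; congr (_ * _).
rewrite -[LHS]/(fine (mu `[a, b]%classic)) lebesgue_measure_itv/= lte_fin.
by case: ltP => //= ba; have -> : a = b; [apply/eqP; rewrite eq_le ab|rewrite subrr].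
Qed.

Lemma circle_integral_cst (k : R) : circle_integral (fun=> k) = k * (pi *+ 2).
Proof.
by rewrite /circle_integral Rintegral_itv_cst ?subr0// mulrn_wge0// pi_ge0.
Qed.

Lemma circle_integral_le (f g : R -> R) : continuous f -> continuous g ->
  (forall u, f u <= g u) -> circle_integral f <= circle_integral g.
Proof. by move=> cf cg fg; apply: le_Rintegral => //; exact: continuous_integrable_itv. Qed.

Lemma circle_integral_gt0 (f : R -> R) v : continuous f -> (forall u, 0 <= f u) ->
  0 < v < pi *+ 2 -> 0 < f v -> 0 < circle_integral f.
Proof.
move=> cf f0 /andP[v0 v1] fv.
have fv2 : 0 < f v / 2 by rewrite divr_gt0.
have /cvgrPdist_lt/(_ _ fv2)[d /= d0 Hd] := cf v.
pose e := Num.min (d / 2) (pi *+ 2 - v).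
have e0 : 0 < e by rewrite lt_min divr_gt0// subr_gt0.
have ve : v + e <= pi *+ 2.
  have : e <= pi *+ 2 - v by rewrite /e ge_min lexx orbT.
  lra.
have ed : e < d.
  have : e <= d / 2 by rewrite /e ge_min lexx.
  lra.
have ice a b := @continuous_integrable_itv f a b cf.
rewrite /circle_integral (@Rintegral_itv_cat f 0 v)// ?(ltW v0) ?(ltW v1)//.
rewrite (@Rintegral_itv_cat f v (v + e))// ?lerDl ?(ltW e0)//.
rewrite ltr_wpDl//; first exact: Rintegral_ge0.
rewrite ltr_pwDl//; last exact: Rintegral_ge0.
apply: (@lt_le_trans _ _ (\int[mu]_(u in `[v, v + e]) (f v / 2))).
  rewrite Rintegral_itv_cst ?lerDl ?(ltW e0)//.
  by rewrite addrAC subrr add0r mulr_gt0.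
apply: le_Rintegral => //.
  by apply: continuous_integrable_itv => x; exact: cvg_cst.
move=> u; rewrite /= in_itv/= => /andP[u1 u2].
have vu : `|v - u| < d by rewrite ltr_norml; apply/andP; split; lra.
by have := Hd u vu; rewrite /= ltr_norml => /andP[]; lra.
Qed.

Lemma Rintegral_setD_seq (f : R -> R) (A : set R) (s : seq R) : measurable A ->
  measurable_fun setT f ->
  \int[mu]_(u in A `\` [set` s]) f u = \int[mu]_(u in A) f u.
Proof.
move=> mA mf; rewrite /Rintegral; congr fine.
have ms (l : seq R) : measurable [set` l].
  by apply: closed_measurable; exact: closed_set_seq.
elim: s => [|a s IH].
  by rewrite (_ : [set` [::]] = set0) ?setD0//; apply/seteqP; split.
have -> : A `\` [set` a :: s] = (A `\` [set` s]) `\ a.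
  apply/seteqP; split => u.
    move=> [Au /= nu]; split; first by split => // us; apply: nu; rewrite inE us orbT.
    by move=> ua; apply: nu; rewrite inE ua eqxx.
  by move=> [[Au nu] ua]; split => //=; rewrite inE => /predU1P[].
rewrite integral_setD1//; first by apply: measurableD => //; apply: measurableD.
by apply/measurable_EFinP; exact: measurable_funS mf.
Qed.

End CircleIntegrals.

(** * Powers of a linear polynomial *)

Section Triviality.
Variable R : realType.
Local Notation C := R[i].

Lemma lead_coef_deriv_char0 (q : {poly C}) : (1 < size q)%N ->
  lead_coef q^`() = lead_coef q *+ (size q).-1.
Proof.
move=> sq; have q0 : q != 0 by rewrite -size_poly_gt0 ltnW.
have [m sE] : exists m, size q = m.+2.
  by move: sq; case: (size q) => [|[|m]] // _; exists m.
have cE : q^`()`_m = lead_coef q *+ m.+1 by rewrite coef_deriv lead_coefE sE.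
have nz : q^`()`_m != 0 by rewrite cE mulrn_eq0 negb_or lead_coef_eq0 q0.
have s'E : size q^`() = m.+1.
  apply/eqP; rewrite eqn_leq -ltnS -sE lt_size_deriv//= leqNgt; apply/negP => h.
  by rewrite nth_default ?eqxx in nz.
by rewrite lead_coefE s'E cE sE.
Qed.

(** At a root of multiplicity [j + 1] the leading Taylor coefficients of
    [P'^2] and of [P P''] are in the ratio [j + 1 : j], whereas at infinity the
    ratio is [n : n - 1]. *)
Lemma power_of_log_deriv_eq (n : nat) (P : {poly C}) (k : C) : (1 < n)%N -> P \is monic ->
  size P = n.+1 -> k *: P^`() ^+ 2 = P * P^`()^`() ->
  exists a : C, P = ('X - a%:P) ^+ n.
Proof.
move=> n1 Pm Ps H.
have Pn : P`_n = 1 by have := monicP Pm; rewrite lead_coefE Ps.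
have P'n : lead_coef P^`() = n%:R := deriv_lead n1 Pm Ps.
have P's : size P^`() = n := size_deriv_monic n1 Pm Ps.
have kE : k * n%:R = (n.-1)%:R.
  have := congr1 lead_coef H; rewrite lead_coefZ lead_coef_exp lead_coefM (monicP Pm) mul1r.
  rewrite (@lead_coef_deriv_char0 P^`()) ?P's// P'n -[RHS]mulr_natr expr2 mulrA mulrC.
  by move=> h; apply: (mulfI (nR_neq0 R n1)).
have [a Pa] : exists a, root P a.
  have := size_fiber n1 Pm Ps 0; case E : (fiber P 0) => [|a s] /=.
    by move=> n0; rewrite -n0 in n1.
  move=> _; exists a; have := mem_fiber n1 Pm Ps 0 a.
  by rewrite E mem_head /root => /esym.
have P0 : P != 0 by rewrite -size_poly_gt0 Ps.
have [m [q]] := multiplicity_XsubC P a; rewrite P0 /= => qa PE.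
case: m PE => [|j] PE.
  by move: Pa qa; rewrite PE expr0 mulr1 => ->.
set X := 'X - a%:P in PE *.
have X' : X^`() = 1 by rewrite derivB derivX derivC subr0.
pose r1 := X * q^`() + j.+1%:R *: q.
have E1 : P^`() = X ^+ j * r1.
  rewrite PE derivM deriv_exp X' /= mul1r /r1 exprS scaler_nat -mulr_natr -[_ *+ j.+1]mulr_natr.
  by ring.
pose r2 := X * r1^`() + j%:R *: r1.
have E2 : X * P^`()^`() = X ^+ j * r2.
  rewrite E1 derivM deriv_exp X' mul1r /r2 scaler_nat -[X ^+ j.-1 *+ j]mulr_natr -[r1 *+ j]mulr_natr.
  case: (j) => [|j']; first by rewrite !mulr0 mul0r; ring.
  by rewrite /= [X ^+ j'.+1]exprS; ring.
have X0 : X != 0 by rewrite polyXsubC_eq0.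
have E3 : k *: r1 ^+ 2 = q * r2.
  have : (X ^+ j * X ^+ j.+1) * (k *: r1 ^+ 2) = (X ^+ j * X ^+ j.+1) * (q * r2).
    have := congr1 (fun p => X * p) H; rewrite E1 => h.
    have h2 : X * (P * (X ^+ j * r1)^`()) = P * (X * P^`()^`()) by rewrite E1; ring.
    rewrite h2 E2 {1}PE in h.
    rewrite -!mul_polyC in h *; rewrite exprS.
    transitivity (X * (k%:P * (X ^+ j * r1) ^+ 2)); first by ring.
    rewrite h [X ^+ j.+1]exprS; ring.
  by apply: mulfI; rewrite mulf_neq0// expf_neq0.
have Xa : X.[a] = 0 by rewrite hornerXsubC subrr.
have qa0 : q.[a] != 0 by [].
have r1a : r1.[a] = j.+1%:R * q.[a] by rewrite hornerD hornerM Xa mul0r add0r hornerZ.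
have r2a : r2.[a] = j%:R * r1.[a] by rewrite hornerD hornerM Xa mul0r add0r hornerZ.
have E4 : k * j.+1%:R = j%:R.
  have := congr1 (fun p => p.[a]) E3.
  rewrite hornerZ horner_exp hornerM r2a r1a => h.
  have nz : q.[a] ^+ 2 * j.+1%:R != 0 by rewrite mulf_neq0 ?expf_neq0// pnatr_eq0.
  apply: (mulIf nz); transitivity (k * (j.+1%:R * q.[a]) ^+ 2); first by ring.
  by rewrite h; ring.
have jn : j.+1 = n.
  have nn : n = n.-1.+1 by rewrite prednK// ltnW.
  have : (n.-1 * j.+1)%:R = (j * n)%:R :> C.
    by rewrite !natrM -kE -E4; ring.
  move/eqP; rewrite eqr_nat {2}nn => /eqP; lia.
exists a; rewrite -jn PE.
have q1 : size q = 1%N.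
  have q0 : q != 0 by apply: contra_neq qa0 => ->; rewrite horner0.
  have := Ps; rewrite PE size_Mmonic ?monic_exp ?monicXsubC// size_exp_XsubC jn addnS /=.
  by rewrite -[RHS]add1n => /addIn.
have /size_poly1P[c c0 qE] : size q == 1%N by rewrite q1.
have : lead_coef P = c by rewrite PE lead_coef_Mmonic ?monic_exp ?monicXsubC// qE lead_coefC.
by rewrite (monicP Pm) qE => <-; rewrite mul1r.
Qed.

End Triviality.

(** * Strict logarithmic convexity of the length *)

Section LogConvexity.
Variable R : realType.

Lemma expR_mul_le (a b k : R) : 0 < a -> 0 < b -> ln a - k <= ln b -> expR (- k) * a <= b.
Proof.
move=> a0 b0 h; rewrite -ler_ln ?posrE ?mulr_gt0 ?expR_gt0//.
by rewrite lnM ?posrE ?expR_gt0// expRK addrC.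
Qed.

(** If [ln L] minus the chord, of slope [c], reached its maximum at an interior
    point, the second difference of [exp (- c t) * L t] there would not be positive. *)
Lemma strict_log_convexity (L : R -> R) (x y l : R) : x < y -> 0 < l < 1 ->
  (forall t, 0 < L t) -> continuous L ->
  (forall t c, x < t < y -> exists2 rho0, 0 < rho0 & forall rho, 0 < rho <= rho0 ->
    2 * L t < expR (- (c * rho)) * L (t + rho) + expR (c * rho) * L (t - rho)) ->
  ln (L (l * x + (1 - l) * y)) < l * ln (L x) + (1 - l) * ln (L y).
Proof.
move=> xy /andP[l0 l1] L0 cL H.
pose f t := ln (L t).
pose c := (f y - f x) / (y - x).
have yx0 : 0 < y - x by rewrite subr_gt0.
have cE : c * (y - x) = f y - f x by rewrite /c divfK// gt_eqF.
pose h t := f t - c * (t - x).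
have hx : h x = f x by rewrite /h subrr mulr0 subr0.
have hy : h y = f x by rewrite /h cE opprB addrC subrK.
have cf : continuous f.
  move=> t; apply: (@continuous_comp _ _ _ L (@ln R)).
    exact: cL.
  exact: continuous_ln (L0 t).
have ch : continuous h.
  move=> t; apply: cvgB; first exact: cf.
  by apply: cvgM; [exact: cvg_cst|apply: cvgB; [exact: cvg_id|exact: cvg_cst]].
have [m mI hm] := EVT_max (ltW xy) (continuous_subspaceT ch).
move: mI; rewrite in_itv/= => /andP[xm my].
(* The second difference of [exp h] at an interior maximum cannot be positive. *)
have key t : x < t < y -> (forall s, x <= s <= y -> h s <= h t) -> False.
  move=> /andP[xt ty] ht.
  have [rho0 rho00 Hrho] := H t c (introT andP (conj xt ty)).
  pose rho := Num.min rho0 (Num.min (t - x) (y - t)).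
  have rho_gt0 : 0 < rho by rewrite !lt_min rho00 !subr_gt0 xt ty.
  have : 0 < rho <= rho0 by rewrite rho_gt0 ge_min lexx.
  move=> /Hrho.
  have rx : rho <= t - x by rewrite /rho !ge_min lexx orbT.
  have ry : rho <= y - t by rewrite /rho !ge_min lexx !orbT.
  have le1 s d : x <= s <= y -> s = t + d ->
      expR (- (c * d)) * L s <= L t.
    move=> sI sE; have := ht s sI; rewrite /h /f => hh.
    apply: expR_mul_le; [exact: L0|exact: L0|].
    move: hh; rewrite sE; move: (ln _) (ln _) => a b; lra.
  have := le1 (t + rho) rho; have := le1 (t - rho) (- rho).
  rewrite mulrN opprK => a1 a2.
  have b1 : expR (c * rho) * L (t - rho) <= L t.
    by apply: a1 => //; apply/andP; split; lra.
  have b2 : expR (- (c * rho)) * L (t + rho) <= L t.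
    by apply: a2 => //; apply/andP; split; lra.
  move: b1 b2; move: (expR _ * _) (expR _ * _) (L t) => a b q; lra.
have hmx : h m = f x.
  have [->//|xm'] := eqVneq m x.
  have [->//|ym'] := eqVneq m y.
  exfalso; apply: (key m).
    by rewrite !lt_neqAle xm my [x == m]eq_sym xm' ym'.
  by move=> s sI; apply: hm; rewrite in_itv.
pose t := l * x + (1 - l) * y.
have tI : x < t < y.
  have : 0 < (1 - l) * (y - x) by rewrite mulr_gt0// subr_gt0.
  have : 0 < l * (y - x) by rewrite mulr_gt0.
  by rewrite /t; move=> ? ?; apply/andP; split; lra.
have ht : h t < f x.
  rewrite ltNge; apply/negP => hge; apply: (key t tI) => s sI.
  by rewrite (le_trans _ hge)// -hmx; apply: hm; rewrite in_itv.
rewrite -/t -/(f t) -/(f x) -/(f y).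
have -> : l * f x + (1 - l) * f y = f x + c * (t - x).
  have -> : t - x = (1 - l) * (y - x) by rewrite /t; ring.
  by rewrite mulrCA cE; move: (f x) (f y) => a b; ring.
by move: ht; rewrite /h; lra.
Qed.

End LogConvexity.

Section Convexity.
Variable R : realType.
Local Notation C := R[i].
Local Notation mu := (@lebesgue_measure R).
Implicit Types (t u v eta e c : R).

Variables (n : nat) (P : {poly C}).
Hypothesis n_gt1 : (1 < n)%N.
Hypothesis P_monic : P \is monic.
Hypothesis P_size : size P = n.+1.

Let n_gt0 : (0 < n)%N. Proof. exact: ltnW. Qed.

Lemma regular_level_cexp t u : regular_level P t ->
  forall zeta, P^`().[zeta] = 0 -> P.[zeta] != cexp t u.
Proof.
move=> reg zeta zc; apply/eqP => e; have := reg zeta zc.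
by rewrite e normc_cexp eqxx.
Qed.

Lemma continuous_level_density t : regular_level P t -> continuous (level_density P t).
Proof.
move=> reg u; apply: (fiber_sum_continuous_arg n_gt1 P_monic P_size).
  exact: regular_level_cexp.
exact: speed_cvg.
Qed.

Lemma level_density_periodic t u : level_density P t (u + pi *+ 2) = level_density P t u.
Proof. by rewrite /level_density cexp2pi. Qed.

Lemma regular_argsE : regular_args P = `[0, pi *+ 2] `\` [set` crit_angles P].
Proof.
apply/seteqP; split => u.
  by move=> [/= uI uA]; split => //; move: uI; rewrite /= !in_itv/= => /andP[/ltW -> /ltW ->].
move=> [/= uI uA]; split => //; move: uI; rewrite /= !in_itv/= => /andP[u0 u1].
rewrite !lt_neqAle u0 u1 !andbT; apply/andP; split; apply/eqP => e; apply: uA.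
  by rewrite -e !inE eqxx.
by rewrite e !inE eqxx orbT.
Qed.

Lemma Rintegral_regular_args (f : R -> R) : continuous f ->
  \int[mu]_(u in regular_args P) f u = circle_integral f.
Proof.
move=> cf; rewrite regular_argsE Rintegral_setD_seq//.
exact: continuous_measurable_fun.
Qed.

Lemma level_integral_circle t : regular_level P t ->
  level_integral P t = circle_integral (level_density P t).
Proof. by move=> reg; apply: Rintegral_regular_args; exact: continuous_level_density. Qed.

Lemma speed_energy_ge0 c z : 0 <= speed_energy P c z.
Proof. by rewrite mulr_ge0 ?speed_ge0// exprn_ge0 ?normc_ge0. Qed.

Lemma speed_energy_cvg c z : P^`().[z] != 0 ->
  speed_energy P c x @[x --> nbc z] --> speed_energy P c z.
Proof.
move=> Pz; rewrite /speed_energy; apply: cvgM; first exact: speed_cvg.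
pose Q : {poly C} := (1 - c%:C) *: P^`() ^+ 2 - P * P^`()^`().
pose g x := normc Q.[x] / normc P^`().[x] ^+ 2.
have QE x : P^`().[x] != 0 -> normc (log_deriv P c x) = g x.
  move=> Px; rewrite /g -normcX -normcV -normcM; congr normc.
  rewrite /log_deriv hornerD hornerN hornerZ horner_exp hornerM; field.
  exact: Px.
have gz : g x @[x --> nbc z] --> g z.
  apply: cvgM; first exact: normc_poly_cvg.
  apply: cvgV; first by rewrite expf_eq0/= normc_eq0.
  by rewrite expr2; apply: cvgM; exact: normc_poly_cvg.
have gz2 : g x ^+ 2 @[x --> nbc z] --> g z ^+ 2.
  by rewrite expr2; apply: cvgM.
rewrite QE//; apply: cvg_trans gz2; apply: near_eq_cvg.
have pz0 : 0 < normc P^`().[z] by rewrite normc_gt0.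
have /cvgrPdist_lt/(_ _ pz0) := @normc_poly_cvg R P^`() z.
apply: filterS => x; rewrite -/(normc _) => h; rewrite QE// -normc_eq0; apply/eqP => e.
by move: h; rewrite e subr0 ger0_norm ?normc_ge0// ltxx.
Qed.

Hypothesis nontrivial : ~ exists a : C, P = ('X - a%:P) ^+ n.

(** Were the energy zero for all these arguments, [G'' / G' - c] would vanish at
    infinitely many points of the level curve. Then [(1 - c) P'^2 - P P''] would be
    zero, and [power_of_log_deriv_eq] would make [P] a power. *)
Lemma energy_somewhere_pos t c : regular_level P t ->
  exists2 u, 0 < u < pi *+ 2 & 0 < fiber_sum P (speed_energy P c) (cexp t u).
Proof.
move=> reg; apply: contrapT => none; apply: nontrivial.
pose Q : {poly C} := (1 - c%:C) *: P^`() ^+ 2 - P * P^`()^`().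
have Q0 z u : 0 < u < pi *+ 2 -> P.[z] = cexp t u -> Q.[z] = 0.
  move=> u02 Pz.
  have Pz' : P^`().[z] != 0.
    by apply/eqP => /(regular_level_cexp u reg); rewrite Pz eqxx.
  have : speed_energy P c z = 0.
    apply/eqP; rewrite eq_le speed_energy_ge0 andbT leNgt; apply/negP => pos.
    apply: none; exists u => //; apply: (lt_le_trans pos).
    have zf : z \in fiber P (cexp t u) by rewrite (mem_fiber n_gt1 P_monic P_size) Pz.
    rewrite /fiber_sum (big_rem z zf)/= lerDl.
    by apply: sumr_ge0 => *; exact: speed_energy_ge0.
  have s0 : speed P z != 0.
    by rewrite /speed Pz normc_cexp gt_eqF// divr_gt0 ?expR_gt0// normc_gt0.
  move/eqP; rewrite mulf_eq0 (negPf s0)/= expf_eq0/= normc_eq0 => /eqP.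
  rewrite /log_deriv => h.
  have -> : Q.[z] = (1 - c%:C - P.[z] * P^`()^`().[z] / P^`().[z] ^+ 2) * P^`().[z] ^+ 2.
    by rewrite hornerD hornerN hornerZ horner_exp hornerM; field; exact: Pz'.
  by rewrite h mul0r.
have QE : Q = 0.
  apply/eqP; apply: contrapT => /negP Qn0.
  pose N := (size Q).+1.
  (* More points of the level curve than [Q] could have zeros. *)
pose x (i : nat) : R := i.+1%:R / N.+1%:R.
  have x02 i : (i < N)%N -> 0 < x i < pi *+ 2.
    move=> iN; rewrite divr_gt0//=; apply: (@lt_trans _ _ 1).
      by rewrite ltr_pdivrMr// mul1r ltr_nat ltnS.
    have := @pi_ge2 R; rewrite mulr2n; lra.
  pose zs (i : nat) : C := head 0 (fiber P (cexp t (x i))).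
  have Pzs i : P.[zs i] = cexp t (x i).
    apply/eqP; rewrite -(mem_fiber n_gt1 P_monic P_size) /zs.
    have := size_fiber n_gt1 P_monic P_size (cexp t (x i)).
    by case: (fiber _ _) => [n0|a s _] /=; [move: n_gt0; rewrite -n0|exact: mem_head].
  suff : uniq [seq zs i | i <- iota 0 N].
    have rs : all (root Q) [seq zs i | i <- iota 0 N].
      rewrite all_map; apply/allP => i; rewrite mem_iota /= add0n => iN.
      by apply/eqP; apply: (Q0 _ (x i)) => //; exact: x02.
    by move=> /(max_poly_roots Qn0 rs); rewrite size_map size_iota ltnNge leqnSn.
  rewrite map_inj_in_uniq ?iota_uniq// => i j; rewrite !mem_iota /= !add0n => iN jN e.
  have {}e : cexp t (x i) = cexp t (x j) by rewrite -!Pzs e.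
  apply/eqP; apply: contrapT => /negP ij.
  have dij : 0 < `|x i - x j|.
    rewrite normr_gt0 subr_eq0; apply: contra ij => /eqP xij.
    have N0 : N.+1%:R != 0 :> R by rewrite pnatr_eq0.
    have : i.+1%:R = j.+1%:R :> R.
      by have := congr1 (fun y => y * N.+1%:R) xij; rewrite /x !divfK.
    by move/eqP; rewrite eqr_nat eqSS.
  have /andP[xi0 xi2] := x02 i iN; have /andP[xj0 xj2] := x02 j jN.
  pose eta := Num.min `|x i - x j| (pi *+ 2 - `|x i - x j|).
  have eta0 : 0 < eta.
    rewrite lt_min dij/= subr_gt0 ltr_norml; apply/andP; split; lra.
  have := @chord_ge R t (x i) (x j) eta (ltW eta0).
  rewrite !ge_min !lexx orbT => /(_ isT isT).
  by rewrite e subrr normc0 leNgt mulr_gt0 ?expR_gt0// divr_gt0.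
apply: (@power_of_log_deriv_eq R n P (1 - c%:C) n_gt1 P_monic P_size).
by apply/eqP; rewrite -subr_eq0; apply/eqP.
Qed.

(** Integrating [density_second_difference] over the circle, the shifts of the argument
    disappear by periodicity, and what remains of the energy has a positive
    integral that outweighs the cubic error. *)
Lemma level_integral_second_difference t c : regular_level P t ->
  exists2 rho0, 0 < rho0 & forall rho, 0 < rho <= rho0 ->
    2 * level_integral P t <
      expR (- (c * rho)) * level_integral P (t + rho) + expR (c * rho) * level_integral P (t - rho).
Proof.
move=> reg.
have [eta eta0 Hfar] := regular_level_far n_gt1 P_monic P_size reg.
have /cvgrPdist_lt/(_ _ eta0)[d /= d0 Hd] := @continuous_expR R t.
have [K [rho1 [K0 rho10 Hdiff]]] := density_second_difference n_gt1 P_monic P_size c reg.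
pose D u := fiber_sum P (speed_energy P c) (cexp t u).
have cD : continuous D.
  move=> u; apply: (fiber_sum_continuous_arg n_gt1 P_monic P_size).
    exact: regular_level_cexp.
  exact: speed_energy_cvg.
have D0 u : 0 <= D u by apply: fiber_sum_ge0; exact: speed_energy_ge0.
have [v v02 Dv] := energy_somewhere_pos c reg.
have ID : 0 < circle_integral D by exact: (circle_integral_gt0 cD D0 v02 Dv).
have p0 : 0 < pi :> R := pi_gt0 R.
pose rho2 := circle_integral D / (K * (pi *+ 2) + 1).
have K1 : 0 < K * (pi *+ 2) + 1 by rewrite ltr_wpDl// mulr_ge0// mulrn_wge0// ltW.
pose rho0 := Num.min (Num.min rho1 (d / 2)) (Num.min pi (rho2 / 2)).
exists rho0; first by rewrite !lt_min rho10 p0 !divr_gt0.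
move=> rho /andP[r0]; rewrite /rho0 !le_min => /andP[/andP[h1 h2] /andP[h3 h4]].
have r00 := ltW r0.
have reg1 : regular_level P (t + rho).
  apply: (far_regular_level eta0 Hfar); rewrite distrC; apply: Hd.
  by rewrite /= opprD addrA subrr sub0r normrN ger0_norm//; lra.
have reg2 : regular_level P (t - rho).
  apply: (far_regular_level eta0 Hfar); rewrite distrC; apply: Hd.
  by rewrite /= opprB addrCA subrr addr0 ger0_norm//; lra.
have cF := continuous_level_density reg.
have cF1 := continuous_level_density reg1.
have cF2 := continuous_level_density reg2.
have shiftc (a : R) : continuous (fun u => level_density P t (u + a)).
  move=> u; apply: (@continuous_comp _ _ _ (fun u => u + a)); last exact: cF.
  by apply: cvgD; [exact: cvg_id|exact: cvg_cst].
have cst_c (k : R) : continuous (fun _ : R => k) by move=> ?; exact: cvg_cst.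
have cZ (k : R) (f : R -> R) : continuous f -> continuous (fun u => k * f u).
  by move=> cf u; apply: cvgM; [exact: cvg_cst|exact: cf].
have cDD (f g : R -> R) : continuous f -> continuous g -> continuous (fun u => f u + g u).
  by move=> cf cg u; apply: cvgD; [exact: cf|exact: cg].
have rp : 0 <= rho <= pi *+ 2 by rewrite r00 (le_trans h3)// mulr2n lerDl ltW.
have cL : continuous (fun u => 4 * level_density P t u + rho ^+ 2 * D u + (- (K * rho ^+ 3))).
  by apply: (cDD _ _ (cDD _ _ (cZ _ _ cF) (cZ _ _ cD)) (cst_c _)).
have cR : continuous (fun u => expR (- (c * rho)) * level_density P (t + rho) u +
   expR (c * rho) * level_density P (t - rho) u + level_density P t (u + rho) + level_density P t (u - rho)).
  exact: (cDD _ _ (cDD _ _ (cDD _ _ (cZ _ _ cF1) (cZ _ _ cF2)) (shiftc _)) (shiftc _)).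
have := circle_integral_le cL cR (fun u => Hdiff rho u (introT andP (conj r0 h1))).
rewrite (circle_integralD (cDD _ _ (cZ _ _ cF) (cZ _ _ cD)) (cst_c _)).
rewrite (circle_integralD (cZ _ _ cF) (cZ _ _ cD)) (circle_integralZ _ cF) (circle_integralZ _ cD).
rewrite (circle_integralD (cDD _ _ (cDD _ _ (cZ _ _ cF1) (cZ _ _ cF2)) (shiftc _)) (shiftc _)).
rewrite (circle_integralD (cDD _ _ (cZ _ _ cF1) (cZ _ _ cF2)) (shiftc _)).
rewrite (circle_integralD (cZ _ _ cF1) (cZ _ _ cF2)) (circle_integralZ _ cF1) (circle_integralZ _ cF2).
rewrite circle_integral_cst (circle_integral_shift cF (level_density_periodic t) rp).
rewrite (circle_integral_shiftN cF (level_density_periodic t) rp).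
rewrite !level_integral_circle//.
have : rho * (K * (pi *+ 2) + 1) < circle_integral D.
  rewrite -ltr_pdivlMr// (le_lt_trans h4)// ltr_pdivrMr// ltr_pMr ?ltr1n//.
  by rewrite divr_gt0.
move=> hID; have : rho ^+ 2 * (rho * (K * (pi *+ 2) + 1)) < rho ^+ 2 * circle_integral D.
  by rewrite ltr_pM2l// exprn_gt0.
have r3 : 0 < rho ^+ 3 by rewrite exprn_gt0.
have -> : rho ^+ 2 * (rho * (K * (pi *+ 2) + 1)) = K * rho ^+ 3 * (pi *+ 2) + rho ^+ 3 by ring.
set I0 := circle_integral _; set I1 := circle_integral _; set I2 := circle_integral _.
set I3 := circle_integral _; rewrite mulNr; lra.
Qed.

Lemma level_integral_gt0 t : 0 < level_integral P t.
Proof.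
have [M M0 HM] := fiber_bounded n_gt1 P_monic P_size (expR t).
have [B B0 HB] := poly_bounded P^`() M.
have mD := measurable_regular_args P.
have lb u : regular_args P u -> expR t / B <= level_density P t u.
  move=> uD; have nc := regular_not_crit n_gt1 P_monic P_size t uD.
  have := size_fiber n_gt1 P_monic P_size (cexp t u).
  case E : (fiber P (cexp t u)) => [|z s] zs; first by move: n_gt0; rewrite -zs.
  have Pz : P.[z] = cexp t u.
    by apply/eqP; rewrite -(mem_fiber n_gt1 P_monic P_size) E mem_head.
  have Pz' : P^`().[z] != 0 by apply/eqP => /nc; rewrite Pz eqxx.
  rewrite /level_density /fiber_sum E big_cons.
  apply: (@le_trans _ _ (speed P z)).
    rewrite /speed Pz normc_cexp ler_wpM2l ?expR_ge0// lef_pV2 ?posrE ?normc_gt0//.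
    by rewrite HB// HM// Pz normc_cexp.
  by rewrite lerDl; apply: sumr_ge0 => *; exact: speed_ge0.
have k0 : 0 < expR t / B by rewrite divr_gt0 ?expR_gt0.
have p0 : 0 <= pi *+ 2 :> R by rewrite mulrn_wge0 ?pi_ge0.
have ccst : continuous (fun _ : R => expR t / B) by move=> ?; exact: cvg_cst.
have cI : \int[mu]_(u in regular_args P) (expR t / B) = expR t / B * (pi *+ 2).
  by rewrite Rintegral_regular_args// circle_integral_cst.
apply: (@lt_le_trans _ _ (\int[mu]_(u in regular_args P) (expR t / B))).
  by rewrite cI mulr_gt0// mulrn_wgt0 ?pi_gt0.
apply: le_Rintegral => //.
- apply: (@integrableS _ (measurableTypeR R) R lebesgue_measure
    (`[0, pi *+ 2]%classic : set R) (regular_args P)) => //.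
    by move=> u /regular_args_itv; rewrite /= in_itv.
  exact: (continuous_integrable_itv 0 (pi *+ 2) ccst).
- exact: (integrable_level_density n_gt1 P_monic P_size).
Qed.

Lemma ln_level_integral_strictly_convex (x y l : R) : x < y -> 0 < l < 1 ->
  (forall t, x <= t <= y -> regular_level P t) ->
  ln (level_integral P (l * x + (1 - l) * y)) <
    l * ln (level_integral P x) + (1 - l) * ln (level_integral P y).
Proof.
move=> xy l01 reg; apply: strict_log_convexity => //.
- exact: level_integral_gt0.
- exact: (continuous_level_integral n_gt1 P_monic P_size).
- move=> t c /andP[xt ty]; apply: level_integral_second_difference; apply: reg.
  by rewrite !ltW.
Qed.

End Convexity.

(** * Asymptotics of the length *)

Section Asymptotics.
Variable R : realType.
Local Notation C := R[i].
Implicit Types (t u v s : R).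

Variables (n : nat) (P : {poly C}).
Hypothesis n_gt1 : (1 < n)%N.
Hypothesis P_monic : P \is monic.
Hypothesis P_size : size P = n.+1.

Let n_gt0 : (0 < n)%N. Proof. exact: ltnW. Qed.
Let nR0 : 0 < n%:R :> R. Proof. by rewrite ltr0n. Qed.

(** Write [s ^ n] for the level. As [|P|] is the product of the distances to its zeros,
    which lie in a disc of radius [M0], the curve lies between the circles of
    radii [s - M0] and [s + M0]. Hence the distances from its points to the
    critical points are within [M] of [s], and [|P'|] is [n] times their product. *)
Lemma level_density_bounds : exists2 M : R, 0 < M & forall t u, M < expR (t / n%:R) ->
  regular_level P t /\
  expR (t / n%:R) / (1 + M * expR (- (t / n%:R))) ^+ n.-1 <= level_density P t u <=
  expR (t / n%:R) / (1 - M * expR (- (t / n%:R))) ^+ n.-1.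
Proof.
have [M0 M00 HM0] := fiber_bounded n_gt1 P_monic P_size 0.
have [M1 M10 HM1] := normc_seq_bounded (crit P).
pose M := M0 + M1.
have M_gt0 : 0 < M by rewrite ltr_wpDr.
exists M => //.
move=> t u; set s := expR (t / n%:R) => sM.
have s0 : 0 < s := expR_gt0 _.
have snE : s ^+ n = expR t by rewrite -expRM_natl mulrC divfK// gt_eqF.
have roots_le y : y \in fiber P 0 -> normc y <= M0.
  by rewrite (mem_fiber n_gt1 P_monic P_size) => /eqP Py; apply: HM0; rewrite Py normc0.
have normP z : normc P.[z] = \prod_(y <- fiber P 0) normc (z - y).
  by rewrite -normc_prod -(horner_fiber n_gt1 P_monic P_size) subr0.
have rootP z y : y \in fiber P 0 -> normc z - M0 <= normc (z - y) <= normc z + M0.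
  move=> /roots_le yM; apply/andP; split.
    by rewrite (le_trans _ (lerB_normc _ _))// lerB.
  by rewrite (le_trans (normcB _ _))// lerD2l.
have nz z : normc P.[z] = expR t -> s - M0 <= normc z <= s + M0.
  move=> Pz; apply/andP; split.
    suff : s <= normc z + M0 by rewrite lerBlDr.
    have zM : 0 <= normc z + M0 by rewrite addr_ge0 ?normc_ge0// ltW.
    rewrite -(ler_pXn2r n_gt0) ?nnegrE ?(ltW s0)// snE -Pz normP.
    rewrite -[X in _ ^+ X](size_fiber n_gt1 P_monic P_size 0).
    apply: prod_le_exp => y yP; rewrite normc_ge0/=.
    by have /andP[] := rootP z y yP.
  rewrite -lerBlDr; have [zM|zM] := ltP (normc z - M0) 0.
    by rewrite (le_trans (ltW zM))// ltW.
  rewrite -(ler_pXn2r n_gt0) ?nnegrE ?(ltW s0)// snE -Pz normP.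
  rewrite -[X in _ ^+ X](size_fiber n_gt1 P_monic P_size 0).
  apply: exp_le_prod => // y yP.
  by have /andP[] := rootP z y yP.
have critP z c : normc P.[z] = expR t -> c \in crit P ->
    s - M <= normc (z - c) <= s + M.
  move=> /nz /andP[z1 z2] /HM1 cM; apply/andP; split.
    by rewrite (le_trans _ (lerB_normc _ _))// /M opprD addrA lerB.
  by rewrite (le_trans (normcB _ _))// /M addrA lerD.
have sM0 : 0 < s + M by rewrite ltr_wpDr// ltW.
have sM' : 0 < s - M by rewrite subr_gt0.
have reg : regular_level P t.
  move=> zeta zc; apply/eqP => Pz.
  have zC : zeta \in crit P by rewrite (mem_crit n_gt1 P_monic P_size) zc.
  have := critP _ _ Pz zC; rewrite subrr normc0 => /andP[h _].
  by move: sM'; rewrite ltNge h.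
split => //.
have q0 : 0 < expR (- (t / n%:R)) by exact: expR_gt0.
have sq : s * expR (- (t / n%:R)) = 1 by rewrite /s -expRD subrr expR0.
set q := expR (- (t / n%:R)) in q0 sq *.
have plusE : s + M = s * (1 + M * q) by rewrite mulrDr mulr1 mulrCA sq mulr1.
have minusE : s - M = s * (1 - M * q) by rewrite mulrBr mulr1 mulrCA sq mulr1.
have plus0 : 0 < 1 + M * q by rewrite ltr_wpDr// mulr_ge0// ltW.
have minus0 : 0 < 1 - M * q by rewrite -(pmulr_rgt0 _ s0) -minusE.
have spd z : z \in fiber P (cexp t u) ->
    s / (1 + M * q) ^+ n.-1 / n%:R <= speed P z <= s / (1 - M * q) ^+ n.-1 / n%:R.
  rewrite (mem_fiber n_gt1 P_monic P_size) => /eqP Pz.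
  have nPz : normc P.[z] = expR t by rewrite Pz normc_cexp.
  have dE := normc_deriv n_gt1 P_monic P_size z.
  have d_le : normc P^`().[z] <= n%:R * (s + M) ^+ n.-1.
    rewrite dE ler_wpM2l ?(ltW nR0)// -(size_crit n_gt1 P_monic P_size).
    apply: prod_le_exp => c cP; rewrite normc_ge0/=.
    by have /andP[] := critP z c nPz cP.
  have d_ge : n%:R * (s - M) ^+ n.-1 <= normc P^`().[z].
    rewrite dE ler_wpM2l ?(ltW nR0)// -(size_crit n_gt1 P_monic P_size).
    apply: exp_le_prod => [|c cP]; first exact: ltW.
    by have /andP[] := critP z c nPz cP.
  have d0 : 0 < normc P^`().[z].
    by rewrite (lt_le_trans _ d_ge)// mulr_gt0 ?exprn_gt0.
  have sn : s ^+ n = s * s ^+ n.-1 by rewrite -exprS prednK.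
  rewrite /speed nPz -snE sn.
  have eq (y : R) : 0 < y -> s / y ^+ n.-1 / n%:R = s * s ^+ n.-1 / (n%:R * (s * y) ^+ n.-1).
    move=> y0; rewrite exprMn; field.
    by rewrite !expf_neq0 ?gt_eqF.
  rewrite !eq// -plusE -minusE; apply/andP; split.
    by rewrite ler_wpM2l ?mulr_ge0 ?exprn_ge0 ?(ltW s0)// lef_pV2 ?posrE ?mulr_gt0 ?exprn_gt0 ?ltr0n.
  by rewrite ler_wpM2l ?mulr_ge0 ?exprn_ge0 ?(ltW s0)// lef_pV2 ?posrE ?mulr_gt0 ?exprn_gt0 ?ltr0n.
have cst (k : R) : \sum_(z <- fiber P (cexp t u)) k / n%:R = k.
  rewrite big_const_seq count_predT (size_fiber n_gt1 P_monic P_size) iter_addr addr0.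
  by rewrite -[LHS]mulr_natr divfK// gt_eqF.
rewrite /level_density /fiber_sum.
rewrite -{1}[s / _]cst -[s / (1 - _) ^+ _]cst.
by apply/andP; split; rewrite big_seq [leRHS]big_seq; apply: ler_sum => z /spd /andP[].
Qed.

Lemma normalized_level_integral_cvg :
  level_integral P t * expR (- (t / n%:R)) @[t --> +oo] --> pi *+ 2.
Proof.
have [M M0 HM] := level_density_bounds.
pose q (t : R) := expR (- (t / n%:R)).
have tn : (t : R) / n%:R @[t --> +oo] --> +oo.
  have n0 : 0 < n%:R^-1 :> R by rewrite invr_gt0.
  exact: (@gt0_cvgMly R (pinfty_nbhs R) _ n%:R^-1 id n0 (@cvg_id _ _)).
have qcvg : q t @[t --> +oo] --> 0.
  exact: (@cvg_comp _ _ _ (fun t => t / n%:R) (fun y => expR (- y)) _ _ _ tn (@cvgr_expR R)).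
have lim (e : R) : e = 1 \/ e = -1 ->
    ((1 + e * M * q t) ^+ n.-1)^-1 * (pi *+ 2) @[t --> +oo] --> pi *+ 2.
  move=> eE; rewrite -[X in _ --> X]mul1r; apply: cvgM; last exact: cvg_cst.
  rewrite -[X in _ --> X]invr1; apply: cvgV => //.
  rewrite -[X in _ --> X](expr1n _ n.-1).
  have h : 1 + e * M * q t @[t --> +oo] --> (1 : R).
    rewrite -[X in _ --> X]addr0; apply: cvgD; first exact: cvg_cst.
    by rewrite -(mulr0 (e * M)); apply: cvgM => //; exact: cvg_cst.
  exact: (@cvg_comp _ _ _ (fun t => 1 + e * M * q t) (fun y => y ^+ n.-1) _ _ _ h (@exprn_continuous R n.-1 1)).
apply: (squeeze_cvgr _ (lim 1 (or_introl erefl)) (lim (-1) (or_intror erefl))).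
have : \forall t \near +oo, M < expR (t / n%:R).
  have [N Nb] : exists N, M < expR N by exists M; rewrite (lt_le_trans _ (expR_ge1Dx M))// ltrDr.
  have /cvgryPge/(_ N) := tn; apply: filterS => t Nt.
  by rewrite (lt_le_trans Nb)// ler_expR.
apply: filterS => t Mt.
have reg : regular_level P t by have [] := HM t 0 Mt.
have cF := continuous_level_density n_gt1 P_monic P_size reg.
have ccst (k : R) : continuous (fun _ : R => k) by move=> ?; exact: cvg_cst.
have h1 := circle_integral_le (ccst (expR (t / n%:R) / (1 + M * expR (- (t / n%:R))) ^+ n.-1)) cF
  (fun u => proj1 (andP (HM t u Mt).2)).
have h2 := circle_integral_le cF (ccst (expR (t / n%:R) / (1 - M * expR (- (t / n%:R))) ^+ n.-1))
  (fun u => proj2 (andP (HM t u Mt).2)).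
rewrite circle_integral_cst -(level_integral_circle n_gt1 P_monic P_size reg) in h1.
rewrite circle_integral_cst -(level_integral_circle n_gt1 P_monic P_size reg) in h2.
have sq : expR (t / n%:R) * q t = 1 by rewrite /q -expRD subrr expR0.
have q0 : 0 <= q t by exact: expR_ge0.
have {h1}h1 := ler_wpM2r q0 h1; have {h2}h2 := ler_wpM2r q0 h2.
have e (k y : R) : expR (t / n%:R) / k * y * q t = k^-1 * y.
  by transitivity (expR (t / n%:R) * q t * (k^-1 * y)); [ring|rewrite sq mul1r].
rewrite !e in h1 h2.
by rewrite mul1r mulN1r mulNr h1 h2.
Qed.

Lemma ln_level_integral_cvg :
  ln (level_integral P t) - t / n%:R @[t --> +oo] --> ln (2 * pi).
Proof.
have p0 : 0 < 2 * pi :> R by rewrite mulr_gt0 ?pi_gt0.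
have -> : (fun t => ln (level_integral P t) - t / n%:R) =
    (fun t => ln (level_integral P t * expR (- (t / n%:R)))).
  apply/funext => t; rewrite lnM ?posrE ?expR_gt0 ?expRK//.
  exact: (level_integral_gt0 n_gt1 P_monic P_size).
have h : level_integral P t * expR (- (t / n%:R)) @[t --> +oo] --> 2 * pi.
  by rewrite mulr_natl; exact: normalized_level_integral_cvg.
exact: (@cvg_comp _ _ _ _ (@ln R) _ _ _ h (continuous_ln p0)).
Qed.

End Asymptotics.

(** * Regular intervals *)

Section RegularIntervals.
Variable R : realType.
Local Notation C := R[i].

Lemma strictly_convex_onW (D : set R) (f : R -> R) :
  (forall x y l : R, D x -> D y -> x < y -> 0 < l < 1 ->
    f (l * x + (1 - l) * y) < l * f x + (1 - l) * f y) ->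
  strictly_convex_on D f.
Proof.
move=> H x y l Dx Dy; rewrite neq_lt => /orP[xy|yx] l01; first exact: H.
have l01' : 0 < 1 - l < 1 by case/andP: l01 => ? ?; apply/andP; split; lra.
have := H y x (1 - l) Dy Dx yx l01'.
have -> : 1 - (1 - l) = l by ring.
by rewrite addrC [X in _ < X -> _]addrC.
Qed.

Lemma strictly_convex_on_ln (D : set R) (f : R -> R) : (forall t, 0 < f t) ->
  strictly_convex_on D (fun t => ln (f t)) -> strictly_convex_on D f.
Proof.
move=> f0 H x y l Dx Dy xy l01; have {}H := H x y l Dx Dy xy l01.
set m := l * x + (1 - l) * y in H *.
case/andP: l01 => l0 l1.
rewrite -[f m](lnK (f0 m)) -[f x](lnK (f0 x)) -[f y](lnK (f0 y)).
move: (ln (f m)) (ln (f x)) (ln (f y)) H => k a b kab.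
have tangent (c q : R) : expR q * (1 + (c - q)) <= expR c.
  by rewrite -ler_pdivlMl ?expR_gt0// -expRN -expRD [- q + c]addrC expR_ge1Dx.
pose p := l * a + (1 - l) * b.
have kp : expR k < expR p by rewrite ltr_expR.
apply: (lt_le_trans kp).
have l1' : 0 <= 1 - l by rewrite subr_ge0 ltW.
have ha := ler_wpM2l (ltW l0) (tangent a p).
have hb := ler_wpM2l l1' (tangent b p).
apply: le_trans (lerD ha hb).
have -> : l * (expR p * (1 + (a - p))) + (1 - l) * (expR p * (1 + (b - p))) =
    expR p * (1 + (l * a + (1 - l) * b - p)).
  by move: (expR p) (p) => E q; ring.
by rewrite -/p subrr addr0 mulr1.
Qed.

Lemma regular_interval_not_critical (P : {poly C}) (j : nat) (t : R) : (1 < size P)%N ->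
  (1 <= j <= num_regular P)%N -> regular_interval P j t -> ~ critical_value_set P t.
Proof.
move=> sP; case: j => [//|j] /andP[_ jn] [/= lo hi] /(mem_critical_values t sP) ts.
set s := critical_values P in jn lo hi ts.
have sorted_s : sorted <%O s by exact: sorted_critical_values.
pose i := index t s.
have it : nth 0 s i = t by exact: nth_index.
have is_ : (i < size s)%N by rewrite index_mem.
have nthE k : (k < size s)%N -> crit_level P k.+1 = (nth 0 s k)%:E.
  by move=> ks; rewrite /crit_level /= (nth_map 0).
have mono := lt_sorted_ltn_nth 0 sorted_s.
rewrite /num_regular -/s ltnS in jn.
have ij : (i < j)%N.
  have [js|js] := ltnP j (size s); last exact: leq_trans is_ js.
  by move: hi; rewrite nthE// lte_fin -it mono.
case: j ij lo jn {hi} => [//|j] ij lo js.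
by move: lo; rewrite nthE// lte_fin -it mono// ltnNge -ltnS ij.
Qed.

Lemma regular_interval_convex (P : {poly C}) (j : nat) (x y t : R) :
  regular_interval P j x -> regular_interval P j y -> x <= t <= y -> regular_interval P j t.
Proof.
move=> [x1 _] [_ y2] /andP[xt ty]; split.
  by rewrite (lt_le_trans x1)// lee_fin.
by rewrite (le_lt_trans _ y2)// lee_fin.
Qed.

Lemma regular_interval_level (P : {poly C}) (j : nat) (t : R) : (1 < size P)%N ->
  (1 <= j <= num_regular P)%N -> regular_interval P j t -> regular_level P t.
Proof.
move=> sP jn tI zeta zc; apply/eqP => Pz.
apply: (regular_interval_not_critical sP jn tI); exists zeta.
  by split => //; rewrite -normc_gt0 Pz expR_gt0.
by rewrite Pz expRK.
Qed.

End RegularIntervals.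

Unset Implicit Arguments.
Set Strict Implicit.

Theorem theorem2 (R : realType) (n : nat) (P : {poly R[i]})
    (n_ge2 : (2 <= n)%N) (P_monic : P \is monic) (P_deg : size P = n.+1) :
  (forall t : R, (0 < hausdorff1 (lemniscate P t) < +oo)%E) /\
  continuous (indicator_fun P) /\
  continuous (lemniscate_length P) /\
  ((~ exists a : R[i], P = ('X - a%:P) ^+ n) ->
    (forall j : nat, (1 <= j <= num_regular P)%N ->
       strictly_convex_on (regular_interval P j) (indicator_fun P) /\
       strictly_convex_on (regular_interval P j) (lemniscate_length P)) /\
    (indicator_fun P t @[t --> +oo] --> ln (2 * pi))).
Proof.
have hE t : hausdorff1 (lemniscate P t) = (level_integral P t)%:E.
  by rewrite lemniscateE (hausdorff1_level_curve n_ge2 P_monic P_deg).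
have L0 := level_integral_gt0 n_ge2 P_monic P_deg.
have cL := continuous_level_integral n_ge2 P_monic P_deg.
have lE : lemniscate_length P = level_integral P.
  by apply/funext => t; rewrite /lemniscate_length hE.
have iE : indicator_fun P = (fun t => ln (level_integral P t) - t / n%:R).
  by apply/funext => t; rewrite /indicator_fun lE P_deg.
split; first by move=> t; rewrite hE lte_fin L0 ltry.
rewrite iE lE; split.
  move=> t; apply: cvgB.
    exact: (@continuous_comp _ _ _ (level_integral P) (@ln R) _ (cL t) (continuous_ln (L0 t))).
  by apply: cvgM; [exact: cvg_id|exact: cvg_cst].
split => // nontriv; split; last exact: (ln_level_integral_cvg n_ge2 P_monic P_deg).
have sP : (1 < size P)%N by rewrite P_deg ltnS ltnW.
move=> j jn.
have cvx : strictly_convex_on (regular_interval P j) (fun t => ln (level_integral P t)).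
  apply: strictly_convex_onW => x y l xI yI xy l01.
  apply: (ln_level_integral_strictly_convex n_ge2 P_monic P_deg nontriv) => // t txy.
  exact: (regular_interval_level sP jn (regular_interval_convex xI yI txy)).
split; last exact: strictly_convex_on_ln.
move=> x y l xI yI xy l01; rewrite -subr_gt0.
rewrite [X in 0 < X](_ : _ = l * ln (level_integral P x) + (1 - l) * ln (level_integral P y) -
    ln (level_integral P (l * x + (1 - l) * y))).
  by rewrite subr_gt0; exact: cvx.
by move: (level_integral P) => f; move: (n%:R^-1) => k; ring.
Qed.
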